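(* Let $C$ be a coherator, i.e. a globular extension which is free and $(\infty,0)$-contractible. Let $\infty\text{-}\mathrm{Gpd}_{\mathrm{str}}$ be the category of strict $\infty$-groupoids and let $\infty\text{-}\mathrm{Gpd}_C=\mathrm{Mod}(C)$ be the category of Grothendieck $\infty$-groupoids of type $C$ (globular presheaves on $C$). There exists a canonical functor $$\infty\text{-}\mathrm{Gpd}_{\mathrm{str}}\longrightarrow \infty\text{-}\mathrm{Gpd}_C ,$$ where canonical means: there is a unique globular functor $C\to\widetilde\Theta$ (morphism of globular theories), and the functor in question is the composite $\infty\text{-}\mathrm{Gpd}_{\mathrm{str}}\simeq\mathrm{Mod}(\widetilde\Theta)\to\mathrm{Mod}(C)$ it induces by restriction. Moreover, this functor is fully faithful.
   Context: Globe category. $\mathbb{G}$ has objects $D_0,D_1,\dots$ and is generated by $\sigma_i,\tau_i:D_{i-1}\to D_i$ ($i\ge1$) subject to $\sigma_{i+1}\sigma_i=\tau_{i+1}\sigma_i$ and $\sigma_{i+1}\tau_i=\tau_{i+1}\tau_i$. For $i\ge j$, $\sigma^i_j=\sigma_i\cdots\sigma_{j+1}$ and $\tau^i_j=\tau_i\cdots\tau_{j+1}$, from $D_j$ to $D_i$. A globular set is a presheaf on $\mathbb{G}$; $\mathbb{G}$ is regarded as a full subcategory of globular sets by Yoneda. Strict $\infty$-groupoids. A strict $\infty$-category is a globular set $G$ (sets $G_i$ of $i$-arrows, source and target maps $s_i,t_i:G_i\to G_{i-1}$, iterated to $s^i_j,t^i_j:G_i\to G_j$) with compositions $u\ast^i_j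 v$ for $i$-arrows with $s^i_j(u)=t^i_j(v)$, $i>j\ge0$, and identities $k_i:G_i\to G_{i+1}$, satisfying the usual source/target, associativity, exchange, identity and functoriality-of-identities axioms. It is a strict $\infty$-groupoid if every $i$-arrow $u:x\to y$, $i\ge1$, has a $\ast^i_{i-1}$-inverse $u^{-1}:y\to x$. Morphisms are the maps of globular sets preserving compositions and identities. $L$ denotes the left adjoint of the forgetful functor from strict $\infty$-groupoids to globular sets (free strict $\infty$-groupoid). Globular sums. A table of dimensions $T$ consists of integers $i_1,\dots,i_k\ge0$ and $i'_1,\dots,i'_{k-1}\ge0$ ($k\ge1$) with $i_l>i'_l<i_{l+1}$ for $1\le l\le k-1$; its dimension is the largest integer in it. In a category $C$ under $\mathbb{G}$ (a category with a functor $\mathbb{G}\to C$; images of objects and morphisms are denoted by the same symbols), the globular sum associated to $T$ is the colimit, if it exists, of the zigzag diagram $D_{i_1}\leftarrow D_{i'_1}\to D_{i_2}\leftarrow D_{i'_2}\to\cdots\leftarrow D_{i'_{k-1}}\to D_{i_k}$, whose maps are $\sigma^{i_l}_{i'_l}:D_{i'_l}\to D_{i_l}$ and $\tau^{i_{l+1}}_{i'_l}:D_{i'_l}\to D_{i_{l+1}}$. A globular extension is a category under $\mathbb{G}$ in which all globular sums exist. A globular functor between globular extensions is a functor under $\mathbb{G}$ preserving globular sums. $\Theta_0$ and globular theories. Let $G_T$ be the globular sum of $T$ in globular sets. $\Theta_0$ is the category whose objects are the tables of dimensions, with $\mathrm{Hom}_{\Theta_0}(S,T)=\mathrm{Hom}(G_S,G_T)$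 in globular sets; it is the initial globular extension (up to the choice of globular sums). A globular theory is a globular extension $C$ equipped with its globular functor $\Theta_0\to C$, which is bijective on objects. Morphisms (globular functors) between globular theories are the functors under $\Theta_0$. $\widetilde\Theta$. Its objects are the tables of dimensions, and $\mathrm{Hom}_{\widetilde\Theta}(S,T)$ is the set of morphisms of strict $\infty$-groupoids $L(G_S)\to L(G_T)$. It is a globular theory via the functor $\Theta_0\to\widetilde\Theta$ induced by $L$. Globular presheaves. For a globular theory $C$, $\mathrm{Mod}(C)$ is the full subcategory of presheaves of sets on $C$ consisting of those sending globular sums to the corresponding iterated fibre products (globular presheaves). A globular functor $C\to D$ induces by precomposition a functor $\mathrm{Mod}(D)\to\mathrm{Mod}(C)$. The canonical equivalence $\infty\text{-}\mathrm{Gpd}_{\mathrm{str}}\simeq\mathrm{Mod}(\widetilde\Theta)$ sends $G$ to $T\mapsto\mathrm{Hom}(L(G_T),G)$. Contractibility. Morphisms $f,g:D_n\to X$ in a globular extension are globularly parallel if $n=0$, or $n\geq 1$, $f\sigma_n=g\sigma_n$ and $f\tau_n=g\tau_n$. A lifting of $(f,g)$ is $h:D_{n+1}\to X$ with $h\sigma_{n+1}=f$ and $h\tau_{n+1}=g$. A pair $(f,g):D_n\to S$ is $(\infty,0)$-admissible if $f,g$ are globularly parallel and $S$ is a globular sum of dimension at most $n+1$. A globular extension is $(\infty,0)$-contractible if every admissible pair has a lifting. Free globular extensions. A cellular tower is a sequence of globular extensions and globular functors $C_0=\Theta_0\to C_1\to C_2\to\cdots$ with, for each $n$, a set $A_n$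 of admissible pairs of $C_n$, such that $C_{n+1}$ is obtained from $C_n$ by formally adding a lifting to each pair in $A_n$: $C_{n+1}$ carries a chosen lifting of the image of each pair of $A_n$, and for every globular extension $D$, every globular functor $F:C_n\to D$ and every choice of liftings in $D$ of the pairs $(F(f),F(g))$, $(f,g)\in A_n$, there is a unique globular functor $C_{n+1}\to D$ extending $F$ and sending the chosen liftings to the given ones. A globular extension is free if it is the colimit of a cellular tower; it is then a globular theory. *)

(* Defs.v *)
From mathcomp Require Import all_boot.
From Stdlib Require Import FunctionalExtensionality PropExtensionality.
From Stdlib Require Import ClassicalEpsilon.

Set Implicit Arguments.
Unset Strict Implicit.
Unset Printing Implicit Defensive.

(* Equality of functors, and of morphisms, is Leibniz equality throughout:
   the categories below are strict categories.                              *)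

Record category := Category {
  obj :> Type;
  hom : obj -> obj -> Type;
  idm : forall x, hom x x;
  cmp : forall x y z, hom y z -> hom x y -> hom x z;
  cmp1m : forall x y (f : hom x y), cmp (idm y) f = f;
  cmpm1 : forall x y (f : hom x y), cmp f (idm x) = f;
  cmpA : forall x y z w (h : hom z w) (g : hom y z) (f : hom x y),
    cmp h (cmp g f) = cmp (cmp h g) f }.

Notation "g '\c' f" := (cmp g f) (at level 50, left associativity).

Record functor (C D : category) := Functor {
  fob :> C -> D;
  fmor : forall x y, hom x y -> hom (fob x) (fob y);
  fmor1 : forall x, fmor (idm x) = idm (fob x);
  fmorM : forall x y z (g : hom y z) (f : hom x y),
    fmor (g \c f) = fmor g \c fmor f }.

Lemma fcomp1 (C D E : category) (G : functor D E) (F : functor C D) (x : C) :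
  fmor G (fmor F (idm x)) = idm (G (F x)).
Proof. by rewrite !fmor1. Qed.

Lemma fcompM (C D E : category) (G : functor D E) (F : functor C D)
    (x y z : C) (g : hom y z) (f : hom x y) :
  fmor G (fmor F (g \c f)) = fmor G (fmor F g) \c fmor G (fmor F f).
Proof. by rewrite !fmorM. Qed.

Definition fcomp (C D E : category) (G : functor D E) (F : functor C D) :
    functor C E :=
  @Functor C E (fun x => G (F x)) (fun x y f => fmor G (fmor F f))
    (fcomp1 G F) (fcompM G F).

Definition fid (C : category) : functor C C :=
  @Functor C C id (fun x y f => f) (fun x => erefl) (fun x y z g f => erefl).

Definition fully_faithful (C D : category) (F : functor C D) : Prop :=
  forall (x y : C) (g : hom (F x) (F y)), exists! f : hom x y, fmor F f = g.

(* A morphism together with its domain and codomain: used to compare morphisms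
   whose domains and codomains are only propositionally equal. *)
Record arrow (C : category) := Arrow {
  adom : C; acod : C; amor : hom adom acod }.

Arguments Arrow {C adom acod} amor.

(* The category with object type [A] and with the homs of [C] along [o]; it is
   the full subcategory on the [o a] when [o] is injective. *)
Definition full_on (C : category) (A : Type) (o : A -> C) : category :=
  @Category A (fun a b => hom (o a) (o b)) (fun a => idm (o a))
    (fun a b c g f => g \c f) (fun a b f => cmp1m f) (fun a b f => cmpm1 f)
    (fun a b c d h g f => cmpA h g f).

Definition full_on_incl (C : category) (A : Type) (o : A -> C) :
    functor (full_on o) C :=
  @Functor (full_on o) C o (fun a b f => f) (fun a => erefl)
    (fun a b c g f => erefl).

(* [Lt j i] is a proof-irrelevant (see [Lt_irr]) version of [j < i] on which one
   can recurse to build iterated sources, targets and identities. *)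
Inductive Lt (j : nat) : nat -> Set :=
| Lt1 : Lt j j.+1
| LtS i : Lt j i -> Lt j i.+1.

Arguments Lt1 {j}.

Lemma Lt_ltn j i : Lt j i -> j < i.
Proof. by elim=> // k _; apply: leqW. Qed.

Lemma ltn_Lt j i : j < i -> Lt j i.
Proof.
elim: i => // i IH; rewrite ltnS leq_eqVlt.
case: (altP (j =P i)) => [-> _|_ /= /IH]; [exact: Lt1 | exact: LtS].
Qed.

Lemma Lt_irr j i (p q : Lt j i) : p = q.
Proof.
elim: p q => [|k p IH] q.
- refine (match q as q' in Lt _ i' return
      (forall e : i' = j.+1, Lt1 = eq_rect _ (Lt j) q' _ e) with
    | Lt1 => _ | LtS k r => _ end erefl) => e.
  + by rewrite (eq_irrelevance e erefl).
  + by exfalso; have := Lt_ltn r; case: (e) => ->; rewrite ltnn.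
- move: p IH; refine (match q as q' in Lt _ i' return
      (forall (e : i' = k.+1) (p : Lt j k), (forall r, p = r) ->
        LtS p = eq_rect _ (Lt j) q' _ e) with
    | Lt1 => _ | LtS l r => _ end erefl) => e p IH.
  + by exfalso; have := Lt_ltn p; case: (e) => <-; rewrite ltnn.
  + case: (e) => lk; subst l.
    by rewrite (eq_irrelevance e erefl) /= (IH r).
Qed.

(* [iter_down s p] is [s_{j+1} ... s_i]. *)
Fixpoint iter_down (F : nat -> Type) (s : forall n, F n.+1 -> F n) j i
    (p : Lt j i) : F i -> F j :=
  match p in Lt _ i return F i -> F j with
  | Lt1 => fun x => s j x
  | LtS i p => fun x => iter_down s p (s i x)
  end.

Fixpoint iter_up (F : nat -> Type) (k : forall n, F n -> F n.+1) j i
    (p : Lt j i) : F j -> F i :=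
  match p in Lt _ i return F j -> F i with
  | Lt1 => fun x => k j x
  | LtS i p => fun x => k i (iter_up k p x)
  end.

(* A functor from the globe category to [C]. As the globe category is presented
   by generators and relations, this is an object for each generating object
   and a morphism for each generating morphism, subject to the relations. *)
Record globe_functor (C : category) := GlobeFunctor {
  disk :> nat -> C;
  sig : forall n, hom (disk n) (disk n.+1);
  tau : forall n, hom (disk n) (disk n.+1);
  sig_sig : forall n, sig n.+1 \c sig n = tau n.+1 \c sig n;
  sig_tau : forall n, sig n.+1 \c tau n = tau n.+1 \c tau n }.

Lemma push_sig_sig (C D : category) (F : functor C D) (K : globe_functor C) n :
  fmor F (sig K n.+1) \c fmor F (sig K n) =
  fmor F (tau K n.+1) \c fmor F (sig K n).
Proof. by rewrite -!fmorM sig_sig. Qed.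

Lemma push_sig_tau (C D : category) (F : functor C D) (K : globe_functor C) n :
  fmor F (sig K n.+1) \c fmor F (tau K n) =
  fmor F (tau K n.+1) \c fmor F (tau K n).
Proof. by rewrite -!fmorM sig_tau. Qed.

Definition push (C D : category) (F : functor C D) (K : globe_functor C) :
    globe_functor D :=
  @GlobeFunctor D (fun n => F (K n)) (fun n => fmor F (sig K n))
    (fun n => fmor F (tau K n)) (push_sig_sig F K) (push_sig_tau F K).

(* [tab i] is the type of tables of dimensions with [i_1 = i]:
   [Tab1 i] is the table (i), and [TabS p q T], for [T = (i_2, ..., i_k; ...)],
   is the table (i, i_2, ..., i_k; i', ...) with [i > i' < i_2]. *)
Inductive tab : nat -> Set :=
| Tab1 i : tab i
| TabS i i' i2 : Lt i' i -> Lt i' i2 -> tab i2 -> tab i.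

Record table := Table { thead : nat; ttab :> tab thead }.

Fixpoint tab_dim i (T : tab i) : nat :=
  match T with
  | Tab1 i => i
  | TabS i i' _ _ _ T' => maxn i (maxn i' (tab_dim T'))
  end.

(* Families [(x_1, ..., x_k)] with [x_l] in [F i_l]. *)
Fixpoint fam (F : nat -> Type) i (T : tab i) : Type :=
  match T with
  | Tab1 i => F i
  | TabS i _ _ _ _ T' => (F i * fam F T')%type
  end.

Definition fam_head (F : nat -> Type) i (T : tab i) : fam F T -> F i :=
  match T in tab i return fam F T -> F i with
  | Tab1 i => fun x => x
  | TabS i _ _ _ _ T' => fun x => x.1
  end.

Fixpoint fam_map (F F' : nat -> Type) (h : forall n, F n -> F' n) i
    (T : tab i) : fam F T -> fam F' T :=
  match T in tab i return fam F T -> fam F' T with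
  | Tab1 i => fun x => h i x
  | TabS i _ _ _ _ T' => fun x => (h i x.1, fam_map h x.2)
  end.

(* Families with [s^{i_l}_{i'_l}(x_l) = t^{i_{l+1}}_{i'_l}(x_{l+1})] for all [l],
   i.e. elements of the iterated fibre product
   [F_{i_1} x_{F_{i'_1}} F_{i_2} x ... x F_{i_k}]. *)
Fixpoint matching (F : nat -> Type) (s t : forall n, F n.+1 -> F n) i
    (T : tab i) : fam F T -> Prop :=
  match T in tab i return fam F T -> Prop with
  | Tab1 i => fun _ => True
  | TabS i _ _ p q T' => fun x =>
      iter_down s p x.1 = iter_down t q (fam_head x.2) /\ matching s t x.2
  end.

(* A cocone with vertex [X] on the zigzag diagram of [T] is a family of
   [f_l : D_{i_l} -> X] with [f_l sigma^{i_l}_{i'_l} = f_{l+1} tau^{i_{l+1}}_{i'_l}]. *)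
Definition is_cocone (C : category) (K : globe_functor C) (T : table) (X : C)
    (c : fam (fun n => hom (K n) X) T) : Prop :=
  matching (F := fun n => hom (K n) X)
    (fun n f => f \c sig K n) (fun n f => f \c tau K n) c.

Definition cocone_map (C : category) (K : globe_functor C) (T : table)
    (X Y : C) (h : hom X Y) :
    fam (fun n => hom (K n) X) T -> fam (fun n => hom (K n) Y) T :=
  fam_map (F := fun n => hom (K n) X) (F' := fun n => hom (K n) Y)
    (fun n f => h \c f) (T := T).

Definition is_globular_sum (C : category) (K : globe_functor C) (T : table)
    (X : C) (c : fam (fun n => hom (K n) X) T) : Prop :=
  is_cocone c /\
  forall (Y : C) (d : fam (fun n => hom (K n) Y) T), is_cocone d ->
    exists! h : hom X Y, cocone_map h c = d.

Record globular_extension := GlobularExtension {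
  ge_cat :> category;
  ge_globe : globe_functor ge_cat;
  ge_sums : forall T : table, exists (X : ge_cat)
    (c : fam (fun n => hom (ge_globe n) X) T), is_globular_sum c }.

Definition cocone_image (C D : category) (F : functor C D)
    (K : globe_functor C) (T : table) (X : C) :
    fam (fun n => hom (K n) X) T -> fam (fun n => hom (push F K n) (F X)) T :=
  fam_map (F := fun n => hom (K n) X) (F' := fun n => hom (push F K n) (F X))
    (fun n f => fmor F f) (T := T).

Definition preserves_sums (C D : category) (F : functor C D)
    (K : globe_functor C) : Prop :=
  forall (T : table) (X : C) (c : fam (fun n => hom (K n) X) T),
    is_globular_sum c -> is_globular_sum (cocone_image F c).

Record globular_functor (C D : globular_extension) := GlobularFunctor {
  gf_functor :> functor C D;
  gf_under : push gf_functor (ge_globe C) = ge_globe D;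
  gf_sums : preserves_sums gf_functor (ge_globe C) }.

Section FamFacts.
Variables (F F' F'' : nat -> Type) (h : forall n, F n -> F' n).
Variables (h' : forall n, F' n -> F'' n).

Lemma fam_map_comp i (T : tab i) (x : fam F T) :
  fam_map h' (fam_map h x) = fam_map (fun n y => h' (h y)) x.
Proof. by elim: T x => [//|i0 i' i2 p q T IH] [x y] /=; rewrite IH. Qed.

Lemma fam_map_ext (g : forall n, F n -> F' n) i (T : tab i) (x : fam F T) :
  (forall n (y : F n), h y = g n y) -> fam_map h x = fam_map g x.
Proof.
by move=> e; elim: T x => [//|i0 i' i2 p q T IH] [x y] /=; rewrite IH e.
Qed.

Lemma fam_map_id (g : forall n, F n -> F n) i (T : tab i) (x : fam F T) :
  (forall n y, g n y = y) -> fam_map g x = x.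
Proof.
by move=> e; elim: T x => [//|i0 i' i2 p q T IH] [x y] /=; rewrite IH e.
Qed.

Lemma fam_map_inj i (T : tab i) (x y : fam F T) :
  (forall n, injective (@h n)) -> fam_map h x = fam_map h y -> x = y.
Proof.
move=> e; elim: T x y => [i0 x y /=|i0 i' i2 p q T IH [x x'] [y y'] /=].
  exact: e.
by case=> /e -> /IH ->.
Qed.

Lemma fam_head_map i (T : tab i) (x : fam F T) :
  fam_head (fam_map h x) = h (fam_head x).
Proof. by case: T x. Qed.

Variables (s t : forall n, F n.+1 -> F n) (s' t' : forall n, F' n.+1 -> F' n).
Hypothesis hs : forall n x, h (s x) = s' (h x) :> F' n.
Hypothesis ht : forall n x, h (t x) = t' (h x) :> F' n.

Lemma iter_down_map (u : forall n, F n.+1 -> F n) (u' : forall n, F' n.+1 -> F' n)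
    j i (p : Lt j i) (x : F i) :
  (forall n x, h (u n x) = u' n (h x)) ->
  h (iter_down u p x) = iter_down u' p (h x).
Proof. by move=> e; elim: p x => //= k p IH x; rewrite IH e. Qed.

Lemma matching_map i (T : tab i) (x : fam F T) :
  matching s t x -> matching s' t' (fam_map h x).
Proof.
elim: T x => [//|i0 i' i2 p q T IH] [x y] /= [e /IH ?]; split=> //.
by rewrite fam_head_map -(iter_down_map p x hs) -(iter_down_map q _ ht) e.
Qed.

Lemma matching_map_inj i (T : tab i) (x : fam F T) :
  (forall n, injective (@h n)) -> matching s' t' (fam_map h x) ->
  matching s t x.
Proof.
move=> hi; elim: T x => [//|i0 i' i2 p q T IH] [x y] /= [e /IH ?]; split=> //.
apply: hi; rewrite (iter_down_map p x hs) (iter_down_map q _ ht).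
by rewrite -fam_head_map.
Qed.

End FamFacts.

Section SumFacts.
Variables (C : category) (K : globe_functor C).

Lemma cocone_map_comp (T : table) (X Y Z : C) (g : hom Y Z) (f : hom X Y)
    (c : fam (fun n => hom (K n) X) T) :
  cocone_map (g \c f) c = cocone_map g (cocone_map f c).
Proof.
by rewrite /cocone_map fam_map_comp; apply: fam_map_ext => n y; rewrite cmpA.
Qed.

Lemma cocone_map1 (T : table) (X : C) (c : fam (fun n => hom (K n) X) T) :
  cocone_map (idm X) c = c.
Proof. by apply: fam_map_id => n y; rewrite cmp1m. Qed.

Lemma is_cocone_map (T : table) (X Y : C) (f : hom X Y)
    (c : fam (fun n => hom (K n) X) T) :
  is_cocone c -> is_cocone (cocone_map f c).
Proof. by apply: matching_map => n y; rewrite cmpA. Qed.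

Lemma globular_sum_iso (T : table) (X X' : C)
    (c : fam (fun n => hom (K n) X) T) (c' : fam (fun n => hom (K n) X') T) :
  is_globular_sum c -> is_globular_sum c' ->
  exists (h : hom X X') (g : hom X' X),
    [/\ cocone_map h c = c', g \c h = idm X & h \c g = idm X'].
Proof.
move=> [cc uc] [cc' uc'].
case: (uc _ _ cc') => h [hc _]; case: (uc' _ _ cc) => g [gc _].
exists h, g; split=> //.
- case: (uc _ _ cc) => k [_ ku].
  rewrite -(ku (g \c h)) ?cocone_map_comp ?hc ?gc //.
  by apply: ku; rewrite cocone_map1.
- case: (uc' _ _ cc') => k [_ ku].
  rewrite -(ku (h \c g)) ?cocone_map_comp ?gc ?hc //.
  by apply: ku; rewrite cocone_map1.
Qed.

Lemma iso_globular_sum (T : table) (X X' : C) (h : hom X X') (g : hom X' X)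
    (c : fam (fun n => hom (K n) X) T) :
  g \c h = idm X -> h \c g = idm X' -> is_globular_sum c ->
  is_globular_sum (cocone_map h c).
Proof.
move=> gh hg [cc uc]; split; first exact: is_cocone_map.
move=> Y d /uc [k [kc ku]]; exists (k \c g); split.
  by rewrite -cocone_map_comp -cmpA gh cmpm1.
by move=> l; rewrite -cocone_map_comp => /ku ->; rewrite -cmpA hg cmpm1.
Qed.

End SumFacts.

Lemma cocone_image_map (C D : category) (F : functor C D)
    (K : globe_functor C) (T : table) (X Y : C) (h : hom X Y)
    (c : fam (fun n => hom (K n) X) T) :
  cocone_image F (cocone_map h c) = cocone_map (K := push F K) (fmor F h) (cocone_image F c).
Proof.
rewrite /cocone_image /cocone_map !fam_map_comp.
by apply: fam_map_ext => n f; rewrite fmorM.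
Qed.

Lemma preserves_sums_of (C D : category) (F : functor C D)
    (K : globe_functor C) :
  (forall T : table, exists (X : C) (c : fam (fun n => hom (K n) X) T),
     is_globular_sum c /\ is_globular_sum (cocone_image F c)) ->
  preserves_sums F K.
Proof.
move=> H T X c cs; have [X0 [c0 [c0s Fc0]]] := H T.
have [h [g [<- gh hg]]] := globular_sum_iso c0s cs.
rewrite cocone_image_map; apply: (iso_globular_sum (g := fmor F g)) => //.
- by rewrite -fmorM gh fmor1.
- by rewrite -fmorM hg fmor1.
Qed.

Lemma cocone_image_comp (C D E : category) (G : functor D E) (F : functor C D)
    (K : globe_functor C) (T : table) (X : C) (c : fam (fun n => hom (K n) X) T) :
  cocone_image (fcomp G F) c = cocone_image G (cocone_image F c).
Proof. by rewrite /cocone_image fam_map_comp. Qed.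

Lemma eq_globe_functor (C : category) (K K' : globe_functor C)
    (e : disk K = disk K') :
  eq_rect _ (fun d : nat -> C => forall n, hom (d n) (d n.+1)) (@sig C K) _ e = @sig C K' ->
  eq_rect _ (fun d : nat -> C => forall n, hom (d n) (d n.+1)) (@tau C K) _ e = @tau C K' ->
  K = K'.
Proof.
case: K K' e => [d s t r r'] [d' s1 t1 r1 r1'] /= e; subst d' => /= ? ?.
subst s1 t1; congr GlobeFunctor; exact: proof_irrelevance.
Qed.

Lemma eq_functor (C D : category) (F G : functor C D) (e : fob F = fob G) :
  eq_rect _ (fun o : C -> D => forall x y, hom x y -> hom (o x) (o y))
    (@fmor _ _ F) _ e = @fmor _ _ G -> F = G.
Proof.
case: F G e => [o m r r'] [o' m' r1 r1'] /= e; subst o' => /= ?.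
subst m'; congr Functor; exact: proof_irrelevance.
Qed.

Lemma fcompA (A B C D : category) (H : functor C D) (G : functor B C)
    (F : functor A B) : fcomp H (fcomp G F) = fcomp (fcomp H G) F.
Proof. by congr Functor; apply: proof_irrelevance. Qed.

Lemma push_comp (A B C : category) (G : functor B C) (F : functor A B)
    (K : globe_functor A) : push (fcomp G F) K = push G (push F K).
Proof. by congr GlobeFunctor; apply: proof_irrelevance. Qed.

Lemma preserves_sums_comp (A B C : category) (G : functor B C) (F : functor A B)
    (K : globe_functor A) :
  preserves_sums F K -> preserves_sums G (push F K) ->
  preserves_sums (fcomp G F) K.
Proof.
move=> hF hG T X c cs; have {}cs := hG _ _ _ (hF _ _ _ cs).
by rewrite -cocone_image_comp in cs.
Qed.

Lemma globular_comp_under (A B C : globular_extension)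
    (G : globular_functor B C) (F : globular_functor A B) :
  push (fcomp G F) (ge_globe A) = ge_globe C.
Proof. by rewrite push_comp !gf_under. Qed.

Lemma globular_comp_sums (A B C : globular_extension)
    (G : globular_functor B C) (F : globular_functor A B) :
  preserves_sums (fcomp G F) (ge_globe A).
Proof.
apply: preserves_sums_comp; first exact: gf_sums.
rewrite gf_under; exact: gf_sums.
Qed.

Definition globular_comp (A B C : globular_extension)
    (G : globular_functor B C) (F : globular_functor A B) :
    globular_functor A C :=
  GlobularFunctor (globular_comp_under G F) (@globular_comp_sums A B C G F).

Lemma eq_globular_functor (C D : globular_extension)
    (F G : globular_functor C D) : F = G :> functor C D -> F = G.
Proof.
case: F G => [F u s] [G u' s'] /= e; subst G.
by congr GlobularFunctor; apply: proof_irrelevance.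
Qed.

(* The quotient of [X] by the equivalence relation generated by [R], as the set
   of equivalence classes. *)
Inductive eqv_gen (X : Type) (R : X -> X -> Prop) : X -> X -> Prop :=
| eqv_rel x y : R x y -> eqv_gen R x y
| eqv_refl x : eqv_gen R x x
| eqv_sym x y : eqv_gen R x y -> eqv_gen R y x
| eqv_trans x y z : eqv_gen R x y -> eqv_gen R y z -> eqv_gen R x z.

Definition quot (X : Type) (R : X -> X -> Prop) : Type :=
  {P : X -> Prop | exists x, P = eqv_gen R x}.

Section Quotient.
Variables (X : Type) (R : X -> X -> Prop).

Definition qcl (x : X) : quot R :=
  exist _ (eqv_gen R x) (ex_intro _ x erefl).

Lemma qcl_eqv x y : eqv_gen R x y -> qcl x = qcl y.
Proof.
move=> xy; have e : eqv_gen R x = eqv_gen R y.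
  apply: functional_extensionality => z; apply: propositional_extensionality.
  by split; apply: eqv_trans => //; apply: eqv_sym.
by apply: eq_sig_hprop => // P; apply: proof_irrelevance.
Qed.

Lemma qcl_rel x y : R x y -> qcl x = qcl y.
Proof. by move=> xy; apply/qcl_eqv/eqv_rel. Qed.

Lemma qcl_inj x y : qcl x = qcl y -> eqv_gen R x y.
Proof. by case=> ->; apply: eqv_refl. Qed.

Lemma qcl_surj (q : quot R) : exists x, qcl x = q.
Proof.
case: q => P [x e]; exists x; subst P.
by apply: eq_sig_hprop => // P; apply: proof_irrelevance.
Qed.

Definition qrep (q : quot R) : X :=
  proj1_sig (constructive_indefinite_description _ (qcl_surj q)).

Lemma qrepK q : qcl (qrep q) = q.
Proof. exact: proj2_sig (constructive_indefinite_description _ (qcl_surj q)). Qed.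

Definition qlift (Y : Type) (f : X -> Y) (q : quot R) : Y := f (qrep q).

Lemma qliftE (Y : Type) (f : X -> Y) x :
  (forall x y, R x y -> f x = f y) -> qlift f (qcl x) = f x.
Proof.
move=> fR; have fE a b : eqv_gen R a b -> f a = f b.
  by elim=> // c d e _ -> _ ->.
exact/fE/qcl_inj/qrepK.
Qed.

End Quotient.

Record gset := GSet {
  cell :> nat -> Type;
  gsrc : forall n, cell n.+1 -> cell n;
  gtgt : forall n, cell n.+1 -> cell n;
  gsrc_src : forall n (x : cell n.+2), gsrc (gsrc x) = gsrc (gtgt x);
  gtgt_src : forall n (x : cell n.+2), gtgt (gsrc x) = gtgt (gtgt x) }.

Record gmap (G H : gset) := GMap {
  gfun :> forall n, G n -> H n;
  gfun_src : forall n (x : G n.+1), gfun (gsrc x) = gsrc (gfun x);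
  gfun_tgt : forall n (x : G n.+1), gfun (gtgt x) = gtgt (gfun x) }.

Lemma eq_gmap (G H : gset) (f g : gmap G H) :
  (forall n (x : G n), f n x = g n x) -> f = g.
Proof.
case: f g => [f fs ft] [g gs gt] /= e.
have e' : f = g by do 2!apply: functional_extensionality_dep => ?; apply: e.
by subst g; congr GMap; apply: proof_irrelevance.
Qed.

Definition gmap_id (G : gset) : gmap G G :=
  @GMap G G (fun n x => x) (fun n x => erefl) (fun n x => erefl).

Section GMapComp.
Variables (G H I : gset) (g : gmap H I) (f : gmap G H).

Lemma gmap_comp_src n (x : G n.+1) : g n (f n (gsrc x)) = gsrc (g _ (f _ x)).
Proof. by rewrite !gfun_src. Qed.

Lemma gmap_comp_tgt n (x : G n.+1) : g n (f n (gtgt x)) = gtgt (g _ (f _ x)).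
Proof. by rewrite !gfun_tgt. Qed.

Definition gmap_comp : gmap G I :=
  @GMap G I (fun n x => g n (f n x)) gmap_comp_src gmap_comp_tgt.

End GMapComp.

Lemma gmap_comp1m (G H : gset) (f : gmap G H) : gmap_comp (gmap_id H) f = f.
Proof. exact: eq_gmap. Qed.

Lemma gmap_compm1 (G H : gset) (f : gmap G H) : gmap_comp f (gmap_id G) = f.
Proof. exact: eq_gmap. Qed.

Lemma gmap_compA (A B C D : gset) (h : gmap C D) (g : gmap B C) (f : gmap A B) :
  gmap_comp h (gmap_comp g f) = gmap_comp (gmap_comp h g) f.
Proof. exact: eq_gmap. Qed.

Definition gset_cat : category :=
  @Category gset gmap gmap_id gmap_comp gmap_comp1m gmap_compm1 gmap_compA.

Definition isrc (G : gset) j i (p : Lt j i) : G i -> G j :=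
  iter_down (@gsrc G) p.
Definition itgt (G : gset) j i (p : Lt j i) : G i -> G j :=
  iter_down (@gtgt G) p.

Lemma isrc_src (G : gset) j i (p : Lt j i) (x : G i.+1) :
  isrc p (gsrc x) = isrc p (gtgt x).
Proof. by case: i / p x => [|i p] x; rewrite /isrc /= gsrc_src. Qed.

Lemma itgt_tgt (G : gset) j i (p : Lt j i) (x : G i.+1) :
  itgt p (gtgt x) = itgt p (gsrc x).
Proof. by case: i / p x => [|i p] x; rewrite /itgt /= gtgt_src. Qed.

Lemma gsrc_isrc (G : gset) j i (p : Lt j.+1 i) (q : Lt j i) (x : G i) :
  gsrc (isrc p x) = isrc q x.
Proof.
elim: p q x => [|k p IH] q x.
  by rewrite (Lt_irr q (LtS Lt1)).
have q' : Lt j k by apply: ltn_Lt; apply: ltn_trans (Lt_ltn p).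
by rewrite (Lt_irr q (LtS q')); apply: (IH q' (gsrc x)).
Qed.

Lemma gsrc_itgt (G : gset) j i (p : Lt j.+1 i) (q : Lt j i) (x : G i) :
  gsrc (itgt p x) = isrc q x.
Proof.
elim: p q x => [|k p IH] q x.
  by rewrite (Lt_irr q (LtS Lt1)) /= /isrc /= gsrc_src.
have q' : Lt j k by apply: ltn_Lt; apply: ltn_trans (Lt_ltn p).
by rewrite (Lt_irr q (LtS q')) [LHS](IH q' (gtgt x)) -isrc_src.
Qed.

Lemma gtgt_itgt (G : gset) j i (p : Lt j.+1 i) (q : Lt j i) (x : G i) :
  gtgt (itgt p x) = itgt q x.
Proof.
elim: p q x => [|k p IH] q x.
  by rewrite (Lt_irr q (LtS Lt1)).
have q' : Lt j k by apply: ltn_Lt; apply: ltn_trans (Lt_ltn p).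
by rewrite (Lt_irr q (LtS q')); apply: (IH q' (gtgt x)).
Qed.

Lemma gtgt_isrc (G : gset) j i (p : Lt j.+1 i) (q : Lt j i) (x : G i) :
  gtgt (isrc p x) = itgt q x.
Proof.
elim: p q x => [|k p IH] q x.
  by rewrite (Lt_irr q (LtS Lt1)) /= /itgt /= gtgt_src.
have q' : Lt j k by apply: ltn_Lt; apply: ltn_trans (Lt_ltn p).
by rewrite (Lt_irr q (LtS q')) [LHS](IH q' (gsrc x)) -itgt_tgt.
Qed.

Lemma gfun_isrc (G H : gset) (f : gmap G H) j i (p : Lt j i) (x : G i) :
  f j (isrc p x) = isrc p (f i x).
Proof. by apply: iter_down_map => n y; apply: gfun_src. Qed.

Lemma gfun_itgt (G H : gset) (f : gmap G H) j i (p : Lt j i) (x : G i) :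
  f j (itgt p x) = itgt p (f i x).
Proof. by apply: iter_down_map => n y; apply: gfun_tgt. Qed.

(* [globe j i] is the set of morphisms from [D_j] to [D_i] in the globe category:
   the identity if [j = i], and [sigma^i_j] and [tau^i_j] if [j < i]. *)
Inductive globe (j : nat) : nat -> Set :=
| Gid : globe j j
| Gsig i : Lt j i -> globe j i
| Gtau i : Lt j i -> globe j i.

Arguments Gid {j}.

Fixpoint Lt_pred j i (p : Lt j.+1 i) : Lt j i :=
  match p in Lt _ i return Lt j i with
  | Lt1 => LtS Lt1
  | LtS i p => LtS (Lt_pred p)
  end.

(* [globe_src] and [globe_tgt] precompose with [sigma_{j+1}] and [tau_{j+1}]. *)
Definition globe_src j i (f : globe j.+1 i) : globe j i :=
  match f in globe _ i return globe j i with
  | Gid => Gsig Lt1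
  | Gsig i p => Gsig (Lt_pred p)
  | Gtau i p => Gsig (Lt_pred p)
  end.

Definition globe_tgt j i (f : globe j.+1 i) : globe j i :=
  match f in globe _ i return globe j i with
  | Gid => Gtau Lt1
  | Gsig i p => Gtau (Lt_pred p)
  | Gtau i p => Gtau (Lt_pred p)
  end.

Lemma globe_src_src i j (f : globe j.+2 i) :
  globe_src (globe_src f) = globe_src (globe_tgt f).
Proof. by case: f. Qed.

Lemma globe_tgt_src i j (f : globe j.+2 i) :
  globe_tgt (globe_src f) = globe_tgt (globe_tgt f).
Proof. by case: f. Qed.

Definition gdisk (i : nat) : gset :=
  @GSet (fun j => globe j i) (fun j => @globe_src j i) (fun j => @globe_tgt j i)
    (@globe_src_src i) (@globe_tgt_src i).

(* The map [D_i -> G] given by [x] under the Yoneda lemma. *)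
Definition yo_fun (G : gset) i (x : G i) n (f : gdisk i n) : G n :=
  match f in globe _ i return G i -> G n with
  | Gid => fun x => x
  | Gsig i p => isrc p
  | Gtau i p => itgt p
  end x.

Lemma yo_src (G : gset) i (x : G i) n (f : gdisk i n.+1) :
  yo_fun x (gsrc f) = gsrc (yo_fun x f).
Proof.
rewrite /=; case: i / f x => [|i p|i p] x //=.
- by rewrite (gsrc_isrc p (Lt_pred p)).
- by rewrite (gsrc_itgt p (Lt_pred p)).
Qed.

Lemma yo_tgt (G : gset) i (x : G i) n (f : gdisk i n.+1) :
  yo_fun x (gtgt f) = gtgt (yo_fun x f).
Proof.
rewrite /=; case: i / f x => [|i p|i p] x //=.
- by rewrite (gtgt_isrc p (Lt_pred p)).
- by rewrite (gtgt_itgt p (Lt_pred p)).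
Qed.

Definition yo (G : gset) i (x : G i) : gmap (gdisk i) G :=
  @GMap (gdisk i) G (@yo_fun G i x) (@yo_src G i x) (@yo_tgt G i x).

Lemma isrc_itgt_Gid i k j (p : Lt j i) : i - j <= k ->
  isrc p (Gid : gdisk i i) = Gsig p /\ itgt p (Gid : gdisk i i) = Gtau p.
Proof.
elim: k j p => [|k IH] j p ijk.
  by have := Lt_ltn p; rewrite -subn_gt0 ltnNge ijk.
have [q|ij] := ltnP j.+1 i; last first.
  have e : i = j.+1 by apply/eqP; rewrite eqn_leq ij Lt_ltn.
  by subst i; rewrite (Lt_irr p Lt1).
have {}q := ltn_Lt q; have [|s t] := IH _ q.
  by rewrite subnS; move: ijk (Lt_ltn q); case: (i - j).
rewrite -(gsrc_isrc q) -(gtgt_itgt q) s t /=.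
by rewrite (Lt_irr (Lt_pred q) p).
Qed.

Lemma isrc_Gid i j (p : Lt j i) : isrc p (Gid : gdisk i i) = Gsig p.
Proof. by case: (isrc_itgt_Gid p (leqnn _)). Qed.

Lemma itgt_Gid i j (p : Lt j i) : itgt p (Gid : gdisk i i) = Gtau p.
Proof. by case: (isrc_itgt_Gid p (leqnn _)). Qed.

Lemma yo_uniq (G : gset) i (f : gmap (gdisk i) G) : f = yo (f i Gid).
Proof.
apply: eq_gmap => n d; rewrite /=; case: i / d f => [//|i p|i p] f /=.
- by rewrite -isrc_Gid gfun_isrc.
- by rewrite -itgt_Gid gfun_itgt.
Qed.

Lemma gdisk_ext (G : gset) i (f g : gmap (gdisk i) G) :
  f i Gid = g i Gid -> f = g.
Proof. by move=> e; rewrite (yo_uniq f) (yo_uniq g) e. Qed.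

Definition gdisk_sig n : gmap (gdisk n) (gdisk n.+1) :=
  yo (G := gdisk n.+1) (Gsig Lt1).
Definition gdisk_tau n : gmap (gdisk n) (gdisk n.+1) :=
  yo (G := gdisk n.+1) (Gtau Lt1).

Lemma gdisk_sig_sig n : gmap_comp (gdisk_sig n.+1) (gdisk_sig n) =
  gmap_comp (gdisk_tau n.+1) (gdisk_sig n).
Proof. exact: gdisk_ext. Qed.

Lemma gdisk_sig_tau n : gmap_comp (gdisk_sig n.+1) (gdisk_tau n) =
  gmap_comp (gdisk_tau n.+1) (gdisk_tau n).
Proof. exact: gdisk_ext. Qed.

Definition gset_globe : globe_functor gset_cat :=
  @GlobeFunctor gset_cat gdisk gdisk_sig gdisk_tau gdisk_sig_sig gdisk_sig_tau.

Section Pushout.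
Variables (A B C : gset) (f : gmap A B) (g : gmap A C).

Definition po_rel n (x y : B n + C n) : Prop :=
  exists a : A n, x = inl (f n a) /\ y = inr (g n a).

Definition po_cell n : Type := quot (@po_rel n).

Definition po_inl n (b : B n) : po_cell n := qcl (@po_rel n) (inl b).
Definition po_inr n (c : C n) : po_cell n := qcl (@po_rel n) (inr c).

Lemma po_glue n (a : A n) : po_inl (f n a) = po_inr (g n a).
Proof. by apply: qcl_rel; exists a. Qed.

Definition po_case n (Y : Type) (b : B n -> Y) (c : C n -> Y) : po_cell n -> Y :=
  qlift (fun x => match x with inl x => b x | inr x => c x end).

Section Case.
Variables (n : nat) (Y : Type) (b : B n -> Y) (c : C n -> Y).
Hypothesis bc : forall a : A n, b (f n a) = c (g n a).

Lemma po_caseL x : po_case b c (po_inl x) = b x.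
Proof. by rewrite /po_case qliftE // => _ _ [a [-> ->]]. Qed.

Lemma po_caseR x : po_case b c (po_inr x) = c x.
Proof. by rewrite /po_case qliftE // => _ _ [a [-> ->]]. Qed.

End Case.

Lemma po_ind n (P : po_cell n -> Prop) :
  (forall b, P (po_inl b)) -> (forall c, P (po_inr c)) -> forall x, P x.
Proof.
by move=> Pb Pc x; have [[b|c] <-] := qcl_surj x; [apply: Pb | apply: Pc].
Qed.

Definition po_src n : po_cell n.+1 -> po_cell n :=
  po_case (fun b => po_inl (gsrc b)) (fun c => po_inr (gsrc c)).
Definition po_tgt n : po_cell n.+1 -> po_cell n :=
  po_case (fun b => po_inl (gtgt b)) (fun c => po_inr (gtgt c)).

Lemma po_srcL n (b : B n.+1) : po_src (po_inl b) = po_inl (gsrc b).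
Proof. by rewrite /po_src po_caseL // => a; rewrite -!gfun_src po_glue. Qed.
Lemma po_srcR n (c : C n.+1) : po_src (po_inr c) = po_inr (gsrc c).
Proof. by rewrite /po_src po_caseR // => a; rewrite -!gfun_src po_glue. Qed.
Lemma po_tgtL n (b : B n.+1) : po_tgt (po_inl b) = po_inl (gtgt b).
Proof. by rewrite /po_tgt po_caseL // => a; rewrite -!gfun_tgt po_glue. Qed.
Lemma po_tgtR n (c : C n.+1) : po_tgt (po_inr c) = po_inr (gtgt c).
Proof. by rewrite /po_tgt po_caseR // => a; rewrite -!gfun_tgt po_glue. Qed.

Lemma po_src_src n (x : po_cell n.+2) : po_src (po_src x) = po_src (po_tgt x).
Proof.
by elim/po_ind: x => x; rewrite !(po_srcL, po_srcR, po_tgtL, po_tgtR) gsrc_src.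
Qed.

Lemma po_tgt_src n (x : po_cell n.+2) : po_tgt (po_src x) = po_tgt (po_tgt x).
Proof.
by elim/po_ind: x => x; rewrite !(po_srcL, po_srcR, po_tgtL, po_tgtR) gtgt_src.
Qed.

Definition pushout : gset := GSet po_src_src po_tgt_src.

Definition pushout_inl : gmap B pushout :=
  @GMap B pushout po_inl (fun n x => esym (po_srcL x)) (fun n x => esym (po_tgtL x)).
Definition pushout_inr : gmap C pushout :=
  @GMap C pushout po_inr (fun n x => esym (po_srcR x)) (fun n x => esym (po_tgtR x)).

Lemma pushout_univ (H : gset) (b : gmap B H) (c : gmap C H) :
  gmap_comp b f = gmap_comp c g ->
  exists! h : gmap pushout H, gmap_comp h pushout_inl = b /\
                              gmap_comp h pushout_inr = c.
Proof.
move=> e; have bc n (a : A n) : b n (f n a) = c n (g n a).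
  exact: (f_equal (fun k : gmap A H => k n a) e).
pose h n : pushout n -> H n := po_case (b n) (c n).
have hs n (x : pushout n.+1) : h n (gsrc x) = gsrc (h _ x).
  by elim/po_ind: x => x; rewrite /= (po_srcL, po_srcR) /h
    !(po_caseL (@bc _), po_caseR (@bc _)) gfun_src.
have ht n (x : pushout n.+1) : h n (gtgt x) = gtgt (h _ x).
  by elim/po_ind: x => x; rewrite /= (po_tgtL, po_tgtR) /h
    !(po_caseL (@bc _), po_caseR (@bc _)) gfun_tgt.
exists (GMap hs ht); split.
  by split; apply: eq_gmap => n x /=; rewrite /h ?(po_caseL (@bc _), po_caseR (@bc _)).
move=> k [kb kc]; apply: eq_gmap => n; apply: po_ind => x /=; rewrite /h.
- by rewrite (po_caseL (@bc _)) -kb.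
- by rewrite (po_caseR (@bc _)) -kc.
Qed.

End Pushout.

(* [G_T], together with the [i_1]-cell corresponding to [D_{i_1} -> G_T], as the
   iterated pushout of [D_{i_1} <- D_{i'_1} -> G_{T'}]: by [gsum_is_globular_sum]
   below, this is the colimit of the zigzag of [T]. *)
Fixpoint gsum_rec i (T : tab i) : {G : gset & G i} :=
  match T in tab i return {G : gset & G i} with
  | Tab1 i => existT (fun G : gset => G i) (gdisk i) Gid
  | TabS i i' i2 p q T' =>
      let f := yo (G := gdisk i) (Gsig p) in
      let g := yo (itgt q (projT2 (gsum_rec T'))) in
      existT (fun G : gset => G i) (pushout f g) (po_inl f g Gid)
  end.

Definition gsum (T : table) : gset := projT1 (gsum_rec T).

Fixpoint gsum_legs_rec i (T : tab i) : fam (projT1 (gsum_rec T)) T :=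
  match T in tab i return fam (projT1 (gsum_rec T)) T with
  | Tab1 i => Gid
  | TabS i i' i2 p q T' =>
      let f := yo (G := gdisk i) (Gsig p) in
      let g := yo (itgt q (projT2 (gsum_rec T'))) in
      (po_inl f g Gid, fam_map (@po_inr _ _ _ f g) (gsum_legs_rec T'))
  end.

Lemma gsum_legs_head i (T : tab i) :
  fam_head (gsum_legs_rec T) = projT2 (gsum_rec T).
Proof. by case: T. Qed.

Lemma gsum_legs_matching i (T : tab i) :
  matching (@gsrc _) (@gtgt _) (gsum_legs_rec T).
Proof.
elim: T => [//|i0 i' i2 p q T IH] /=; split; last first.
  by apply: matching_map IH => n x; [apply: (gfun_src (pushout_inr _ _))
    | apply: (gfun_tgt (pushout_inr _ _))].
set f := yo _; set g := yo _.
rewrite fam_head_map gsum_legs_head.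
rewrite -[LHS](gfun_isrc (pushout_inl f g)) -[RHS](gfun_itgt (pushout_inr f g)).
by rewrite isrc_Gid; apply: (po_glue f g Gid).
Qed.

Lemma gsum_univ i (T : tab i) (H : gset) (y : fam H T) :
  matching (@gsrc H) (@gtgt H) y ->
  exists! h : gmap (projT1 (gsum_rec T)) H, fam_map h (gsum_legs_rec T) = y.
Proof.
elim: T y => [i0 y _|i0 i' i2 p q T IH [x y] /= [xy /IH [h [hy hu]]]].
  by exists (yo y); split=> // h <-; rewrite -yo_uniq.
set f := yo _; set g := yo _.
have [|k [[kx kh] ku]] := @pushout_univ _ _ _ f g H (yo x) h.
  apply: gdisk_ext; rewrite /= -[LHS]/(isrc p x) gfun_itgt -gsum_legs_head.
  by rewrite [LHS]xy -hy fam_head_map.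
exists k; split.
  rewrite -[x in RHS]/(yo x _ Gid) -kx -hy -kh fam_map_comp; congr pair.
move=> l [lx ly]; apply: ku; split.
  by apply: gdisk_ext.
apply/esym/hu; rewrite -ly fam_map_comp; exact: fam_map_ext.
Qed.

Definition gsum_legs (T : table) : fam (fun n => gmap (gdisk n) (gsum T)) T :=
  fam_map (F' := fun n => gmap (gdisk n) (gsum T)) (@yo (gsum T)) (gsum_legs_rec T).

Lemma gsum_is_globular_sum (T : table) :
  is_globular_sum (K := gset_globe) (gsum_legs T).
Proof.
have yoE (G : gset) n (x : G n.+1) :
    gmap_comp (yo x) (gdisk_sig n) = yo (gsrc x) /\
    gmap_comp (yo x) (gdisk_tau n) = yo (gtgt x).
  by split; apply: gdisk_ext.
split.
  apply: matching_map (gsum_legs_matching T) => n x /=; first by case: (yoE _ n x).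
  by case: (yoE _ n x).
move=> H d dc.
pose ev n (f : gmap (gdisk n) H) : H n := f n Gid.
have evc : matching (@gsrc H) (@gtgt H) (fam_map ev d).
  by apply: matching_map dc => n f; rewrite /ev /= -?gfun_src -?gfun_tgt.
have [h [hd hu]] := gsum_univ evc.
have evK (k : gmap (gsum T) H) :
    fam_map ev (cocone_map (K := gset_globe) (X := gsum T) (Y := H) k (gsum_legs T)) =
    fam_map k (gsum_legs_rec T).
  by rewrite /cocone_map /gsum_legs !fam_map_comp; apply: fam_map_ext.
have evI n : injective (@ev n) by move=> a b; apply: gdisk_ext.
exists h; split.
  by apply: (fam_map_inj evI); rewrite evK.
by move=> k kd; apply: hu; rewrite -evK kd.
Qed.

Definition theta0_cat : category := full_on (C := gset_cat) gsum.

Definition dtable (n : nat) : table := Table (Tab1 n).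

Definition theta0_globe : globe_functor theta0_cat :=
  @GlobeFunctor theta0_cat dtable gdisk_sig gdisk_tau
    gdisk_sig_sig gdisk_sig_tau.

Lemma gsum_theta0 (T : table) :
  is_globular_sum (K := theta0_globe) (X := T) (gsum_legs T).
Proof.
have [c u] := gsum_is_globular_sum T; split; first exact: c.
by move=> S; apply: u.
Qed.

Lemma theta0_sums (T : table) : exists (X : theta0_cat)
  (c : fam (fun n => hom (theta0_globe n) X) T), is_globular_sum c.
Proof. by exists T, (gsum_legs T); apply: gsum_theta0. Qed.

Definition theta0 : globular_extension := GlobularExtension theta0_sums.

(* [scomp p u v _] is [u *^i_j v], for [p : Lt j i], and [iter_up sid p] is the
   iterated identity from [j]-arrows to [i]-arrows. In each axiom the proofs of
   composability are universally quantified; those of the right-hand sides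
   follow from those of the left-hand sides. *)
Record strict_cat := StrictCat {
  sc_gset :> gset;
  scomp : forall j i (p : Lt j i) (u v : sc_gset i), isrc p u = itgt p v -> sc_gset i;
  sid : forall i, sc_gset i -> sc_gset i.+1;
  scomp_src1 : forall i (u v : sc_gset i.+1) (e : isrc Lt1 u = itgt Lt1 v),
    gsrc (scomp e) = gsrc v;
  scomp_tgt1 : forall i (u v : sc_gset i.+1) (e : isrc Lt1 u = itgt Lt1 v),
    gtgt (scomp e) = gtgt u;
  scomp_srcS : forall j i (p : Lt j i) (u v : sc_gset i.+1)
    (e : isrc (LtS p) u = itgt (LtS p) v) (e' : isrc p (gsrc u) = itgt p (gsrc v)),
    gsrc (scomp e) = scomp e';
  scomp_tgtS : forall j i (p : Lt j i) (u v : sc_gset i.+1)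
    (e : isrc (LtS p) u = itgt (LtS p) v) (e' : isrc p (gtgt u) = itgt p (gtgt v)),
    gtgt (scomp e) = scomp e';
  sid_src : forall i (u : sc_gset i), gsrc (sid u) = u;
  sid_tgt : forall i (u : sc_gset i), gtgt (sid u) = u;
  scompA : forall j i (p : Lt j i) (u v w : sc_gset i)
    (uv : isrc p u = itgt p v) (vw : isrc p v = itgt p w)
    (uv_w : isrc p (scomp uv) = itgt p w) (u_vw : isrc p u = itgt p (scomp vw)),
    scomp uv_w = scomp u_vw;
  sexchange : forall k j i (r : Lt k j) (p : Lt j i) (q : Lt k i)
    (u u' v v' : sc_gset i)
    (uu' : isrc p u = itgt p u') (vv' : isrc p v = itgt p v')
    (uv : isrc q u = itgt q v) (uv' : isrc q u' = itgt q v')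
    (e : isrc q (scomp uu') = itgt q (scomp vv'))
    (e' : isrc p (scomp uv) = itgt p (scomp uv')),
    scomp e = scomp e';
  scompu1 : forall j i (p : Lt j i) (u : sc_gset i)
    (e : isrc p u = itgt p (iter_up sid p (isrc p u))), scomp e = u;
  scomp1u : forall j i (p : Lt j i) (u : sc_gset i)
    (e : isrc p (iter_up sid p (itgt p u)) = itgt p u), scomp e = u;
  sid_comp : forall j i (p : Lt j i) (u v : sc_gset i)
    (e : isrc p u = itgt p v) (e' : isrc (LtS p) (sid u) = itgt (LtS p) (sid v)),
    sid (scomp e) = scomp e' }.

Arguments scomp {s j i} p u v e.

(* [v : y -> x] is a [*^i_{i-1}]-inverse of [u : x -> y]. *)
Definition is_inverse (G : strict_cat) i (u v : G i.+1) : Prop :=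
  exists (uv : isrc Lt1 u = itgt Lt1 v) (vu : isrc Lt1 v = itgt Lt1 u),
    scomp Lt1 u v uv = sid (gtgt u) /\ scomp Lt1 v u vu = sid (gsrc u).

Record strict_gpd := StrictGpd {
  sg_cat :> strict_cat;
  sg_inv : forall i (u : sg_cat i.+1), exists v, is_inverse u v }.

Record gpd_map (G H : strict_gpd) := GpdMap {
  gpd_fun :> gmap G H;
  gpd_comp : forall j i (p : Lt j i) (u v : G i) (e : isrc p u = itgt p v)
    (e' : isrc p (gpd_fun i u) = itgt p (gpd_fun i v)),
    gpd_fun i (scomp p u v e) = scomp p (gpd_fun i u) (gpd_fun i v) e';
  gpd_id : forall i (u : G i), gpd_fun i.+1 (sid u) = sid (gpd_fun i u) }.

Lemma eq_gpd_map (G H : strict_gpd) (f g : gpd_map G H) :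
  (forall n (x : G n), f n x = g n x) -> f = g.
Proof.
move=> /eq_gmap; case: f g => [f fc fi] [g gc gi] /= e; subst g.
by congr GpdMap; apply: proof_irrelevance.
Qed.

Lemma scomp_eq (G : strict_cat) j i (p : Lt j i) (u u' v v' : G i)
    (e : isrc p u = itgt p v) (e' : isrc p u' = itgt p v') :
  u = u' -> v = v' -> scomp p u v e = scomp p u' v' e'.
Proof. by move=> ? ?; subst u' v'; congr scomp; apply: proof_irrelevance. Qed.

Definition gpd_map_id (G : strict_gpd) : gpd_map G G :=
  @GpdMap G G (gmap_id G)
    (fun j i p u v e e' => scomp_eq e e' erefl erefl) (fun i u => erefl).

Section GpdMapComp.
Variables (G H I : strict_gpd) (g : gpd_map H I) (f : gpd_map G H).

Lemma gpd_map_comp_comp j i (p : Lt j i) (u v : G i) (e : isrc p u = itgt p v)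
    (e' : isrc p (g i (f i u)) = itgt p (g i (f i v))) :
  g i (f i (scomp p u v e)) = scomp p (g i (f i u)) (g i (f i v)) e'.
Proof.
have e1 : isrc p (f i u) = itgt p (f i v) by rewrite -gfun_isrc -gfun_itgt e.
by rewrite (gpd_comp e e1) (gpd_comp e1 e').
Qed.

Lemma gpd_map_comp_id i (u : G i) : g _ (f _ (sid u)) = sid (g i (f i u)).
Proof. by rewrite !gpd_id. Qed.

Definition gpd_map_comp : gpd_map G I :=
  @GpdMap G I (gmap_comp g f) gpd_map_comp_comp gpd_map_comp_id.

End GpdMapComp.

Lemma gpd_comp1m (G H : strict_gpd) (f : gpd_map G H) :
  gpd_map_comp (gpd_map_id H) f = f.
Proof. exact: eq_gpd_map. Qed.

Lemma gpd_compm1 (G H : strict_gpd) (f : gpd_map G H) :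
  gpd_map_comp f (gpd_map_id G) = f.
Proof. exact: eq_gpd_map. Qed.

Lemma gpd_compA (A B C D : strict_gpd) (h : gpd_map C D) (g : gpd_map B C)
    (f : gpd_map A B) :
  gpd_map_comp h (gpd_map_comp g f) = gpd_map_comp (gpd_map_comp h g) f.
Proof. exact: eq_gpd_map. Qed.

Definition gpd_cat : category :=
  @Category strict_gpd gpd_map gpd_map_id gpd_map_comp gpd_comp1m gpd_compm1
    gpd_compA.

Definition gpd_forget : functor gpd_cat gset_cat :=
  @Functor gpd_cat gset_cat (fun G => G : gset) (fun G H f => f : gmap G H)
    (fun G => erefl) (fun G H I g f => erefl).

Lemma inverse_uniq (G : strict_cat) i (u v w : G i.+1) :
  is_inverse u v -> is_inverse u w -> v = w.
Proof.
move=> [uv [vu [_ vuE]]] [uw [wu [uwE _]]].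
have su : isrc Lt1 v = itgt Lt1 (scomp Lt1 u w uw).
  by rewrite [RHS]scomp_tgt1.
have sw : isrc Lt1 (scomp Lt1 v u vu) = itgt Lt1 w.
  by rewrite [LHS]scomp_src1.
have := scompA sw su.
have e1 : isrc Lt1 v = itgt Lt1 (iter_up (@sid G) Lt1 (isrc Lt1 v)).
  by rewrite [RHS]sid_tgt.
have e2 : isrc Lt1 (iter_up (@sid G) Lt1 (itgt Lt1 w)) = itgt Lt1 w.
  by rewrite [LHS]sid_src.
rewrite (scomp_eq su e1) // ?scompu1; last by rewrite uwE [X in _ = sid X]vu.
rewrite (scomp_eq sw e2) // ?scomp1u //; last by rewrite vuE -[X in _ = sid X]uw.
Qed.

(* The [n]-arrows of the free strict oo-groupoid on [G] are given by formal terms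
   that have a value in each strict oo-groupoid under [G], two terms being equal
   if they always have the same value. Values form a partial function
   ([value_uniq]) as a composite is defined for composable arrows only. That this defines a left adjoint of
   [gpd_forget] is proved in [free_gpd_univ]. *)
Inductive term (G : gset) : nat -> Type :=
| Gen n : G n -> term G n
| Idt n : term G n -> term G n.+1
| Comp j i : Lt j i -> term G i -> term G i -> term G i
| Inv n : term G n.+1 -> term G n.+1.

Fixpoint value (G : gset) (H : strict_gpd) (f : gmap G H) n (t : term G n) :
    H n -> Prop :=
  match t in term _ n return H n -> Prop with
  | Gen n x => fun y => y = f n x
  | Idt n t => fun y => exists2 x, value f t x & y = sid x
  | Comp j i p t t' => fun y => exists x x' (e : isrc p x = itgt p x'),
      [/\ value f t x, value f t' x' & y = scomp p x x' e]
  | Inv n t => fun y => exists2 x, value f t x & is_inverse x y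
  end.

Definition valid (G : gset) n (t : term G n) : Prop :=
  forall (H : strict_gpd) (f : gmap G H), exists x, value f t x.

Definition same_value (G : gset) n (t t' : {t : term G n | valid t}) : Prop :=
  forall (H : strict_gpd) (f : gmap G H) (x : H n),
    value f (proj1_sig t) x <-> value f (proj1_sig t') x.

Section Free.
Variable G : gset.

Lemma value_uniq (H : strict_gpd) (f : gmap G H) n (t : term G n) x y :
  value f t x -> value f t y -> x = y.
Proof.
elim: t x y => {n} [n a|n t IH|j i p t IH t' IH'|n t IH] x y /=.
- by move=> -> ->.
- by move=> [x0 /IH hx ->] [y0 /hx -> ->].
- move=> [x0 [x1 [e [/IH hx /IH' hx' ->]]]] [y0 [y1 [e' [/hx ? /hx' ? ->]]]].
  exact: scomp_eq.
- by move=> [x0 /IH hx h] [y0 /hx <- h']; apply: inverse_uniq h h'.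
Qed.

Definition free_cell (n : nat) : Type := quot (@same_value G n).

Lemma same_value_eqv n (t t' : {t : term G n | valid t}) :
  eqv_gen (@same_value G n) t t' -> same_value t t'.
Proof.
elim=> {t t'} [//|//|t t' _ h|t t' t'' _ h _ h'] H f x; first by rewrite h.
by rewrite h h'.
Qed.

Section Value.
Variables (H : strict_gpd) (f : gmap G H).

Definition fval n (z : free_cell n) : H n :=
  proj1_sig (constructive_indefinite_description _
    (proj2_sig (qrep z) H f)).

Lemma fvalP n (z : free_cell n) : value f (proj1_sig (qrep z)) (fval z).
Proof.
exact: proj2_sig (constructive_indefinite_description _
  (proj2_sig (qrep z) H f)).
Qed.

Lemma fval_cl n (t : {t : term G n | valid t}) :
  value f (proj1_sig t) (fval (qcl _ t)).
Proof.
apply/(same_value_eqv (qcl_inj (qrepK (qcl (@same_value G n) t)))).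
exact: fvalP.
Qed.

End Value.

Lemma fval_inj n (z z' : free_cell n) :
  (forall (H : strict_gpd) (f : gmap G H), fval f z = fval f z') -> z = z'.
Proof.
move=> e; rewrite -(qrepK z) -(qrepK z'); apply: qcl_rel => H f x; split.
- by move=> /(value_uniq (fvalP f z)) <-; rewrite e; apply: fvalP.
- by move=> /(value_uniq (fvalP f z')) <-; rewrite -e; apply: fvalP.
Qed.

Lemma free_exists n (t : term G n) (v : forall (H : strict_gpd) (f : gmap G H), H n) :
  (forall (H : strict_gpd) (f : gmap G H), value f t (v H f)) ->
  exists z : free_cell n, forall (H : strict_gpd) (f : gmap G H), fval f z = v H f.
Proof.
move=> tv; have vt : valid t by move=> H f; exists (v H f).
exists (qcl _ (exist _ t vt)) => H f.
exact: value_uniq (fval_cl f (exist _ t vt)) (tv H f).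
Qed.

Lemma term_src_tgt n (t : term G n.+1) : exists ts tt : term G n,
  forall (H : strict_gpd) (f : gmap G H) (x : H n.+1), value f t x ->
    value f ts (gsrc x) /\ value f tt (gtgt x).
Proof.
pose P m := match m return term G m -> Prop with
  | 0 => fun _ => True
  | m.+1 => fun t => exists ts tt : term G m,
     forall (H : strict_gpd) (f : gmap G H) (x : H m.+1), value f t x ->
       value f ts (gsrc x) /\ value f tt (gtgt x) end.
suff: P n.+1 t by [].
move: (n.+1) t => m; elim=> {n m} [[|n] a|n t _|j i p t + t' +|n t [ts [tt IH]]] //.
- by exists (Gen (gsrc a)), (Gen (gtgt a)) => H f _ -> /=; rewrite gfun_src gfun_tgt.
- by exists t, t => H f _ [x tx ->]; rewrite sid_src sid_tgt.
- move: p t t' => p; destruct p as [|i p] => t t' [ts [tt IH]] [ts' [tt' IH']].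
    exists ts', tt => H f _ [x [x' [e [/IH [_ ?] /IH' [? _] ->]]]].
    by rewrite scomp_src1 scomp_tgt1.
  exists (Comp p ts ts'), (Comp p tt tt') => H f y.
  move=> [x [x' [e [/IH [xs xt] /IH' [xs' xt'] ->]]]].
  have es : isrc p (gsrc x) = itgt p (gsrc x').
    by rewrite [LHS]e [LHS]itgt_tgt.
  have et : isrc p (gtgt x) = itgt p (gtgt x') by rewrite -isrc_src.
  rewrite (scomp_srcS e es) (scomp_tgtS e et); split.
    by exists (gsrc x), (gsrc x'), es.
  by exists (gtgt x), (gtgt x'), et.
- exists tt, ts => H f y [x /IH [? ?] [xy [yx _]]].
  by rewrite -[gtgt y]xy [gsrc y]yx.
Qed.

Definition free_choose n (Q : free_cell n -> Prop) (e : exists z, Q z) : free_cell n :=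
  proj1_sig (constructive_indefinite_description Q e).

Lemma free_chooseP n (Q : free_cell n -> Prop) (e : exists z, Q z) :
  Q (free_choose e).
Proof. exact: proj2_sig (constructive_indefinite_description Q e). Qed.

Lemma free_src_exists n (z : free_cell n.+1) : exists z' : free_cell n,
  forall (H : strict_gpd) (f : gmap G H), fval f z' = gsrc (fval f z).
Proof.
have [ts [tt h]] := term_src_tgt (proj1_sig (qrep z)).
by apply: (@free_exists _ ts) => H f; case: (h H f _ (fvalP f z)).
Qed.

Lemma free_tgt_exists n (z : free_cell n.+1) : exists z' : free_cell n,
  forall (H : strict_gpd) (f : gmap G H), fval f z' = gtgt (fval f z).
Proof.
have [ts [tt h]] := term_src_tgt (proj1_sig (qrep z)).
by apply: (@free_exists _ tt) => H f; case: (h H f _ (fvalP f z)).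
Qed.

Definition free_src n (z : free_cell n.+1) : free_cell n :=
  free_choose (free_src_exists z).
Definition free_tgt n (z : free_cell n.+1) : free_cell n :=
  free_choose (free_tgt_exists z).

Lemma fval_src (H : strict_gpd) (f : gmap G H) n (z : free_cell n.+1) :
  fval f (free_src z) = gsrc (fval f z).
Proof. exact: (free_chooseP (free_src_exists z)). Qed.
Lemma fval_tgt (H : strict_gpd) (f : gmap G H) n (z : free_cell n.+1) :
  fval f (free_tgt z) = gtgt (fval f z).
Proof. exact: (free_chooseP (free_tgt_exists z)). Qed.

Lemma free_src_src n (z : free_cell n.+2) :
  free_src (free_src z) = free_src (free_tgt z).
Proof.
by apply: fval_inj => H f; rewrite !fval_src fval_tgt gsrc_src.
Qed.

Lemma free_tgt_src n (z : free_cell n.+2) :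
  free_tgt (free_src z) = free_tgt (free_tgt z).
Proof.
by apply: fval_inj => H f; rewrite !fval_tgt fval_src gtgt_src.
Qed.

Definition free_gset : gset := GSet free_src_src free_tgt_src.

Definition fval_gmap (H : strict_gpd) (f : gmap G H) : gmap free_gset H :=
  @GMap free_gset H (fval f) (@fval_src H f) (@fval_tgt H f).

Lemma fval_isrc (H : strict_gpd) (f : gmap G H) j i (p : Lt j i) (z : free_gset i) :
  fval f (isrc p z) = isrc p (fval f z).
Proof. exact: (gfun_isrc (fval_gmap f)). Qed.

Lemma fval_itgt (H : strict_gpd) (f : gmap G H) j i (p : Lt j i) (z : free_gset i) :
  fval f (itgt p z) = itgt p (fval f z).
Proof. exact: (gfun_itgt (fval_gmap f)). Qed.

Lemma fval_composable (H : strict_gpd) (f : gmap G H) j i (p : Lt j i) (u v : free_gset i) :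
  isrc p u = itgt p v -> isrc p (fval f u) = itgt p (fval f v).
Proof. by rewrite -fval_isrc -fval_itgt => ->. Qed.

Lemma free_comp_exists j i (p : Lt j i) (u v : free_gset i)
    (e : isrc p u = itgt p v) : exists z : free_gset i,
  forall (H : strict_gpd) (f : gmap G H),
    fval f z = scomp p (fval f u) (fval f v) (fval_composable f e).
Proof.
apply: (@free_exists _ (Comp p (proj1_sig (qrep u)) (proj1_sig (qrep v)))) => H f.
by exists (fval f u), (fval f v), (fval_composable f e); split=> //; apply: fvalP.
Qed.

Definition free_comp j i (p : Lt j i) (u v : free_gset i)
    (e : isrc p u = itgt p v) : free_gset i := free_choose (free_comp_exists e).

Lemma free_id_exists i (u : free_gset i) : exists z : free_gset i.+1,
  forall (H : strict_gpd) (f : gmap G H), fval f z = sid (fval f u).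
Proof.
apply: (@free_exists _ (Idt (proj1_sig (qrep u)))) => H f.
by exists (fval f u) => //; apply: fvalP.
Qed.

Definition free_id i (u : free_gset i) : free_gset i.+1 :=
  free_choose (free_id_exists u).

Lemma fval_comp (H : strict_gpd) (f : gmap G H) j i (p : Lt j i) (u v : free_gset i)
    (e : isrc p u = itgt p v) (e' : isrc p (fval f u) = itgt p (fval f v)) :
  fval f (free_comp e) = scomp p (fval f u) (fval f v) e'.
Proof. by rewrite (free_chooseP (free_comp_exists e)); apply: scomp_eq. Qed.

Lemma fval_id (H : strict_gpd) (f : gmap G H) i (u : free_gset i) :
  fval f (free_id u) = sid (fval f u).
Proof. exact: (free_chooseP (free_id_exists u)). Qed.

Lemma fval_idn (H : strict_gpd) (f : gmap G H) j i (p : Lt j i) (u : free_gset j) :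
  fval f (iter_up free_id p u) = iter_up (@sid H) p (fval f u).
Proof. by elim: p => [|k p IH] /=; rewrite fval_id ?IH. Qed.

Lemma fval_compE (H : strict_gpd) (f : gmap G H) j i (p : Lt j i)
    (u v : free_gset i) (e : isrc p u = itgt p v) :
  fval f (free_comp e) = scomp p (fval f u) (fval f v) (fval_composable f e).
Proof. exact: fval_comp. Qed.

Lemma free_comp_src1 i (u v : free_gset i.+1) (e : isrc Lt1 u = itgt Lt1 v) :
  free_src (free_comp e) = free_src v.
Proof.
by apply: fval_inj => H f; rewrite !fval_src fval_compE scomp_src1.
Qed.

Lemma free_comp_tgt1 i (u v : free_gset i.+1) (e : isrc Lt1 u = itgt Lt1 v) :
  free_tgt (free_comp e) = free_tgt u.
Proof.
by apply: fval_inj => H f; rewrite !fval_tgt fval_compE scomp_tgt1.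
Qed.

Lemma free_comp_srcS j i (p : Lt j i) (u v : free_gset i.+1)
    (e : isrc (LtS p) u = itgt (LtS p) v)
    (e' : isrc p (free_src u : free_gset i) = itgt p (free_src v : free_gset i)) :
  free_src (free_comp e) = free_comp e'.
Proof.
apply: fval_inj => H f; rewrite fval_src !fval_compE.
have e1 : isrc p (gsrc (fval f u)) = itgt p (gsrc (fval f v)).
  by have := fval_composable f e'; rewrite !fval_src.
by rewrite (scomp_srcS _ e1); apply: scomp_eq; rewrite fval_src.
Qed.

Lemma free_comp_tgtS j i (p : Lt j i) (u v : free_gset i.+1)
    (e : isrc (LtS p) u = itgt (LtS p) v)
    (e' : isrc p (free_tgt u : free_gset i) = itgt p (free_tgt v : free_gset i)) :
  free_tgt (free_comp e) = free_comp e'.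
Proof.
apply: fval_inj => H f; rewrite fval_tgt !fval_compE.
have e1 : isrc p (gtgt (fval f u)) = itgt p (gtgt (fval f v)).
  by have := fval_composable f e'; rewrite !fval_tgt.
by rewrite (scomp_tgtS _ e1); apply: scomp_eq; rewrite fval_tgt.
Qed.

Lemma free_id_src i (u : free_gset i) : free_src (free_id u) = u.
Proof. by apply: fval_inj => H f; rewrite fval_src fval_id sid_src. Qed.

Lemma free_id_tgt i (u : free_gset i) : free_tgt (free_id u) = u.
Proof. by apply: fval_inj => H f; rewrite fval_tgt fval_id sid_tgt. Qed.

Lemma free_compA j i (p : Lt j i) (u v w : free_gset i)
    (uv : isrc p u = itgt p v) (vw : isrc p v = itgt p w)
    (uv_w : isrc p (free_comp uv : free_gset i) = itgt p w)
    (u_vw : isrc p u = itgt p (free_comp vw : free_gset i)) :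
  free_comp uv_w = free_comp u_vw.
Proof.
apply: fval_inj => H f; rewrite [LHS]fval_compE [RHS]fval_compE.
have a := fval_composable f uv; have b := fval_composable f vw.
have c : isrc p (scomp p _ _ a) = itgt p (fval f w).
  by have := fval_composable f uv_w; rewrite (fval_comp _ a).
have d : isrc p (fval f u) = itgt p (scomp p _ _ b).
  by have := fval_composable f u_vw; rewrite (fval_comp _ b).
rewrite (scomp_eq _ c) ?(fval_comp _ a) // (scompA c d).
by apply: scomp_eq; rewrite ?(fval_comp _ b).
Qed.

Lemma free_exchange k j i (r : Lt k j) (p : Lt j i) (q : Lt k i)
    (u u' v v' : free_gset i)
    (uu' : isrc p u = itgt p u') (vv' : isrc p v = itgt p v')
    (uv : isrc q u = itgt q v) (uv' : isrc q u' = itgt q v')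
    (e : isrc q (free_comp uu' : free_gset i) = itgt q (free_comp vv' : free_gset i))
    (e' : isrc p (free_comp uv : free_gset i) = itgt p (free_comp uv' : free_gset i)) :
  free_comp e = free_comp e'.
Proof.
apply: fval_inj => H f; rewrite [LHS]fval_compE [RHS]fval_compE.
have a := fval_composable f uu'; have b := fval_composable f vv'.
have c := fval_composable f uv; have d := fval_composable f uv'.
have x : isrc q (scomp p _ _ a) = itgt q (scomp p _ _ b).
  by have := fval_composable f e; rewrite (fval_comp _ a) (fval_comp _ b).
have y : isrc p (scomp q _ _ c) = itgt p (scomp q _ _ d).
  by have := fval_composable f e'; rewrite (fval_comp _ c) (fval_comp _ d).
rewrite (scomp_eq _ x) ?(fval_comp _ a) ?(fval_comp _ b) //.
rewrite (sexchange r x y).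
by apply: scomp_eq; rewrite ?(fval_comp _ c) ?(fval_comp _ d).
Qed.

Lemma free_compu1 j i (p : Lt j i) (u : free_gset i)
    (e : isrc p u = itgt p (iter_up free_id p (isrc p u) : free_gset i)) :
  free_comp e = u.
Proof.
apply: fval_inj => H f; rewrite fval_compE.
have a : isrc p (fval f u) = itgt p (iter_up (@sid H) p (isrc p (fval f u))).
  by have := fval_composable f e; rewrite fval_idn fval_isrc.
by rewrite (scomp_eq _ a) ?scompu1 // fval_idn fval_isrc.
Qed.

Lemma free_comp1u j i (p : Lt j i) (u : free_gset i)
    (e : isrc p (iter_up free_id p (itgt p u) : free_gset i) = itgt p u) :
  free_comp e = u.
Proof.
apply: fval_inj => H f; rewrite fval_compE.
have a : isrc p (iter_up (@sid H) p (itgt p (fval f u))) = itgt p (fval f u).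
  by have := fval_composable f e; rewrite fval_idn fval_itgt.
by rewrite (scomp_eq _ a) ?scomp1u // fval_idn fval_itgt.
Qed.

Lemma free_id_comp j i (p : Lt j i) (u v : free_gset i) (e : isrc p u = itgt p v)
    (e' : isrc (LtS p) (free_id u : free_gset i.+1) =
          itgt (LtS p) (free_id v : free_gset i.+1)) :
  free_id (free_comp e) = free_comp e'.
Proof.
apply: fval_inj => H f; rewrite fval_id !fval_compE.
have a : isrc (LtS p) (sid (fval f u)) = itgt (LtS p) (sid (fval f v)).
  by have := fval_composable f e'; rewrite !fval_id.
by rewrite (sid_comp _ a); apply: scomp_eq; rewrite fval_id.
Qed.

Definition free_cat : strict_cat :=
  StrictCat free_comp_src1 free_comp_tgt1 free_comp_srcS free_comp_tgtS
    free_id_src free_id_tgt free_compA free_exchange free_compu1 free_comp1u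
    free_id_comp.

Lemma free_inv i (u : free_cat i.+1) : exists v, is_inverse u v.
Proof.
pose v (H : strict_gpd) (f : gmap G H) :=
  proj1_sig (constructive_indefinite_description _ (sg_inv (fval f u))).
have vP (H : strict_gpd) (f : gmap G H) : is_inverse (fval f u) (v H f).
  exact: (proj2_sig (constructive_indefinite_description _ (sg_inv (fval f u)))).
have [z zv] : exists z : free_cat i.+1,
    forall (H : strict_gpd) (f : gmap G H), fval f z = v H f.
  apply: (@free_exists _ (Inv (proj1_sig (qrep u)))).
  by move=> H f; exists (fval f u) => //; apply: fvalP.
have uz : isrc Lt1 u = itgt Lt1 z.
  apply: fval_inj => H f; rewrite fval_isrc fval_itgt zv.
  by have [] := vP H f.
have zu : isrc Lt1 z = itgt Lt1 u.
  apply: fval_inj => H f; rewrite fval_isrc fval_itgt zv.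
  by have [? []] := vP H f.
exists z, uz, zu; split; apply: fval_inj => H f; have [a [b [c d]]] := vP H f.
- by rewrite fval_compE fval_id fval_tgt -c; apply: scomp_eq; rewrite ?zv.
- by rewrite fval_compE fval_id fval_src -d; apply: scomp_eq; rewrite ?zv.
Qed.

Definition free_gpd : strict_gpd := StrictGpd free_inv.

Definition free_ext (H : strict_gpd) (f : gmap G H) : gpd_map free_gpd H :=
  @GpdMap free_gpd H (fval_gmap f) (@fval_comp H f) (@fval_id H f).

Lemma free_gen_exists n (x : G n) : exists z : free_cell n,
  forall (H : strict_gpd) (f : gmap G H), fval f z = f n x.
Proof. exact: (@free_exists _ (Gen x)). Qed.

Definition free_gen n (x : G n) : free_gset n := free_choose (free_gen_exists x).

Lemma fval_gen (H : strict_gpd) (f : gmap G H) n (x : G n) :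
  fval f (free_gen x) = f n x.
Proof. exact: (free_chooseP (free_gen_exists x)). Qed.

Lemma free_gen_src n (x : G n.+1) : free_gen (gsrc x) = gsrc (free_gen x).
Proof.
by apply: fval_inj => H f; rewrite fval_src !fval_gen gfun_src.
Qed.

Lemma free_gen_tgt n (x : G n.+1) : free_gen (gtgt x) = gtgt (free_gen x).
Proof.
by apply: fval_inj => H f; rewrite fval_tgt !fval_gen gfun_tgt.
Qed.

Definition free_unit : gmap G free_gpd :=
  @GMap G free_gpd free_gen free_gen_src free_gen_tgt.

Lemma free_extK (H : strict_gpd) (f : gmap G H) :
  gmap_comp (free_ext f) free_unit = f.
Proof. by apply: eq_gmap => n x; apply: fval_gen. Qed.

Lemma gpd_map_value (H I : strict_gpd) (m : gpd_map H I) (f : gmap G H) n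
    (t : term G n) (x : H n) :
  value f t x -> value (gmap_comp m f) t (m n x).
Proof.
elim: t x => {n} [n a|n t IH|j i p t IH t' IH'|n t IH] y /=.
- by move=> ->.
- by move=> [x /IH ? ->]; exists (m _ x); rewrite ?gpd_id.
- move=> [x [x' [e [/IH ? /IH' ? ->]]]].
  have e' : isrc p (m _ x) = itgt p (m _ x') by rewrite -gfun_isrc -gfun_itgt e.
  by exists (m _ x), (m _ x'), e'; split=> //; apply: gpd_comp.
- move=> [x /IH hx [a [b [c d]]]]; exists (m _ x) => //.
  have a' : isrc Lt1 (m _ x) = itgt Lt1 (m _ y) by rewrite -gfun_isrc -gfun_itgt a.
  have b' : isrc Lt1 (m _ y) = itgt Lt1 (m _ x) by rewrite -gfun_isrc -gfun_itgt b.
  exists a', b'; split.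
  + by rewrite -(gpd_comp a a') c gpd_id gfun_tgt.
  + by rewrite -(gpd_comp b b') d gpd_id gfun_src.
Qed.

Lemma fval_unit n (z : free_gpd n) : fval free_unit z = z.
Proof.
apply: fval_inj => H f.
have := gpd_map_value (free_ext f) (fvalP free_unit z).
by rewrite free_extK => /(value_uniq (fvalP f z)) e; apply: esym.
Qed.

End Free.

Lemma free_gpd_univ (G : gset) (H : strict_gpd) (f : gmap G H) :
  exists! m : gpd_map (free_gpd G) H, gmap_comp m (free_unit G) = f.
Proof.
exists (free_ext f); split; first exact: free_extK.
move=> m mf; apply: eq_gpd_map => n z /=.
have := gpd_map_value m (fvalP (free_unit G) z).
by rewrite mf fval_unit => /(value_uniq (fvalP f z)).
Qed.

Lemma free_gpd_ext (G : gset) (H : strict_gpd) (m m' : gpd_map (free_gpd G) H) :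
  gmap_comp m (free_unit G) = gmap_comp m' (free_unit G) -> m = m'.
Proof.
move=> e; have [k [_ ku]] := free_gpd_univ (gmap_comp m' (free_unit G)).
by rewrite -(ku m) // -(ku m').
Qed.

Definition free_map (G G' : gset) (f : gmap G G') :
    gpd_map (free_gpd G) (free_gpd G') :=
  free_ext (gmap_comp (free_unit G') f).

Lemma free_map_unit (G G' : gset) (f : gmap G G') :
  gmap_comp (free_map f) (free_unit G) = gmap_comp (free_unit G') f.
Proof. exact: free_extK. Qed.

Lemma free_map1 (G : gset) : free_map (gmap_id G) = gpd_map_id (free_gpd G).
Proof. by apply: free_gpd_ext; rewrite free_map_unit; apply: eq_gmap. Qed.

Lemma free_mapM (A B C : gset) (g : gmap B C) (f : gmap A B) :
  free_map (gmap_comp g f) = gpd_map_comp (free_map g) (free_map f).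
Proof.
apply: free_gpd_ext; rewrite free_map_unit gmap_compA -free_map_unit.
rewrite -gmap_compA -free_map_unit; exact: eq_gmap.
Qed.

Definition free_functor : functor gset_cat gpd_cat :=
  @Functor gset_cat gpd_cat free_gpd free_map free_map1 free_mapM.

Lemma free_gsum_is_globular_sum (T : table) :
  is_globular_sum (cocone_image (K := gset_globe) (X := gsum T) free_functor
    (gsum_legs T)).
Proof.
have [c u] := gsum_is_globular_sum T; split.
  rewrite /is_cocone /cocone_image.
  by apply: matching_map c => n f; apply: free_mapM.
move=> X d dc.
pose phi n (m : gpd_map (free_gpd (gdisk n)) X) : gmap (gdisk n) X :=
  gmap_comp m (free_unit _).
have phiI n : injective (phi n) by move=> a b; apply: free_gpd_ext.
have phiE A n (m : gpd_map (free_gpd A) X) (f : gmap (gdisk n) A) :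
    phi n (gpd_map_comp m (free_map f)) = gmap_comp (gmap_comp m (free_unit _)) f.
  rewrite /phi -[RHS]gmap_compA -free_map_unit; exact: eq_gmap.
have dc' : is_cocone (C := gset_cat) (K := gset_globe) (X := X : gset) (fam_map phi d).
  by apply: matching_map dc => n m; apply: phiE.
have [h [hd hu]] := u _ _ dc'.
have phiK (m : gpd_map (free_gpd (gsum T)) X) :
    fam_map phi (cocone_map (C := gpd_cat) (K := push free_functor gset_globe)
      (X := free_gpd (gsum T)) (Y := X) m (cocone_image (K := gset_globe)
      (X := gsum T) free_functor (gsum_legs T))) =
    cocone_map (C := gset_cat) (K := gset_globe) (X := gsum T) (Y := X : gset)
      (gmap_comp m (free_unit _)) (gsum_legs T).
  rewrite /cocone_map /cocone_image !fam_map_comp; apply: fam_map_ext => n f.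
  exact: phiE.
exists (free_ext h); split.
  by apply: (fam_map_inj phiI); rewrite phiK free_extK.
by move=> m md; apply: free_gpd_ext; rewrite free_extK; apply: hu; rewrite -phiK md.
Qed.

Definition theta_tilde_cat : category :=
  full_on (C := gpd_cat) (fun T : table => free_gpd (gsum T)).

Definition theta_tilde_functor : functor theta0 theta_tilde_cat :=
  @Functor theta0 theta_tilde_cat (fun T => T) (fun S T f => free_map f)
    (fun T => free_map1 (gsum T)) (fun S T U g f => free_mapM g f).

Definition theta_tilde_globe : globe_functor theta_tilde_cat :=
  push theta_tilde_functor (ge_globe theta0).

Lemma free_gsum_theta_tilde (T : table) :
  is_globular_sum (K := theta_tilde_globe)
    (cocone_image (K := theta0_globe) (X := T) theta_tilde_functor (gsum_legs T)).
Proof.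
have [c u] := free_gsum_is_globular_sum T; split; first exact: c.
by move=> S; apply: u.
Qed.

Lemma theta_tilde_sums (T : table) : exists (X : theta_tilde_cat)
  (c : fam (fun n => hom (theta_tilde_globe n) X) T), is_globular_sum c.
Proof. by exists T; eexists; apply: free_gsum_theta_tilde. Qed.

Definition theta_tilde_ext : globular_extension :=
  GlobularExtension theta_tilde_sums.

Lemma theta_tilde_preserves :
  preserves_sums theta_tilde_functor (ge_globe theta0).
Proof.
apply: preserves_sums_of => T; exists T, (gsum_legs T).
split; [exact: gsum_theta0 | exact: free_gsum_theta_tilde].
Qed.

Definition theta_tilde_globular : globular_functor theta0 theta_tilde_ext :=
  @GlobularFunctor theta0 theta_tilde_ext theta_tilde_functor erefl
    theta_tilde_preserves.

Definition bijective_on_objects (C D : category) (F : functor C D) : Prop :=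
  forall y : D, exists! x : C, F x = y.

Record globular_theory := GlobularTheory {
  gt_ext :> globular_extension;
  gt_theta0 : globular_functor theta0 gt_ext;
  gt_bij : bijective_on_objects gt_theta0 }.

Lemma theta_tilde_bij : bijective_on_objects theta_tilde_globular.
Proof. by move=> T; exists T; split. Qed.

Definition theta_tilde : globular_theory := GlobularTheory theta_tilde_bij.

(* Morphisms of globular theories are the functors under [theta0]; they are
   automatically globular, see [theory_map_sums]. *)
Record theory_map (C D : globular_theory) := TheoryMap {
  tm_functor :> functor C D;
  tm_under : fcomp tm_functor (gt_theta0 C) = gt_theta0 D }.

Lemma theory_map_globe (C D : globular_theory) (F : theory_map C D) :
  push F (ge_globe C) = ge_globe D.
Proof.
rewrite -(gf_under (gt_theta0 C)) -push_comp tm_under; exact: gf_under.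
Qed.

Lemma theory_map_sums (C D : globular_theory) (F : theory_map C D) :
  preserves_sums F (ge_globe C).
Proof.
rewrite -(gf_under (gt_theta0 C)); apply: preserves_sums_of => T.
have [X [c cs]] := ge_sums theta0 T.
exists (gt_theta0 C X), (cocone_image (gt_theta0 C) c); split.
  exact: gf_sums.
have h : preserves_sums (fcomp F (gt_theta0 C)) (ge_globe theta0).
  rewrite tm_under; exact: gf_sums.
by have := h _ _ _ cs; rewrite cocone_image_comp.
Qed.

Definition theory_map_globular (C D : globular_theory) (F : theory_map C D) :
    globular_functor C D :=
  GlobularFunctor (theory_map_globe F) (@theory_map_sums C D F).

Record presheaf (C : category) := Presheaf {
  psh :> C -> Type;
  pmor : forall x y, hom x y -> psh y -> psh x;
  pmor1 : forall x (a : psh x), pmor (idm x) a = a;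
  pmorM : forall x y z (g : hom y z) (f : hom x y) (a : psh z),
    pmor (g \c f) a = pmor f (pmor g a) }.

Record natural (C : category) (P Q : presheaf C) := Natural {
  nat_fun :> forall x, P x -> Q x;
  nat_mor : forall x y (f : hom x y) (a : P y),
    nat_fun (pmor f a) = pmor f (nat_fun a) }.

Definition fibre_map (C : category) (K : globe_functor C) (P : presheaf C)
    (T : table) (X : C) (c : fam (fun n => hom (K n) X) T) (a : P X) :
    fam (fun n => P (K n)) T :=
  fam_map (F := fun n => hom (K n) X) (F' := fun n => P (K n))
    (fun n f => pmor f a) c.

Definition is_globular_presheaf (C : category) (K : globe_functor C)
    (P : presheaf C) : Prop :=
  forall (T : table) (X : C) (c : fam (fun n => hom (K n) X) T),
    is_globular_sum c ->
    forall a : fam (fun n => P (K n)) T,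
      matching (F := fun n => P (K n))
        (fun n => pmor (sig K n)) (fun n => pmor (tau K n)) a ->
      exists! x : P X, fibre_map c x = a.

Lemma eq_natural (C : category) (P Q : presheaf C) (f g : natural P Q) :
  (forall x (a : P x), f x a = g x a) -> f = g.
Proof.
case: f g => [f fn] [g gn] /= e.
have e' : f = g by do 2!apply: functional_extensionality_dep => ?; apply: e.
by subst g; congr Natural; apply: proof_irrelevance.
Qed.

Definition natural_id (C : category) (P : presheaf C) : natural P P :=
  @Natural C P P (fun x a => a) (fun x y f a => erefl).

Lemma natural_comp_mor (C : category) (P Q R : presheaf C) (g : natural Q R)
    (f : natural P Q) x y (h : hom x y) (a : P y) :
  g x (f x (pmor h a)) = pmor h (g y (f y a)).
Proof. by rewrite !nat_mor. Qed.

Definition natural_comp (C : category) (P Q R : presheaf C) (g : natural Q R)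
    (f : natural P Q) : natural P R :=
  @Natural C P R (fun x a => g x (f x a)) (natural_comp_mor g f).

Lemma natural_comp1m (C : category) (P Q : presheaf C) (f : natural P Q) :
  natural_comp (natural_id Q) f = f.
Proof. exact: eq_natural. Qed.

Lemma natural_compm1 (C : category) (P Q : presheaf C) (f : natural P Q) :
  natural_comp f (natural_id P) = f.
Proof. exact: eq_natural. Qed.

Lemma natural_compA (C : category) (P Q R S : presheaf C) (h : natural R S)
    (g : natural Q R) (f : natural P Q) :
  natural_comp h (natural_comp g f) = natural_comp (natural_comp h g) f.
Proof. exact: eq_natural. Qed.

Definition presheaf_cat (C : category) : category :=
  @Category (presheaf C) (@natural C) (@natural_id C) (@natural_comp C)
    (@natural_comp1m C) (@natural_compm1 C) (@natural_compA C).

Record model (C : globular_theory) := Model {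
  mod_psh :> presheaf C;
  mod_globular : is_globular_presheaf (ge_globe C) mod_psh }.

Definition model_cat (C : globular_theory) : category :=
  full_on (C := presheaf_cat C) (fun M : model C => M : presheaf C).

Section Restriction.
Variables (C D : category) (F : functor C D).

Lemma restrict1 (P : presheaf D) x (a : P (F x)) : pmor (fmor F (idm x)) a = a.
Proof. by rewrite fmor1 pmor1. Qed.

Lemma restrictM (P : presheaf D) x y z (g : hom y z) (f : hom x y)
    (a : P (F z)) :
  pmor (fmor F (g \c f)) a = pmor (fmor F f) (pmor (fmor F g) a).
Proof. by rewrite fmorM pmorM. Qed.

Definition restrict (P : presheaf D) : presheaf C :=
  @Presheaf C (fun x => P (F x)) (fun x y f a => pmor (fmor F f) a)
    (@restrict1 P) (@restrictM P).

Definition restrict_natural (P Q : presheaf D) (h : natural P Q) :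
    natural (restrict P) (restrict Q) :=
  @Natural C (restrict P) (restrict Q) (fun x => h (F x))
    (fun x y f a => nat_mor h (fmor F f) a).

End Restriction.

Lemma restrict_globular (C D : globular_theory) (F : theory_map C D)
    (M : model D) : is_globular_presheaf (ge_globe C) (restrict F M).
Proof.
move=> T X c cs a ac.
have MG : is_globular_presheaf (push F (ge_globe C)) M.
  rewrite theory_map_globe; exact: mod_globular.
have [x [xa xu]] := MG _ _ _ (theory_map_sums F cs) a ac.
have E (y : M (F X)) : fibre_map (K := push F (ge_globe C)) (cocone_image F c) y =
    fibre_map (K := ge_globe C) (P := restrict F M) c y.
  by rewrite /fibre_map /cocone_image fam_map_comp.
exists x; split; first by rewrite -E.
by move=> y; rewrite -E; apply: xu.
Qed.

Section ModelRestriction.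
Variables (C D : globular_theory) (F : theory_map C D).

Definition model_restrict_ob (M : model_cat D) : model_cat C :=
  Model (@restrict_globular C D F M).

Definition model_restrict_mor (M N : model_cat D) (h : hom M N) :
  hom (model_restrict_ob M) (model_restrict_ob N) := restrict_natural F h.

Lemma model_restrict1 (M : model_cat D) :
  model_restrict_mor (idm M) = idm (model_restrict_ob M).
Proof. exact: eq_natural. Qed.

Lemma model_restrictM (M N P : model_cat D) (g : hom N P) (h : hom M N) :
  model_restrict_mor (g \c h) = model_restrict_mor g \c model_restrict_mor h.
Proof. exact: eq_natural. Qed.

Definition model_restrict : functor (model_cat D) (model_cat C) :=
  Functor model_restrict1 model_restrictM.

End ModelRestriction.

Definition gpd_presheaf (G : strict_gpd) : presheaf theta_tilde_cat :=
  @Presheaf theta_tilde_cat (fun T => gpd_map (free_gpd (gsum T)) G)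
    (fun S T f a => gpd_map_comp a f)
    (fun T a => gpd_compm1 a) (fun S T U g f a => gpd_compA a g f).

Lemma gpd_presheaf_globular (G : strict_gpd) :
  is_globular_presheaf theta_tilde_globe (gpd_presheaf G).
Proof.
move=> T X c cs a ac.
have [h [g [hc gh hg]]] := globular_sum_iso (free_gsum_theta_tilde T) cs.
have [_ u] := free_gsum_is_globular_sum T.
have [x [xa xu]] := u G a ac.
pose c0 := cocone_image (K := theta0_globe) (X := T) theta_tilde_functor (gsum_legs T).
have E (y : gpd_presheaf G X) :
    fibre_map c y = fibre_map (P := gpd_presheaf G) c0 (pmor h y).
  rewrite -hc /fibre_map /cocone_map fam_map_comp; apply: fam_map_ext => n f.
  by rewrite pmorM.
exists (pmor (g : hom (X : theta_tilde_cat) (T : theta_tilde_cat))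
  (x : gpd_presheaf G T)); split.
  by rewrite E -pmorM gh pmor1.
move=> y; rewrite E => /xu ->.
by rewrite -pmorM hg pmor1.
Qed.

Definition gpd_nerve_ob (G : gpd_cat) : model_cat theta_tilde :=
  @Model theta_tilde (gpd_presheaf G) (@gpd_presheaf_globular G).

Definition gpd_nerve_mor (G H : gpd_cat) (m : hom G H) :
    hom (gpd_nerve_ob G) (gpd_nerve_ob H) :=
  @Natural theta_tilde_cat (gpd_presheaf G) (gpd_presheaf H)
    (fun T a => gpd_map_comp m a) (fun S T f a => gpd_compA m a f).

Lemma gpd_nerve1 (G : gpd_cat) : gpd_nerve_mor (idm G) = idm (gpd_nerve_ob G).
Proof. by apply: eq_natural => T a; apply: gpd_comp1m. Qed.

Lemma gpd_nerveM (G H I : gpd_cat) (m : hom H I) (m' : hom G H) :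
  gpd_nerve_mor (m \c m') = gpd_nerve_mor m \c gpd_nerve_mor m'.
Proof. by apply: eq_natural => T a; apply/esym/gpd_compA. Qed.

Definition gpd_nerve : functor gpd_cat (model_cat theta_tilde) :=
  Functor gpd_nerve1 gpd_nerveM.

Definition globularly_parallel (C : category) (K : globe_functor C) (n : nat)
    (X : C) : hom (K n) X -> hom (K n) X -> Prop :=
  match n return hom (K n) X -> hom (K n) X -> Prop with
  | 0 => fun _ _ => True
  | n.+1 => fun f g =>
      f \c sig K n = g \c sig K n /\ f \c tau K n = g \c tau K n
  end.

Definition is_lifting (C : category) (K : globe_functor C) (n : nat) (X : C)
    (f g : hom (K n) X) (h : hom (K n.+1) X) : Prop :=
  h \c sig K n = f /\ h \c tau K n = g.

Record disk_pair (C : globular_extension) := DiskPair {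
  dp_dim : nat;
  dp_ob : C;
  dp_fst : hom (ge_globe C dp_dim) dp_ob;
  dp_snd : hom (ge_globe C dp_dim) dp_ob }.

Definition admissible (C : globular_extension) (a : disk_pair C) : Prop :=
  globularly_parallel (dp_fst a) (dp_snd a) /\
  exists (T : table) (c : fam (fun n => hom (ge_globe C n) (dp_ob a)) T),
    is_globular_sum c /\ tab_dim T <= (dp_dim a).+1.

Definition contractible (C : globular_extension) : Prop :=
  forall a : disk_pair C, admissible a ->
    exists h : hom (ge_globe C (dp_dim a).+1) (dp_ob a),
      is_lifting (dp_fst a) (dp_snd a) h.

(* A choice, for each pair in [A], of a morphism [I D_{n+1} -> I X], and the
   property that it is a lifting of the image under [I] of the pair. The disks
   of the codomain of a globular functor [I] are the images of the disks of its
   domain, see [gf_under]. *)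
Definition choice_on (C : globular_extension) (A : disk_pair C -> Prop)
    (D : category) (I : functor C D) : Type :=
  forall a, A a -> hom (I (ge_globe C (dp_dim a).+1)) (I (dp_ob a)).

Definition lifts_on (C : globular_extension) (A : disk_pair C -> Prop)
    (D : category) (I : functor C D) (l : choice_on A I) : Prop :=
  forall a (Aa : A a),
    is_lifting (K := push I (ge_globe C)) (n := dp_dim a) (X := I (dp_ob a))
      (fmor I (dp_fst a)) (fmor I (dp_snd a)) (l a Aa).

(* [I : C -> C'] formally adds the liftings [l] of the pairs in [A]. *)
Definition formally_adds (C C' : globular_extension)
    (I : globular_functor C C') (A : disk_pair C -> Prop)
    (l : choice_on A I) : Prop :=
  lifts_on l /\
  forall (D : globular_extension) (F : globular_functor C D)
    (m : choice_on A F), lifts_on m ->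
    exists! G : globular_functor C' D,
      fcomp G I = F :> functor C D /\
      forall a (Aa : A a), Arrow (fmor G (l a Aa)) = Arrow (m a Aa).

Definition stage (E : nat -> globular_extension) (n : nat) :
    globular_extension :=
  match n with 0 => theta0 | n.+1 => E n end.

Record cellular_tower := CellularTower {
  ct_succ : nat -> globular_extension;
  ct_map : forall n, globular_functor (stage ct_succ n) (stage ct_succ n.+1);
  ct_pairs : forall n, disk_pair (stage ct_succ n) -> Prop;
  ct_admissible : forall n (a : disk_pair (stage ct_succ n)),
    @ct_pairs n a -> admissible a;
  ct_lift : forall n, choice_on (@ct_pairs n) (ct_map n);
  ct_adds : forall n, formally_adds (@ct_lift n) }.

Definition ct_stage (E : cellular_tower) : nat -> globular_extension :=
  stage (ct_succ E).

Definition is_tower_cocone (E : cellular_tower) (C : globular_extension)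
    (leg : forall n, globular_functor (ct_stage E n) C) : Prop :=
  forall n, fcomp (leg n.+1) (ct_map E n) = leg n :> functor _ _.

(* A presentation of [C] as the colimit of a cellular tower, in the category of
   globular extensions and globular functors. *)
Record free_presentation (C : globular_extension) := FreePresentation {
  fp_tower : cellular_tower;
  fp_leg : forall n, globular_functor (ct_stage fp_tower n) C;
  fp_cocone : is_tower_cocone fp_leg;
  fp_colimit : forall (D : globular_extension)
    (leg : forall n, globular_functor (ct_stage fp_tower n) D),
    is_tower_cocone leg ->
    exists! G : globular_functor C D,
      forall n, fcomp G (fp_leg n) = leg n :> functor _ _ }.

Lemma globular_under0 (C : globular_extension) (J : globular_functor theta0 C) :
  push J theta0_globe = ge_globe C.
Proof. exact: (gf_under J). Qed.

Section Image.
Variables (E : globular_extension) (I : globular_functor theta0 E).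

Definition image_ob : Type := {x : E | exists T, I T = x}.
Definition image_cat : category :=
  full_on (C := E) (fun x : image_ob => proj1_sig x).
Definition image_incl : functor image_cat E := full_on_incl _.

Lemma image_ob_inj (x y : image_ob) : proj1_sig x = proj1_sig y -> x = y.
Proof. by apply: eq_sig_hprop => z; apply: proof_irrelevance. Qed.

Lemma fmor_of_eq (C D : category) (F G : functor C D) (e : F = G)
    (o : fob F = fob G) :
  eq_rect _ (fun o : C -> D => forall x y, hom x y -> hom (o x) (o y))
    (@fmor _ _ F) _ o = @fmor _ _ G.
Proof. by subst G; rewrite (proof_irrelevance _ o erefl). Qed.

Lemma image_incl_mono (C : category) (F G : functor C image_cat) :
  fcomp image_incl F = fcomp image_incl G -> F = G.
Proof.
move=> e; have o : fob F = fob G.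
  apply: functional_extensionality => x; apply: image_ob_inj.
  exact: (f_equal (fun H : functor C E => H x) e).
case: F G e o => [F f f1 fM] [G g g1 gM] /= e o; subst G.
have := fmor_of_eq e erefl; rewrite /= => {e}.
move=> e; have {}e : f = g by exact: e.
by subst g; congr Functor; apply: proof_irrelevance.
Qed.

Section Corestriction.
Variables (C : category) (F : functor C E).
Hypothesis FI : forall x, exists T, I T = F x.

Definition corestrict : functor C image_cat :=
  @Functor C image_cat (fun x => exist _ (F x) (FI x))
    (fun x y f => fmor F f) (fun x => fmor1 F x)
    (fun x y z g f => fmorM F g f).

Lemma corestrict_incl : fcomp image_incl corestrict = F.
Proof. exact: (@eq_functor _ _ (fcomp image_incl corestrict) F erefl erefl). Qed.

Lemma corestrict_sums (K : globe_functor C) :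
  preserves_sums F K -> preserves_sums corestrict K.
Proof.
move=> h T X c /h [cc u]; split; first exact: cc.
by move=> Y; apply: u.
Qed.

End Corestriction.

Lemma image_self (T : theta0) : exists T', I T' = I T.
Proof. by exists T. Qed.

Definition image_theta0 : functor theta0 image_cat := corestrict image_self.

Definition image_globe : globe_functor image_cat := push image_theta0 theta0_globe.

Lemma image_sum (T : table) : exists (X : image_cat)
  (c : fam (fun n => hom (image_globe n) X) T),
  is_globular_sum c /\ is_globular_sum (cocone_image image_incl c).
Proof.
exists (image_theta0 T).
exists (cocone_image (K := theta0_globe) (X := T) image_theta0 (gsum_legs T)).
split.
  by apply: (corestrict_sums image_self (gf_sums I)); apply: gsum_theta0.
have := gf_sums I (gsum_theta0 T).
rewrite -(cocone_image_comp image_incl image_theta0).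
by rewrite /cocone_image.
Qed.

Lemma image_sums (T : table) : exists (X : image_cat)
  (c : fam (fun n => hom (image_globe n) X) T), is_globular_sum c.
Proof. by have [X [c [cs _]]] := image_sum T; exists X, c. Qed.

Definition image_ext : globular_extension := GlobularExtension image_sums.

Lemma image_incl_under : push image_incl image_globe = ge_globe E.
Proof.
rewrite -(gf_under I) /image_globe -push_comp /image_theta0.
by rewrite corestrict_incl.
Qed.

Definition image_inclusion : globular_functor image_ext E :=
  @GlobularFunctor image_ext E image_incl image_incl_under
    (preserves_sums_of image_sum).

Section GlobularCorestriction.
Variables (C : globular_extension) (J : globular_functor theta0 C).
Variables (F : globular_functor C E).
Hypotheses (FJ : fcomp F J = I :> functor _ _)
  (Jsurj : forall x, exists T, J T = x).

Lemma in_image x : exists T, I T = F x.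
Proof. by have [T <-] := Jsurj x; exists T; rewrite -FJ. Qed.

Lemma corestrict_theta0 : fcomp (corestrict in_image) J = image_theta0.
Proof.
by apply: image_incl_mono; rewrite fcompA !corestrict_incl.
Qed.

Lemma corestrict_under : push (corestrict in_image) (ge_globe C) = image_globe.
Proof. by rewrite -(globular_under0 J) -push_comp corestrict_theta0. Qed.

Definition globular_corestrict : globular_functor C image_ext :=
  @GlobularFunctor C image_ext (corestrict in_image) corestrict_under
    (corestrict_sums in_image (gf_sums F)).

End GlobularCorestriction.

End Image.

Definition chaos_cat : category :=
  @Category table (fun _ _ => unit) (fun _ => tt) (fun _ _ _ _ _ => tt)
    (fun x y f => match f with tt => erefl end)
    (fun x y f => match f with tt => erefl end)
    (fun _ _ _ _ _ _ _ => erefl).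

Definition chaos_theta0 : functor theta0 chaos_cat :=
  @Functor theta0 chaos_cat (fun T => T) (fun _ _ _ => tt) (fun _ => erefl)
    (fun _ _ _ _ _ => erefl).

Definition chaos_globe : globe_functor chaos_cat := push chaos_theta0 theta0_globe.

Lemma chaos_sum (K : globe_functor chaos_cat) (T : table) (X : chaos_cat)
    (c : fam (fun n => hom (K n) X) T) : is_globular_sum c.
Proof.
have uu (a b : unit) : a = b by case: a; case: b.
have m i (S : tab i) (x : fam (fun n => unit) S) :
    matching (F := fun _ => unit) (fun _ _ => tt) (fun _ _ => tt) x.
  by elim: S x => [//|i0 i' i2 p q S IH] [x y] /=; split.
split; first exact: m.
move=> Y d _; exists tt; split; last by case.
rewrite /cocone_map; elim: (ttab T) c d => [i0 c d|i0 i' i2 p q S IH [x y] [x' y']] /=.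
  exact: uu.
by rewrite (IH _ y'); congr pair; apply: uu.
Qed.

Lemma chaos_sums (T : table) : exists (X : chaos_cat)
  (c : fam (fun n => hom (chaos_globe n) X) T), is_globular_sum c.
Proof.
exists T, (cocone_image (K := theta0_globe) (X := T) chaos_theta0 (gsum_legs T)).
exact: chaos_sum.
Qed.

Definition chaos : globular_extension := GlobularExtension chaos_sums.

Definition chaos_theta0_globular : globular_functor theta0 chaos :=
  @GlobularFunctor theta0 chaos chaos_theta0 erefl
    (fun T X c _ => chaos_sum _).

Definition arrow_map (C D : category) (F : functor C D) (a : arrow C) : arrow D :=
  Arrow (fmor F (amor a)).

Lemma globular_id_under (C : globular_extension) :
  push (fid C) (ge_globe C) = ge_globe C.
Proof.
exact: (@eq_globe_functor _ (push (fid C) (ge_globe C)) (ge_globe C) erefl erefl erefl).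
Qed.

Lemma globular_id_sums (C : globular_extension) :
  preserves_sums (fid C) (ge_globe C).
Proof. by move=> T X c cs; rewrite /cocone_image fam_map_id. Qed.

Definition globular_id (C : globular_extension) : globular_functor C C :=
  GlobularFunctor (globular_id_under C) (@globular_id_sums C).

Section FreeTheory.
Variables (C : globular_extension) (P : free_presentation C).
Let E := fp_tower P.

Fixpoint stage_theta0 n : globular_functor theta0 (ct_stage E n) :=
  match n return globular_functor theta0 (ct_stage E n) with
  | 0 => globular_id theta0
  | n.+1 => globular_comp (ct_map E n) (stage_theta0 n)
  end.

Lemma fcompid (A B : category) (F : functor A B) : fcomp F (fid A) = F.
Proof. exact: (@eq_functor _ _ (fcomp F (fid A)) F erefl erefl). Qed.

Lemma fidcomp (A B : category) (F : functor A B) : fcomp (fid B) F = F.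
Proof. exact: (@eq_functor _ _ (fcomp (fid B) F) F erefl erefl). Qed.

Lemma leg_stage_theta0 n :
  fcomp (fp_leg P n) (stage_theta0 n) = fp_leg P 0 :> functor _ _.
Proof.
elim: n => [|n IH]; first exact: fcompid.
rewrite -[RHS]IH -(fp_cocone P n); exact: fcompA.
Qed.

Lemma stage_theta0_surj n (x : ct_stage E n) : exists T, stage_theta0 n T = x.
Proof.
elim: n x => [|n IH] x; first by exists x.
set J := stage_theta0 n in IH; pose I := ct_map E n.
pose K := globular_comp I J.
have [lI uI] := @ct_adds E n.
pose F0 := globular_corestrict (I := K) (F := I) (J := J) erefl IH.
pose m : choice_on (@ct_pairs E n) F0 := @ct_lift E n.
have [|G [[GI Gl] _]] := uI _ F0 m; first by move=> a Aa; apply: lI.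
have [H [_ Hu]] := uI _ I (@ct_lift E n) lI.
pose G' := globular_comp (image_inclusion K) G.
have eG : H = G'.
  apply: Hu; split; first by rewrite /= -fcompA GI corestrict_incl.
  move=> a Aa; exact: (f_equal (arrow_map (image_incl K)) (Gl a Aa)).
have e1 : H = globular_id _ by apply: Hu; split=> //; apply: fidcomp.
have [T e] := proj2_sig (G x); exists T; rewrite [LHS]e.
rewrite -[LHS]/(G' x) -eG e1 //.
Qed.

Lemma leg0_surj (x : C) : exists T, fp_leg P 0 T = x.
Proof.
pose I := fp_leg P 0.
pose L n := globular_corestrict (I := I) (leg_stage_theta0 n) (@stage_theta0_surj n).
have LE n : fcomp (image_incl I) (L n) = fp_leg P n by apply: corestrict_incl.
have Lc : is_tower_cocone L.
  by move=> n; apply: image_incl_mono; rewrite fcompA !LE; apply: fp_cocone.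
have [G [Gl _]] := fp_colimit Lc.
have [H [_ Hu]] := fp_colimit (fp_cocone P).
pose G' := globular_comp (image_inclusion I) G.
have eG : H = G' by apply: Hu => n; rewrite /= -fcompA Gl LE.
have e1 : H = globular_id _ by apply: Hu => n; apply: fidcomp.
have [T e] := proj2_sig (G x); exists T; rewrite [LHS]e.
by rewrite -[LHS]/(G' x) -eG e1.
Qed.

Lemma stage_retract n (R : globular_functor (ct_stage E n) chaos) :
  exists R' : globular_functor (ct_stage E n.+1) chaos,
    fcomp R' (ct_map E n) = R :> functor _ _.
Proof.
have [_ u] := @ct_adds E n.
have [|R' [[e _] _]] := u chaos R (fun _ _ => tt); last by exists R'.
by split; case: (fmor _ _); case: (_ \c _).
Qed.

Fixpoint stage_chaos n : globular_functor (ct_stage E n) chaos :=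
  match n return globular_functor (ct_stage E n) chaos with
  | 0 => chaos_theta0_globular
  | n.+1 => proj1_sig (constructive_indefinite_description _
              (stage_retract (stage_chaos n)))
  end.

Lemma stage_chaos_cocone : is_tower_cocone stage_chaos.
Proof.
move=> n; exact: (proj2_sig (constructive_indefinite_description _
  (stage_retract (stage_chaos n)))).
Qed.

Lemma leg0_inj (S T : theta0) : fp_leg P 0 S = fp_leg P 0 T -> S = T.
Proof.
have [G [Gl _]] := fp_colimit stage_chaos_cocone.
have GE (U : theta0) : G (fp_leg P 0 U) = U.
  exact: (f_equal (fun H : functor theta0 chaos_cat => H U) (Gl 0)).
by move=> e; rewrite -(GE S) e GE.
Qed.

Lemma free_bij : bijective_on_objects (fp_leg P 0 : globular_functor theta0 C).
Proof.
move=> x; have [T e] := leg0_surj x; exists T; split=> // S Se.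
by apply: leg0_inj; rewrite e.
Qed.

Definition free_theory : globular_theory := GlobularTheory free_bij.

End FreeTheory.

Record coherator := Coherator {
  coh_ext :> globular_extension;
  coh_free : free_presentation coh_ext;
  coh_contractible : contractible coh_ext }.

Definition coh_theory (C : coherator) : globular_theory :=
  free_theory (coh_free C).

(* Main.v *)
Require Import Defs.
From mathcomp Require Import all_boot.
From Stdlib Require Import FunctionalExtensionality ClassicalEpsilon.

Set Implicit Arguments.
Unset Strict Implicit.
Unset Printing Implicit Defensive.

(** The theorem rests on one fact: for every table [T], the free strict oo-groupoid
    L(G_T) is weakly contractible, that is, any two parallel n-arrows of it are the
    source and the target of an (n+1)-arrow ([gsum_contractible]). Above the dimension
    of [T] all arrows of L(G_T) are identities ([free_above]). Hence, when [T] has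
    dimension at most n+1, two (n+1)-arrows with the same source and target are equal,
    since an (n+2)-arrow joins them ([gsum_filler_unique]). So an admissible pair of
    [theta_tilde] has exactly one lifting, and a free globular extension has exactly one
    globular functor to [theta_tilde]: at each stage of the tower the images of the added
    liftings exist and are forced ([free_unique_functor]).

    Contractibility is proved by attaching disks. Every G_T is obtained from the point by
    elementary expansions, each of which attaches a disk D_(n+1) along its source to an
    n-cell [x]. If G' is an expansion of G, then L(G') retracts onto L(G) by sending the
    new (n+1)-cell to the identity of [x], and there is a homotopy from the retraction,
    followed by the inclusion, to the identity of L(G'). Its components are identities in
    dimension less than n, and (n+1)-arrows in dimension n; being invertible, they carry
    a filler in L(G) to a filler in L(G') ([expansion_contractible]). The homotopy is a
    morphism from L(G') to an oo-groupoid of cylinders in L(G'), and it exists by the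
    universal property of L(G'): it is constant on G, and the new cell [a] is sent to a
    cylinder from the identity of [x] to [a] ([expansion_homotopy]). The axioms for
    cylinders are manageable when all cells of all dimensions are in a single set, a cell
    being identified with its identities ([omega_cat]). A strict oo-category gives such a
    structure ([sseq_cat]), and conversely ([cell_cat]).

    For full faithfulness, a natural transformation between the restrictions to C of the
    nerves of G and H induces a map from the cells of G to those of H, by evaluation at
    the disks. It preserves compositions and identities once the arrows
    D_i -> D_i +_(D_j) D_i and D_(i+1) -> D_i of [theta_tilde] that corepresent these
    operations are images of arrows of C. Such arrows of C are constructed by
    contractibility, their source and target being arrows already constructed in lower
    dimension; that they have the right image is again the uniqueness of liftings
    ([lifted_comp], [lifted_id]). *)

(** * Strict oo-categories with a single set of cells *)

(** [bd false j] and [bd true j] are the source and target in dimension [j]; [m]-cells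
    are the elements fixed by them for [j >= m]. The composite [comp j x y] is a total
    function, of interest for composable [x] and [y] only. *)
Record omega_cat := OmegaCat {
  oc :> Type;
  bd : bool -> nat -> oc -> oc;
  comp : nat -> oc -> oc -> oc;
  bd_lt : forall b c i j x, i < j -> bd b i (bd c j x) = bd b i x;
  bd_ge : forall b c i j x, j <= i -> bd b i (bd c j x) = bd c j x;
  bd_comp_eq : forall b j x y, bd false j x = bd true j y ->
    bd b j (comp j x y) = bd b j (if b then x else y);
  bd_comp_gt : forall b i j x y, j < i -> bd false j x = bd true j y ->
    bd b i (comp j x y) = comp j (bd b i x) (bd b i y);
  comp_src : forall j x, comp j x (bd false j x) = x;
  comp_tgt : forall j x, comp j (bd true j x) x = x;
  comp_assoc : forall j x y z, bd false j x = bd true j y -> bd false j y = bd true j z ->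
    comp j (comp j x y) z = comp j x (comp j y z);
  comp_exchange : forall i j a b c d, i < j ->
    bd false j a = bd true j b -> bd false j c = bd true j d ->
    bd false i a = bd true i c -> bd false i b = bd true i d ->
    comp i (comp j a b) (comp j c d) = comp j (comp i a c) (comp i b d) }.

Arguments bd {o} b j x.
Arguments comp {o} j x y.

Notation composable j x y := (bd false j x = bd true j y) (only parsing).

Definition inverses (A : omega_cat) j (x y : A) : Prop :=
  [/\ composable j x y, composable j y x, comp j x y = bd true j x
    & comp j y x = bd false j x].

Definition has_inverses (A : omega_cat) : Prop :=
  forall j (x : A), bd false j.+1 x = x ->
    exists2 y, bd false j.+1 y = y & inverses j x y.

Section OmegaCat.
Variable A : omega_cat.
Implicit Types (x y z : A) (b c : bool) (i j m n : nat).

Lemma bd_cell b j m x : bd false m x = x -> m <= j -> bd b j x = x.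
Proof. by move=> <- mj; rewrite bd_ge. Qed.

Lemma bd_comp_lt b i j x y : i < j -> composable j x y ->
  bd b i (comp j x y) = bd b i x.
Proof. by move=> ij e; rewrite -(bd_lt b true _ ij) bd_comp_eq // bd_lt. Qed.

Lemma composable_lt b i j x y : i < j -> composable j x y -> bd b i x = bd b i y.
Proof. by move=> ij e; rewrite -(bd_lt b false _ ij) e bd_lt. Qed.

Lemma inverse_unique j x y z : inverses j x y -> inverses j x z -> y = z.
Proof.
move=> [xy yx xyE yxE] [xz zx xzE zxE].
rewrite -[y](comp_src j) [bd _ _ y]yx -xzE -comp_assoc // yxE [bd _ _ x]xz.
exact: comp_tgt.
Qed.

(** For a 2-cell [x : s => t] of a 2-category, [s^-1 x^-1 t^-1] is inverse to [x] for
    horizontal composition, where [x^-1] is its vertical inverse. *)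
Lemma left_inverse_S j x : has_inverses A -> bd false j.+2 x = x ->
  exists y, [/\ bd false j.+2 y = y, composable j y x, composable j x y
    & comp j y x = bd false j x].
Proof.
move=> inv x2; have [v v2 [xv vx xvE vxE]] := inv _ _ x2.
have jj : j < j.+1 := ltnSn j.
have b1 b y : bd false j.+1 (bd b j.+1 y) = bd b j.+1 y by rewrite bd_ge.
have [s s1 [S1 S2 S3 S4]] := inv _ _ (b1 false x).
have [t t1 [T1 T2 T3 T4]] := inv _ _ (b1 true x).
rewrite !bd_lt // in S1 S2 T1 T2 S3 S4 T3 T4.
have vb b : bd b j v = bd b j x by rewrite -(bd_lt b false _ jj) vx bd_lt.
have bE b c y : bd b j.+1 (bd c j y) = bd c j y by rewrite bd_ge.
have vt : composable j v t by rewrite vb T1.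
have svt : composable j s (comp j v t) by rewrite bd_comp_eq // vb S2.
have s2 : bd false j.+2 s = s by apply: (bd_cell _ s1).
have t2 : bd false j.+2 t = t by apply: (bd_cell _ t1).
have j2 : j < j.+2 by rewrite ltnS ltnW.
have tx : composable j t x by [].
exists (comp j s (comp j v t)); split.
- by rewrite (bd_comp_gt _ j2 svt) (bd_comp_gt _ j2 vt) s2 v2 t2.
- by rewrite (bd_comp_eq _ svt) (bd_comp_eq _ vt) T2.
- by rewrite (bd_comp_eq _ svt) S1.
have vtx : composable j v (comp j t x) by rewrite bd_comp_eq // vb T1.
rewrite !comp_assoc //; last by rewrite bd_comp_eq // vb S2.
have txT : bd true j.+1 (comp j t x) = bd false j x.
  by rewrite bd_comp_gt // (bd_cell _ t1) // T4.
have -> : comp j v (comp j t x) = bd false j.+1 x.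
  rewrite -{1}[v](comp_src j.+1) -{1}[comp j t x](comp_tgt j.+1) txT vx.
  rewrite comp_exchange //; last by rewrite bd_lt // bd_comp_eq.
  - rewrite -(vb false) comp_src -[X in comp j.+1 v X]comp_assoc // ?T3 ?comp_tgt //.
    by rewrite bd_lt.
  - by rewrite bd_ge.
  - by rewrite bE txT.
  - by rewrite bd_ge // vb.
by rewrite S4.
Qed.

Lemma inverse_S j x : has_inverses A -> bd false j.+2 x = x ->
  exists2 y, bd false j.+2 y = y & inverses j x y.
Proof.
move=> inv x2; have [y [y2 yx xy e]] := left_inverse_S inv x2.
have [z [_ zy yz f]] := left_inverse_S inv y2.
exists y => //; split=> //.
suff xz : z = x by rewrite -{1}xz f.
rewrite -[z](comp_src j) [bd _ _ z]zy -[bd true j y]xy -e -comp_assoc // f yx.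
exact: comp_tgt.
Qed.

End OmegaCat.

(** * The strict oo-groupoid of cells *)

Section ToGroupoid.
Variable A : omega_cat.

Definition ocell (m : nat) : Type := {x : A | bd false m x = x}.

Lemma ocell_inj m (x y : ocell m) : proj1_sig x = proj1_sig y -> x = y.
Proof. by apply: eq_sig_hprop => z; apply: proof_irrelevance. Qed.

Lemma bd_is_cell b m (x : A) : bd false m (bd b m x) = bd b m x.
Proof. by rewrite bd_ge. Qed.

Definition cell_bd b m (x : ocell m.+1) : ocell m :=
  exist _ (bd b m (proj1_sig x)) (bd_is_cell b m _).

Lemma cell_bd_bd b c m (x : ocell m.+2) :
  cell_bd b (cell_bd false x) = cell_bd b (cell_bd c x).
Proof. by apply: ocell_inj; rewrite /= !bd_lt. Qed.

Definition cell_gset : gset :=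
  @GSet ocell (cell_bd false) (cell_bd true) (fun m x => cell_bd_bd false true x)
    (fun m x => cell_bd_bd true true x).

Lemma isrc_ocell j i (p : Lt j i) (x : cell_gset i) :
  proj1_sig (isrc p x) = bd false j (proj1_sig x).
Proof.
elim: p x => [//|k p IH] x; rewrite [LHS](IH (gsrc x)) /= bd_lt //.
exact: Lt_ltn p.
Qed.

Lemma itgt_ocell j i (p : Lt j i) (x : cell_gset i) :
  proj1_sig (itgt p x) = bd true j (proj1_sig x).
Proof.
elim: p x => [//|k p IH] x; rewrite [LHS](IH (gtgt x)) /= bd_lt //.
exact: Lt_ltn p.
Qed.

Lemma ocell_composable j i (p : Lt j i) (x y : cell_gset i) :
  isrc p x = itgt p y -> composable j (proj1_sig x) (proj1_sig y).
Proof. by rewrite -(isrc_ocell p) -(itgt_ocell p) => ->. Qed.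

Lemma comp_is_cell j i (p : Lt j i) (x y : cell_gset i) (e : isrc p x = itgt p y) :
  bd false i (comp j (proj1_sig x) (proj1_sig y)) = comp j (proj1_sig x) (proj1_sig y).
Proof.
rewrite bd_comp_gt ?(proj2_sig x) ?(proj2_sig y) //; first exact: Lt_ltn p.
exact: ocell_composable e.
Qed.

Definition cell_comp j i (p : Lt j i) (x y : cell_gset i) (e : isrc p x = itgt p y) :
    cell_gset i :=
  exist _ (comp j (proj1_sig x) (proj1_sig y)) (comp_is_cell e).

Lemma id_is_cell m (x : cell_gset m) :
  bd false m.+1 (proj1_sig x) = proj1_sig x.
Proof. exact: bd_cell (proj2_sig x) (leqnSn m). Qed.

Definition cell_id m (x : cell_gset m) : cell_gset m.+1 :=
  exist _ (proj1_sig x) (id_is_cell x).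

Lemma iter_cell_id j i (p : Lt j i) (x : cell_gset j) :
  proj1_sig (iter_up cell_id p x) = proj1_sig x.
Proof. by elim: p. Qed.

Definition cell_cat : strict_cat.
Proof.
refine (@StrictCat cell_gset cell_comp cell_id _ _ _ _ _ _ _ _ _ _ _).
- move=> i u v e; apply: ocell_inj => /=.
  by rewrite (bd_comp_eq _ (ocell_composable e)).
- move=> i u v e; apply: ocell_inj => /=.
  by rewrite (bd_comp_eq _ (ocell_composable e)).
- move=> j i p u v e e'; apply: ocell_inj => /=.
  by rewrite (bd_comp_gt _ (Lt_ltn p) (ocell_composable e)).
- move=> j i p u v e e'; apply: ocell_inj => /=.
  by rewrite (bd_comp_gt _ (Lt_ltn p) (ocell_composable e)).
- by move=> i u; apply: ocell_inj; apply: (proj2_sig u).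
- by move=> i u; apply: ocell_inj; rewrite /= (bd_cell _ (proj2_sig u)).
- move=> j i p u v w uv vw uv_w u_vw; apply: ocell_inj => /=.
  exact: comp_assoc (ocell_composable uv) (ocell_composable vw).
- move=> k j i r p q u u' v v' uu' vv' uv uv' e e'; apply: ocell_inj => /=.
  by apply: comp_exchange (Lt_ltn r) _ _ _ _; apply: ocell_composable; eassumption.
- move=> j i p u e; apply: ocell_inj.
  by rewrite /= iter_cell_id isrc_ocell comp_src.
- move=> j i p u e; apply: ocell_inj.
  by rewrite /= iter_cell_id itgt_ocell comp_tgt.
- by move=> j i p u v e e'; apply: ocell_inj.
Defined.

Hypothesis inv : has_inverses A.

Lemma cell_inv i (u : cell_cat i.+1) : exists v, is_inverse u v.
Proof.
have [y yc [uy yu uyE yuE]] := inv (proj2_sig u).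
pose v : cell_cat i.+1 := exist (fun z : A => bd false i.+1 z = z) y yc.
have e : isrc Lt1 u = itgt Lt1 v by apply: ocell_inj.
have e' : isrc Lt1 v = itgt Lt1 u by apply: ocell_inj.
exists v.
by exists e, e'; split; apply: ocell_inj.
Qed.

Definition cell_gpd : strict_gpd := StrictGpd cell_inv.

End ToGroupoid.

(** * Cylinders *)

Section Cylinder.
Variables (A : omega_cat) (n : nat).

(** A cylinder has two ends [x], [y] and two walls, (n+1)-cells from the [n]-source of
    [x] to that of [y] ([cyl_wall false]) and from the [n]-target of [x] to that of [y]
    ([cyl_wall true]); [wall_nat] is the naturality of the walls with respect to the ends.
    In dimension less than [n] the ends have the same boundaries, so a morphism to the
    cylinders is a homotopy that is constant in these dimensions. *)
Record cylinder := Cylinder {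
  cyl_end : bool -> A;
  cyl_wall : bool -> A;
  wall_cell : forall c, bd false n.+1 (cyl_wall c) = cyl_wall c;
  wall_bd : forall b c, bd b n (cyl_wall c) = bd c n (cyl_end b);
  wall_nat : comp n (cyl_wall true) (cyl_end false) =
    comp n (cyl_end true) (cyl_wall false) }.

Lemma cyl_ext (p q : cylinder) :
  (forall c, cyl_end p c = cyl_end q c) ->
  (forall c, cyl_wall p c = cyl_wall q c) -> p = q.
Proof.
case: p q => [g w a b e] [g' w' a' b' e'] /= /functional_extensionality gg.
move=> /functional_extensionality ww; subst g' w'.
by congr Cylinder; apply: proof_irrelevance.
Qed.

(** The source and target of a cylinder in dimension [n] are its two walls, each seen as a
    cylinder between [n]-cells. *)
Definition bd_wall b j (w : bool -> A) (c : bool) : A :=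
  if j < n then bd b j (w c) else if j == n then w b else w c.

(** In dimension [n] cylinders are pasted along a common wall. *)
Definition comp_wall j (w w' : bool -> A) (c : bool) : A :=
  if j < n then comp j (w c) (w' c)
  else if j == n then (if c then w c else w' c) else w c.

Lemma bd_wall_cell (p : cylinder) b j c :
  bd false n.+1 (bd_wall b j (cyl_wall p) c) = bd_wall b j (cyl_wall p) c.
Proof.
rewrite /bd_wall; case: ltngtP => jn; rewrite ?wall_cell //.
by rewrite bd_ge // ltnW // ltnW.
Qed.

Lemma bd_wall_bd (p : cylinder) a j b c :
  bd b n (bd_wall a j (cyl_wall p) c) = bd c n (bd a j (cyl_end p b)).
Proof.
rewrite /bd_wall; case: ltngtP => jn.
- rewrite !(bd_ge _ _ _ (ltnW jn)).
  by rewrite -(bd_lt a b _ jn) wall_bd bd_lt.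
- by rewrite wall_bd bd_lt.
- by subst j; rewrite wall_bd bd_ge.
Qed.

Lemma bd_wall_nat (p : cylinder) a j :
  comp n (bd_wall a j (cyl_wall p) true) (bd a j (cyl_end p false)) =
  comp n (bd a j (cyl_end p true)) (bd_wall a j (cyl_wall p) false).
Proof.
have ww c b : bd a n (cyl_wall p c) = bd c n (cyl_end p a) by apply: wall_bd.
rewrite /bd_wall; case: ltngtP => jn.
- have bdE c d : bd a j (cyl_wall p c) = bd a j (cyl_end p d).
    rewrite -(bd_lt a false _ jn) -(bd_lt a c (cyl_end p d) jn).
    rewrite -wall_bd !bd_lt //.
  by rewrite !(bdE _ true) -(bdE true false) -(bdE true true).
- rewrite -{1}(bd_cell a (wall_cell p true) jn) -[in RHS](bd_cell a (wall_cell p false) jn).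
  rewrite -!bd_comp_gt ?wall_nat // ?[LHS]wall_bd //.
  exact: (esym (wall_bd p true false)).
- by subst j; rewrite -!wall_bd comp_src comp_tgt.
Qed.

Definition cyl_bd b j (p : cylinder) : cylinder :=
  Cylinder (bd_wall_cell p b j) (bd_wall_bd p b j) (bd_wall_nat p b j).

Section Comp.
Variables (j : nat) (p q : cylinder).
Hypothesis pq : cyl_bd false j p = cyl_bd true j q.

Lemma cyl_composable_end c : composable j (cyl_end p c) (cyl_end q c).
Proof. exact: (f_equal (fun r => cyl_end r c) pq). Qed.

Lemma cyl_composable_wall c : bd_wall false j (cyl_wall p) c = bd_wall true j (cyl_wall q) c.
Proof. exact: (f_equal (fun r => cyl_wall r c) pq). Qed.

Lemma cyl_composable_lt c : j < n -> composable j (cyl_wall p c) (cyl_wall q c).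
Proof. by move=> jn; have := cyl_composable_wall c; rewrite /bd_wall jn. Qed.

Lemma cyl_composable_eq : j = n -> cyl_wall p false = cyl_wall q true.
Proof.
by move=> jn; have := cyl_composable_wall true; rewrite /bd_wall jn ltnn eqxx.
Qed.

Lemma cyl_composable_gt c : n < j -> cyl_wall p c = cyl_wall q c.
Proof.
move=> jn; have := cyl_composable_wall c.
by rewrite /bd_wall ltnNge ltnW //= gtn_eqF.
Qed.

Lemma comp_wall_cell c :
  bd false n.+1 (comp_wall j (cyl_wall p) (cyl_wall q) c) =
  comp_wall j (cyl_wall p) (cyl_wall q) c.
Proof.
rewrite /comp_wall; case: ltngtP => jn; rewrite ?wall_cell //.
  by rewrite bd_comp_gt ?wall_cell //; [apply: ltnW | apply: cyl_composable_lt].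
by case: c; rewrite wall_cell.
Qed.

Lemma comp_wall_bd b c :
  bd b n (comp_wall j (cyl_wall p) (cyl_wall q) c) =
  bd c n (comp j (cyl_end p b) (cyl_end q b)).
Proof.
have gg := cyl_composable_end b.
rewrite /comp_wall; case: ltngtP => jn.
- by rewrite !bd_comp_gt ?wall_bd //; apply: cyl_composable_lt.
- by rewrite wall_bd (bd_comp_lt _ jn gg).
- by subst j; rewrite (bd_comp_eq _ gg); case: c; rewrite wall_bd.
Qed.

Lemma comp_wall_nat :
  comp n (comp_wall j (cyl_wall p) (cyl_wall q) true)
    (comp j (cyl_end p false) (cyl_end q false)) =
  comp n (comp j (cyl_end p true) (cyl_end q true))
    (comp_wall j (cyl_wall p) (cyl_wall q) false).
Proof.
have gg c := cyl_composable_end c.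
have wg r : composable n (cyl_wall r true) (cyl_end r false) by apply: wall_bd.
have gw r : composable n (cyl_end r true) (cyl_wall r false) by apply/esym/wall_bd.
rewrite /comp_wall; case: ltngtP => jn.
- have ww c := cyl_composable_lt c jn.
  rewrite -!(comp_exchange jn) //. by rewrite !wall_nat.
- have E c := cyl_composable_gt c jn.
  have bw b c : bd b j (cyl_wall p c) = cyl_wall p c by apply: bd_cell (wall_cell _ _) _.
  have wwE c : comp j (cyl_wall p c) (cyl_wall q c) = cyl_wall p c.
    by rewrite -E -{2}(bw false) comp_src.
  have ww c : composable j (cyl_wall p c) (cyl_wall q c) by rewrite -E !bw.
  rewrite -{1}wwE -[in RHS]wwE.
  by rewrite !(comp_exchange jn) // ?wall_nat.
- have E := cyl_composable_eq jn; subst j.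
  rewrite -comp_assoc // wall_nat !comp_assoc // ?E ?wall_nat //.
Qed.

End Comp.

Definition cyl_comp j (p q : cylinder) : cylinder :=
  match excluded_middle_informative (cyl_bd false j p = cyl_bd true j q) with
  | left e => Cylinder (comp_wall_cell e) (comp_wall_bd e) (comp_wall_nat e)
  | right _ => q
  end.

Lemma end_comp j p q c : cyl_bd false j p = cyl_bd true j q ->
  cyl_end (cyl_comp j p q) c = comp j (cyl_end p c) (cyl_end q c).
Proof. by rewrite /cyl_comp; case: excluded_middle_informative. Qed.

Lemma wall_comp j p q c : cyl_bd false j p = cyl_bd true j q ->
  cyl_wall (cyl_comp j p q) c = comp_wall j (cyl_wall p) (cyl_wall q) c.
Proof. by rewrite /cyl_comp; case: excluded_middle_informative. Qed.

Lemma cyl_bd_lt b c i j p : i < j ->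
  cyl_bd b i (cyl_bd c j p) = cyl_bd b i p.
Proof.
move=> ij; apply: cyl_ext => d /=; first by rewrite bd_lt.
rewrite /bd_wall; case: (ltngtP i n) => i_n //.
- case: (ltngtP j n) => j_n //; rewrite ?bd_lt //.
  subst j; rewrite -(bd_lt b false (cyl_wall p c) ij).
  by rewrite -(bd_lt b false (cyl_wall p d) ij) !wall_bd !bd_lt.
- by rewrite ltnNge (ltnW (ltn_trans i_n ij)) /= gtn_eqF // (ltn_trans i_n).
- by subst i; rewrite ltnNge (ltnW ij) gtn_eqF.
Qed.

Lemma cyl_bd_ge b c i j p : j <= i ->
  cyl_bd b i (cyl_bd c j p) = cyl_bd c j p.
Proof.
move=> ji; apply: cyl_ext => d /=; first by rewrite bd_ge.
rewrite /bd_wall; case: (ltngtP i n) => i_n //.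
  by rewrite (leq_ltn_trans ji i_n) bd_ge.
subst i; case: ltngtP => [jn|jn|//].
  rewrite -(bd_lt c false (cyl_wall p b) jn).
  by rewrite -(bd_lt c false (cyl_wall p d) jn) !wall_bd !bd_lt.
by rewrite leqNgt jn in ji.
Qed.

Lemma cyl_bd_comp_eq b j p q : cyl_bd false j p = cyl_bd true j q ->
  cyl_bd b j (cyl_comp j p q) = cyl_bd b j (if b then p else q).
Proof.
move=> pq; apply: cyl_ext => c.
  by rewrite /= end_comp // bd_comp_eq; [case: b | apply: cyl_composable_end].
rewrite /= /bd_wall !wall_comp // /comp_wall; case: ltngtP => jn.
- by rewrite bd_comp_eq; [case: b | apply: cyl_composable_lt].
- by case: b => //; rewrite (cyl_composable_gt pq).
- by case: b.
Qed.

Lemma cyl_bd_comp_gt b i j p q : j < i -> cyl_bd false j p = cyl_bd true j q ->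
  cyl_bd b i (cyl_comp j p q) = cyl_comp j (cyl_bd b i p) (cyl_bd b i q).
Proof.
move=> ji pq.
have pq' : cyl_bd false j (cyl_bd b i p) = cyl_bd true j (cyl_bd b i q).
  by rewrite !cyl_bd_lt.
apply: cyl_ext => c; first by rewrite /= !end_comp //= bd_comp_gt //; apply: cyl_composable_end.
rewrite /= /bd_wall !wall_comp //= /comp_wall /bd_wall.
case: (ltngtP j n) => jn.
- have ww d := cyl_composable_lt pq d jn.
  by case: (ltngtP i n) => i_n //; rewrite bd_comp_gt.
- by rewrite ltnNge (ltnW (ltn_trans jn ji)) /= gtn_eqF // (ltn_trans jn).
- by subst j; rewrite ltnNge (ltnW ji) gtn_eqF.
Qed.

Lemma cyl_comp_src j p : cyl_comp j p (cyl_bd false j p) = p.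
Proof.
have e : cyl_bd false j p = cyl_bd true j (cyl_bd false j p).
  by rewrite cyl_bd_ge.
apply: cyl_ext => c; first by rewrite end_comp // comp_src.
rewrite wall_comp // /comp_wall /= /bd_wall; case: ltngtP => jn //; first by rewrite comp_src.
by case: c.
Qed.

Lemma cyl_comp_tgt j p : cyl_comp j (cyl_bd true j p) p = p.
Proof.
have e : cyl_bd false j (cyl_bd true j p) = cyl_bd true j p.
  by rewrite cyl_bd_ge.
apply: cyl_ext => c; first by rewrite end_comp // comp_tgt.
rewrite wall_comp // /comp_wall /= /bd_wall; case: ltngtP => jn //; first by rewrite comp_tgt.
by case: c.
Qed.

Lemma cyl_comp_assoc j p q r : cyl_bd false j p = cyl_bd true j q ->
  cyl_bd false j q = cyl_bd true j r ->
  cyl_comp j (cyl_comp j p q) r = cyl_comp j p (cyl_comp j q r).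
Proof.
move=> pq qr.
have e1 : cyl_bd false j (cyl_comp j p q) = cyl_bd true j r.
  by rewrite cyl_bd_comp_eq.
have e2 : cyl_bd false j p = cyl_bd true j (cyl_comp j q r).
  by rewrite cyl_bd_comp_eq.
apply: cyl_ext => c.
  by rewrite !end_comp // comp_assoc //; apply: cyl_composable_end.
rewrite !wall_comp // /comp_wall !wall_comp // /comp_wall; case: ltngtP => jn //.
  by rewrite comp_assoc //; apply: cyl_composable_lt.
by case: c.
Qed.

Lemma cyl_exchange i j a b c d : i < j ->
  cyl_bd false j a = cyl_bd true j b -> cyl_bd false j c = cyl_bd true j d ->
  cyl_bd false i a = cyl_bd true i c -> cyl_bd false i b = cyl_bd true i d ->
  cyl_comp i (cyl_comp j a b) (cyl_comp j c d) =
  cyl_comp j (cyl_comp i a c) (cyl_comp i b d).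
Proof.
move=> ij ab cd ac bdd.
have e1 : cyl_bd false i (cyl_comp j a b) = cyl_bd true i (cyl_comp j c d).
  rewrite -(cyl_bd_lt _ false _ ij) cyl_bd_comp_eq //.
  rewrite -(cyl_bd_lt _ false (cyl_comp j c d) ij) cyl_bd_comp_eq //.
  by rewrite !cyl_bd_lt.
have e2 : cyl_bd false j (cyl_comp i a c) = cyl_bd true j (cyl_comp i b d).
  by rewrite !cyl_bd_comp_gt // ab cd.
apply: cyl_ext => f.
  by rewrite !end_comp // comp_exchange //; apply: cyl_composable_end.
rewrite !wall_comp // /comp_wall !wall_comp // /comp_wall; case: (ltngtP i n) => i_n //.
- case: (ltngtP j n) => j_n //; last by case: f.
  by rewrite comp_exchange //; apply: cyl_composable_lt.
- by subst i; rewrite ltnNge (ltnW ij) gtn_eqF.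
Qed.

Definition cyl_cat : omega_cat :=
  OmegaCat cyl_bd_lt cyl_bd_ge cyl_bd_comp_eq cyl_bd_comp_gt cyl_comp_src
    cyl_comp_tgt cyl_comp_assoc cyl_exchange.

Hypothesis inv : has_inverses A.

(** The walls are unchanged. The two sides of the naturality equation of the inverse are
    inverses of the corresponding sides for [p], which are equal. *)
Lemma cyl_inv_gt j (p : cylinder) : n < j -> cyl_bd false j.+1 p = p ->
  exists2 q : cyl_cat, cyl_bd false j.+1 q = q & inverses (A := cyl_cat) j p q.
Proof.
move=> nj pj.
have nj1 : n < j.+1 by apply: ltnW.
have gj c : bd false j.+1 (cyl_end p c) = cyl_end p c.
  exact: (f_equal (fun r => cyl_end r c) pj).
have [g0 g0c g0P] := inv (gj false); have [g1 g1c g1P] := inv (gj true).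
pose g (c : bool) := if c then g1 else g0.
have gc c : bd false j.+1 (g c) = g c by case: c.
have gP c : inverses j (cyl_end p c) (g c) by case: c.
have gb b c : bd b n (g c) = bd b n (cyl_end p c).
  by have [/(composable_lt b nj)-> _ _ _] := gP c.
have wb b c : bd b j (cyl_wall p c) = cyl_wall p c by apply: bd_cell (wall_cell p c) _.
have ww c : comp j (cyl_wall p c) (cyl_wall p c) = cyl_wall p c.
  by rewrite -{2}(wb false) comp_src.
have wc c : composable j (cyl_wall p c) (cyl_wall p c) by rewrite !wb.
have k1 b c : bd b n (cyl_wall p c) = bd c n (g b) by rewrite gb wall_bd.
have k2 : comp n (cyl_wall p true) (g false) = comp n (g true) (cyl_wall p false).
  have eL : inverses j (comp n (cyl_wall p true) (cyl_end p false))
      (comp n (cyl_wall p true) (g false)).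
    have [a b c d] := gP false.
    have x1 := wall_bd p false true; have x2 := k1 false true.
    split; rewrite ?bd_comp_gt // ?wb ?a ?b // -comp_exchange // ww ?c ?d ?a //.
  have eR : inverses j (comp n (cyl_end p true) (cyl_wall p false))
      (comp n (g true) (cyl_wall p false)).
    have [a b c d] := gP true.
    have x1 := esym (wall_bd p true false); have x2 := esym (k1 true false).
    split; rewrite ?bd_comp_gt // ?wb ?a ?b // -comp_exchange // ww ?c ?d ?a //.
  by rewrite wall_nat in eL; apply: inverse_unique eL eR.
pose q := Cylinder (wall_cell p) k1 k2.
have pq b : cyl_bd b j p = cyl_bd (~~ b) j q.
  apply: cyl_ext => c /=; last by rewrite /bd_wall ltnNge (ltnW nj) /= gtn_eqF.
  by have [a b' _ _] := gP c; case: (b).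
have qp b : cyl_bd b j q = cyl_bd (~~ b) j p by rewrite pq negbK.
exists q.
  apply: cyl_ext => c //=; rewrite /bd_wall ltnNge (ltnW nj1) /= gtn_eqF //.
split; [exact: (pq false) | exact: (qp false) | |]; apply: cyl_ext => c.
- by rewrite /= end_comp ?pq //=; have [_ _ ->] := gP c.
- by rewrite /= wall_comp ?pq //= /comp_wall /bd_wall ltnNge (ltnW nj) /= gtn_eqF.
- by rewrite /= end_comp ?pq //=; have [_ _ _ ->] := gP c.
- by rewrite /= wall_comp ?pq //= /comp_wall /bd_wall ltnNge (ltnW nj) /= gtn_eqF.
Qed.

(** The walls are exchanged. *)
Lemma cyl_inv_eq (p : cylinder) : cyl_bd false n.+1 p = p ->
  exists2 q : cyl_cat, cyl_bd false n.+1 q = q & inverses (A := cyl_cat) n p q.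
Proof.
move=> pj.
have gj c : bd false n.+1 (cyl_end p c) = cyl_end p c.
  exact: (f_equal (fun r => cyl_end r c) pj).
have [g0 g0c g0P] := inv (gj false); have [g1 g1c g1P] := inv (gj true).
pose g (c : bool) := if c then g1 else g0.
have gc c : bd false n.+1 (g c) = g c by case: c.
have gP c : inverses n (cyl_end p c) (g c) by case: c.
have gb b c : bd b n (g c) = bd (~~ b) n (cyl_end p c).
  by have [e1 e2 _ _] := gP c; case: b.
pose w c := cyl_wall p (~~ c).
have k0 c : bd false n.+1 (w c) = w c by apply: wall_cell.
have k1 b c : bd b n (w c) = bd c n (g b) by rewrite gb wall_bd.
have k2 : comp n (w true) (g false) = comp n (g true) (w false).
  have [a1 b1 c1 d1] := g0P; have [a2 b2 c2 d2] := g1P.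
  have x1 := wall_bd p false true; have x2 := esym (wall_bd p true false).
  have x3 := k1 false true; have x4 := esym (k1 true false).
  rewrite /w /= in x3 x4 *.
  have s1 : comp n g1 (comp n (cyl_end p true) (cyl_wall p false)) = cyl_wall p false.
    by rewrite -comp_assoc // d2 -(wall_bd p true false) comp_tgt.
  have s2 : comp n (comp n (cyl_wall p true) (cyl_end p false)) g0 = cyl_wall p true.
    by rewrite comp_assoc // c1 -(wall_bd p false true) comp_src.
  by rewrite -s2 -{1}s1 -wall_nat comp_assoc // bd_comp_eq.
pose q := Cylinder k0 k1 k2.
have pq b : cyl_bd b n p = cyl_bd (~~ b) n q.
  apply: cyl_ext => c /=; first by rewrite gb negbK.
  by rewrite /bd_wall ltnn eqxx /w negbK.
have qp b : cyl_bd b n q = cyl_bd (~~ b) n p by rewrite pq negbK.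
exists q.
  by apply: cyl_ext => c //=; rewrite /bd_wall ltnNge leqnSn /= gtn_eqF.
split; [exact: (pq false) | exact: (qp false) | |]; apply: cyl_ext => c.
- by rewrite /= end_comp ?pq //=; have [_ _ ->] := gP c.
- by rewrite /= wall_comp ?pq //= /comp_wall /bd_wall ltnn eqxx /w; case: c.
- by rewrite /= end_comp ?pq //=; have [_ _ _ ->] := gP c.
- by rewrite /= wall_comp ?pq //= /comp_wall /bd_wall ltnn eqxx /w; case: c.
Qed.

(** The walls coincide, and are cells of dimension up to [j.+2]: this is where
    horizontal inverses are needed. The ends are the boundaries of the wall. *)
Lemma cyl_inv_lt j (p : cylinder) : j < n -> cyl_bd false j.+1 p = p ->
  exists2 q : cyl_cat, cyl_bd false j.+1 q = q & inverses (A := cyl_cat) j p q.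
Proof.
move=> jn pj; have {}pj i : j < i -> cyl_bd false i p = p by move=> ji; rewrite -pj cyl_bd_ge.
have wE c : cyl_wall p c = cyl_wall p false.
  by have := f_equal (fun r => cyl_wall r c) (pj _ jn); rewrite /= /bd_wall ltnn eqxx.
have [v [vn vj [a b c d]]] : exists v, [/\ bd false n.+1 v = v,
    j.+1 < n -> bd false j.+1 v = v & inverses j (cyl_wall p false) v].
  move: (jn); rewrite leq_eqVlt => /orP[/eqP e|j1n].
    have [|v v2 vP] := @inverse_S A j (cyl_wall p false) inv; first by rewrite e wall_cell.
    by exists v; split; rewrite -?e // ltnn.
  have [|v v1 vP] := @inv j (cyl_wall p false).
    by have := f_equal (fun r => cyl_wall r false) (pj _ (ltnSn j)); rewrite /= /bd_wall j1n.
  by exists v; split=> //; apply: (bd_cell _ v1); apply: ltnW (ltnW _).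
have gE e : cyl_end p e = bd e n (cyl_wall p false).
  by rewrite wall_bd; apply/esym; exact: (f_equal (fun r => cyl_end r e) (pj _ jn)).
have k0 (f : bool) : bd false n.+1 v = v by [].
have k1 e f : bd e n v = bd f n (bd e n v) by rewrite bd_ge.
have k2 : comp n v (bd false n v) = comp n (bd true n v) v by rewrite comp_src comp_tgt.
pose q := @Cylinder (fun e => bd e n v) (fun=> v) k0 k1 k2.
have pq e : cyl_bd e j p = cyl_bd (~~ e) j q.
  apply: cyl_ext => f /=; first by rewrite gE !bd_lt //; case: (e).
  by rewrite /bd_wall jn wE; case: (e).
have qp e : cyl_bd e j q = cyl_bd (~~ e) j p by rewrite pq negbK.
exists q.
  apply: cyl_ext => f /=.
    move: (jn); rewrite leq_eqVlt => /orP[/eqP ->|j1n]; first by rewrite bd_ge.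
    by rewrite bd_lt // (bd_cell f (vj j1n)) ?vj // ltnW.
  rewrite /bd_wall; case: ltngtP => // j1n; exact: vj.
split; [exact: (pq false) | exact: (qp false) | |]; apply: cyl_ext => f.
- by rewrite /= end_comp ?pq //= gE -bd_comp_gt // c bd_ge ?bd_lt // ltnW.
- by rewrite /= wall_comp ?pq //= /comp_wall /bd_wall jn wE c.
- by rewrite /= end_comp ?pq //= gE -bd_comp_gt // d bd_ge ?bd_lt // ltnW.
- by rewrite /= wall_comp ?pq //= /comp_wall /bd_wall jn wE d.
Qed.

Lemma cyl_has_inverses : has_inverses cyl_cat.
Proof.
move=> j p pj; case: (ltngtP j n) => jn; first exact: cyl_inv_lt.
  exact: cyl_inv_gt.
by subst j; apply: cyl_inv_eq.
Qed.

Lemma cst_cell (x : A) c : bd false n.+1 (bd c n x) = bd c n x.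
Proof. by rewrite bd_ge. Qed.

Lemma cst_bd (x : A) b c : bd b n (bd c n x) = bd c n x.
Proof. by rewrite bd_ge. Qed.

Lemma cst_nat (x : A) : comp n (bd true n x) x = comp n x (bd false n x).
Proof. by rewrite comp_src comp_tgt. Qed.

(** The walls of a constant cylinder are identities, as [bd c n x] is an [n]-cell. *)
Definition cst (x : A) : cyl_cat :=
  @Cylinder (fun=> x) (fun c => bd c n x) (cst_cell x) (cst_bd x) (cst_nat x).

Lemma cst_bd_comm b j (x : A) : bd b j (cst x) = cst (bd b j x).
Proof.
apply: cyl_ext => c //=; rewrite /bd_wall; case: ltngtP => jn.
- by rewrite bd_lt // bd_ge // ltnW.
- by rewrite bd_lt.
- by subst j; rewrite bd_ge.
Qed.

Section Connection.
Variables (x : A).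
Hypothesis x1 : bd false n.+1 x = x.
Let g (c : bool) := if c then x else bd false n x.

Lemma conn_cell c : bd false n.+1 (g c) = g c.
Proof. by case: c; rewrite /= ?bd_ge. Qed.

Lemma conn_bd b c : bd b n (g c) = bd c n (g b).
Proof. by case: b; case: c; rewrite /= ?bd_ge. Qed.

Lemma conn_nat : comp n (g true) (g false) = comp n (g true) (g false).
Proof. by []. Qed.

(** A connection: this cylinder goes from the identity of the source of [x] to [x], and
    its source is constant. *)
Definition conn : cyl_cat := Cylinder conn_cell conn_bd conn_nat.

Lemma conn_is_cell : bd false n.+1 conn = conn.
Proof.
apply: cyl_ext => c /=; first exact: conn_cell.
by rewrite /bd_wall ltnNge leqnSn /= gtn_eqF.
Qed.

Lemma conn_src : bd false n conn = cst (bd false n x).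
Proof.
apply: cyl_ext => c /=; first by case: c; rewrite /= ?bd_ge.
by rewrite /bd_wall ltnn eqxx /= bd_ge.
Qed.

End Connection.
End Cylinder.

Lemma Lt_trans i j k : Lt i j -> Lt j k -> Lt i k.
Proof. by move=> /Lt_ltn ij /Lt_ltn jk; apply: ltn_Lt; apply: ltn_trans jk. Qed.

(** * The cells of a strict oo-category in a single set *)

Definition gbd (X : gset) (b : bool) i : X i.+1 -> X i :=
  if b then @gtgt X i else @gsrc X i.
Arguments gbd {X} b {i}.

Section Boundaries.
Variable X : strict_cat.

Definition ibd (b : bool) j i (p : Lt j i) : X i -> X j :=
  if b then itgt p else isrc p.


Definition iid j i (p : Lt j i) : X j -> X i := iter_up (@sid X) p.

Lemma ibdS b c j i (p : Lt j i) (x : X i.+1) :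
  ibd b (LtS p) x = ibd b p (gbd c x).
Proof.
case: b; case: c => //; rewrite /gbd /ibd.
  exact: itgt_tgt.
exact: isrc_src.
Qed.

Lemma ibd_ibd b c k j i (r : Lt k j) (p : Lt j i) (q : Lt k i) (x : X i) :
  ibd b r (ibd c p x) = ibd b q x.
Proof.
elim: p q x => [|i0 p IH] q x.
  rewrite (Lt_irr q (LtS r)) (ibdS b c).
  by rewrite /ibd /gbd; case: (c); case: (b).
rewrite (Lt_irr q (LtS (Lt_trans r p))) (ibdS c c p) (ibdS b c).
exact: IH.
Qed.

Lemma gbd_sid b i (x : X i) : gbd b (sid x) = x.
Proof. by case: b; [apply: sid_tgt | apply: sid_src]. Qed.

Lemma ibd_iid b j i (p q : Lt j i) (x : X j) : ibd b p (iid q x) = x.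
Proof.
rewrite (Lt_irr q p); elim: p => [|i0 p IH]; first exact: gbd_sid.
by rewrite (ibdS b b) [gbd _ _]gbd_sid.
Qed.

Lemma ibd_iid_lt b k j i (r : Lt k j) (p : Lt k i) (q : Lt j i) (x : X j) :
  ibd b p (iid q x) = ibd b r x.
Proof. by rewrite -(ibd_ibd b true r q) ibd_iid. Qed.

Lemma iid_iid k j i (r : Lt k j) (q : Lt j i) (p : Lt k i) (x : X k) :
  iid q (iid r x) = iid p x.
Proof.
elim: q p => [|i0 q IH] p; first by rewrite (Lt_irr p (LtS r)).
rewrite (Lt_irr p (LtS (Lt_trans r q))) /=; congr sid; exact: IH.
Qed.

Lemma ibd_iid_gt b k j i (r : Lt j k) (p : Lt k i) (q : Lt j i) (x : X j) :
  ibd b p (iid q x) = iid r x.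
Proof. by rewrite -(iid_iid r p q) ibd_iid. Qed.

(** The junk value [v] makes the source of [tcomp] the [tcomp] of the sources without a
    hypothesis of composability, see [sseq_comp_src0]. *)
Definition tcomp j i (p : Lt j i) (u v : X i) : X i :=
  match excluded_middle_informative (isrc p u = itgt p v) with
  | left e => scomp p u v e
  | right _ => v
  end.

Lemma tcompE j i (p : Lt j i) (u v : X i) (e : isrc p u = itgt p v) :
  tcomp p u v = scomp p u v e.
Proof.
rewrite /tcomp; case: excluded_middle_informative => // e'; exact: scomp_eq.
Qed.

Lemma gbd_tcomp1 b i (u v : X i.+1) : isrc Lt1 u = itgt Lt1 v ->
  gbd b (tcomp Lt1 u v) = gbd b (if b then u else v).
Proof.
by move=> e; rewrite tcompE; case: b; [apply: scomp_tgt1 | apply: scomp_src1].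
Qed.

Lemma gbd_tcompS b j i (p : Lt j i) (u v : X i.+1) :
  isrc (LtS p) u = itgt (LtS p) v ->
  gbd b (tcomp (LtS p) u v) = tcomp p (gbd b u) (gbd b v).
Proof.
move=> e; rewrite (tcompE e).
have e' : isrc p (gbd b u) = itgt p (gbd b v).
  by rewrite -[LHS](ibdS false) -[RHS](ibdS true).
rewrite (tcompE e'); case: b e' => e'; [exact: scomp_tgtS | exact: scomp_srcS].
Qed.

Lemma ibd_tcomp_eq b j i (p : Lt j i) (u v : X i) : isrc p u = itgt p v ->
  ibd b p (tcomp p u v) = ibd b p (if b then u else v).
Proof.
elim: p u v => [|i0 p IH] u v e; first exact: gbd_tcomp1.
rewrite (ibdS b b) gbd_tcompS // IH.
  by rewrite [RHS](ibdS b b); case: (b).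
by rewrite -[LHS](ibdS false) -[RHS](ibdS true).
Qed.

Lemma ibd_tcomp_gt b k j i (r : Lt j k) (p : Lt j i) (q : Lt k i) (u v : X i) :
  isrc p u = itgt p v ->
  ibd b q (tcomp p u v) = tcomp r (ibd b q u) (ibd b q v).
Proof.
elim: q p u v => [|i0 q IH] p u v.
  by rewrite (Lt_irr p (LtS r)) => e; apply: gbd_tcompS.
rewrite (Lt_irr p (LtS (Lt_trans r q))) => e.
rewrite (ibdS b b) gbd_tcompS // IH -?(ibdS b b) //.
by rewrite -[LHS](ibdS false) -[RHS](ibdS true).
Qed.

Lemma iid_tcomp k j i (r : Lt j k) (p : Lt j i) (q : Lt k i) (u v : X k) :
  isrc r u = itgt r v -> iid q (tcomp r u v) = tcomp p (iid q u) (iid q v).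
Proof.
move=> e; elim: q p => [|i0 q IH] p.
  rewrite (Lt_irr p (LtS r)) /iid /= (tcompE e).
  have e' : isrc (LtS r) (sid u) = itgt (LtS r) (sid v).
    by rewrite [LHS](ibdS false false) [RHS](ibdS true true) !gbd_sid.
  by rewrite (tcompE e'); apply: sid_comp.
rewrite (Lt_irr p (LtS (Lt_trans r q))) /iid /= -/(iid q _) (IH (Lt_trans r q)).
have e1 : isrc (Lt_trans r q) (iid q u) = itgt (Lt_trans r q) (iid q v).
  by rewrite [LHS](ibd_iid_lt false r) [RHS](ibd_iid_lt true r).
have e' : isrc (LtS (Lt_trans r q)) (sid (iid q u)) =
    itgt (LtS (Lt_trans r q)) (sid (iid q v)).
  by rewrite [LHS](ibdS false false) [RHS](ibdS true true) !gbd_sid.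
by rewrite (tcompE e') (tcompE e1); apply: sid_comp.
Qed.

End Boundaries.

Section OfGroupoid.
Variable X : strict_cat.

(** Identifying a cell with its identities, an [m]-cell is recorded by its iterated
    sources in dimension less than [m], itself, and its iterated identities above. Such
    sequences are determined by a compatibility condition, without a quotient; those that
    do not become identities are cells of infinite dimension, which is harmless. *)
Record sseq := SSeq {
  sseq_at :> forall m, X m;
  sseq_at_src : forall m, gsrc (sseq_at m.+1) = sseq_at m }.

Lemma isrc_sseq (x : sseq) j i (p : Lt j i) : isrc p (x i) = x j.
Proof.
elim: p => [|k p IH]; first exact: sseq_at_src.
by rewrite -[LHS]/(isrc p (gsrc (x k.+1))) sseq_at_src.
Qed.

(** Earlier components are iterated sources of later ones, so an identity between cells
    may be checked in dimensions above all those involved, where the formulas for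
    boundaries and composites are uniform. *)
Lemma sseq_ext N (x y : sseq) : (forall m, N < m -> x m = y m) -> x = y.
Proof.
move=> e; have e' m : x m = y m.
  have [mN|/e//] := leqP m N.
  by rewrite -(isrc_sseq x (ltn_Lt (leq_ltn_trans mN (ltnSn N)))) e // isrc_sseq.
clear e; case: x y e' => [x xs] [y ys] /= e.
have {}e := functional_extensionality_dep x y e; subst y.
by congr SSeq; apply: proof_irrelevance.
Qed.

(** A sequence given above dimension [N] only is completed by iterated sources. *)
Section Extend.
Variables (N : nat) (y : forall m, Lt N m -> X m).
Hypothesis ys : forall m (p : Lt N m), gsrc (y (LtS p)) = y p.

Definition extend_fun m : X m :=
  match ltnP N m with
  | LtnNotGeq p => y (ltn_Lt p)
  | GeqNotLtn p => isrc (ltn_Lt (p : m < N.+1)) (y Lt1)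
  end.

Lemma extend_gt m (p : Lt N m) : extend_fun m = y p.
Proof.
rewrite /extend_fun; case: ltnP => Nm; first by congr y; apply: Lt_irr.
by exfalso; have := Lt_ltn p; rewrite ltnNge Nm.
Qed.

Lemma extend_src m : gsrc (extend_fun m.+1) = extend_fun m.
Proof.
have [/ltn_Lt p|] := ltnP N m; first by rewrite !(extend_gt p, extend_gt (LtS p)).
rewrite leq_eqVlt => /orP[/eqP e|mN].
  subst m; rewrite (extend_gt Lt1) /extend_fun; case: ltnP => p.
    by exfalso; rewrite ltnn in p.
  by rewrite (Lt_irr (ltn_Lt _) Lt1).
rewrite /extend_fun; case: ltnP => p; first by exfalso; rewrite ltnNge mN in p.
case: ltnP => q; first by exfalso; rewrite ltnNge (ltnW mN) in q.
exact: gsrc_isrc.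
Qed.

Definition extend : sseq := SSeq extend_src.

End Extend.

Lemma ibd_sseqS b (x : sseq) j i (p : Lt j i) :
  ibd b (LtS p) (x i.+1) = ibd b p (x i).
Proof. by rewrite (ibdS b false) [gbd _ _](sseq_at_src x). Qed.

Lemma sseq_bd_src b j (x : sseq) m (p : Lt j m) :
  gsrc (iid (LtS p) (ibd b (LtS p) (x m.+1))) = iid p (ibd b p (x m)).
Proof. by rewrite ibd_sseqS; apply: sid_src. Qed.

Definition sseq_bd b j (x : sseq) : sseq := extend (@sseq_bd_src b j x).

Lemma sseq_comp_src0 j (x y : sseq) m (p : Lt j m) :
  gsrc (tcomp (LtS p) (x m.+1) (y m.+1)) = tcomp p (x m) (y m).
Proof.
have [e|ne] := excluded_middle_informative (isrc p (x m) = itgt p (y m)).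
  rewrite [LHS](@gbd_tcompS X false) /= ?sseq_at_src //.
  by rewrite [LHS](ibd_sseqS false) [RHS](ibd_sseqS true).
rewrite /tcomp; case: excluded_middle_informative => [e|_].
  by case: ne; rewrite -[LHS](ibd_sseqS false) -[RHS](ibd_sseqS true).
by case: excluded_middle_informative => // _; apply: sseq_at_src.
Qed.

Definition sseq_comp j (x y : sseq) : sseq := extend (@sseq_comp_src0 j x y).

Lemma sseq_bdE b j (x : sseq) m (p : Lt j m) : sseq_bd b j x m = iid p (ibd b p (x m)).
Proof. exact: extend_gt. Qed.

Lemma sseq_compE j (x y : sseq) m (p : Lt j m) : sseq_comp j x y m = tcomp p (x m) (y m).
Proof. exact: extend_gt. Qed.

Lemma sseq_composable j (x y : sseq) : sseq_bd false j x = sseq_bd true j y ->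
  forall m (p : Lt j m), isrc p (x m) = itgt p (y m).
Proof.
move=> e m p; have := f_equal (fun z : sseq => ibd false p (z m)) e.
by rewrite !(sseq_bdE _ _ p) !ibd_iid.
Qed.

Lemma sseq_bd_lt b c i j (x : sseq) : i < j -> sseq_bd b i (sseq_bd c j x) = sseq_bd b i x.
Proof.
move=> /ltn_Lt r; apply: (@sseq_ext j) => m /ltn_Lt q.
rewrite !(sseq_bdE _ _ (Lt_trans r q), sseq_bdE _ _ q).
by rewrite (ibd_iid_lt _ r) (ibd_ibd _ _ _ _ (Lt_trans r q)).
Qed.

Lemma sseq_bd_ge b c i j (x : sseq) : j <= i -> sseq_bd b i (sseq_bd c j x) = sseq_bd c j x.
Proof.
move=> ji; apply: (@sseq_ext i) => m im.
have p := ltn_Lt im; have q := ltn_Lt (leq_ltn_trans ji im).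
rewrite !(sseq_bdE _ _ p, sseq_bdE _ _ q); move: ji; rewrite leq_eqVlt.
case/orP => [/eqP e|/ltn_Lt r].
  by subst j; rewrite (Lt_irr p q) ibd_iid.
by rewrite (ibd_iid_gt _ r) (iid_iid _ _ q).
Qed.

Lemma sseq_bd_comp_eq b j (x y : sseq) : sseq_bd false j x = sseq_bd true j y ->
  sseq_bd b j (sseq_comp j x y) = sseq_bd b j (if b then x else y).
Proof.
move=> /sseq_composable xy; apply: (@sseq_ext j) => m /ltn_Lt p.
by rewrite !(sseq_bdE _ _ p) (sseq_compE _ _ p) ibd_tcomp_eq //; case: (b).
Qed.

Lemma sseq_bd_comp_gt b i j (x y : sseq) : j < i -> sseq_bd false j x = sseq_bd true j y ->
  sseq_bd b i (sseq_comp j x y) = sseq_comp j (sseq_bd b i x) (sseq_bd b i y).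
Proof.
move=> /ltn_Lt r /sseq_composable xy; apply: (@sseq_ext i) => m /ltn_Lt q.
have p := Lt_trans r q.
rewrite (sseq_bdE _ _ q) !(sseq_compE _ _ p) (ibd_tcomp_gt _ r) // !(sseq_bdE _ _ q).
rewrite -(iid_tcomp (r := r) p) //.
rewrite [LHS](ibd_ibd false b r q p) [RHS](ibd_ibd true b r q p); exact: xy.
Qed.

Lemma sseq_comp_src j (x : sseq) : sseq_comp j x (sseq_bd false j x) = x.
Proof.
apply: (@sseq_ext j) => m /ltn_Lt p; rewrite (sseq_compE _ _ p) (sseq_bdE _ _ p).
have e : isrc p (x m) = itgt p (iid p (isrc p (x m))).
  by rewrite [RHS](ibd_iid true).
by rewrite (tcompE e) scompu1.
Qed.

Lemma sseq_comp_tgt j (x : sseq) : sseq_comp j (sseq_bd true j x) x = x.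
Proof.
apply: (@sseq_ext j) => m /ltn_Lt p; rewrite (sseq_compE _ _ p) (sseq_bdE _ _ p).
have e : isrc p (iid p (itgt p (x m))) = itgt p (x m).
  by rewrite [LHS](ibd_iid false).
by rewrite (tcompE e) scomp1u.
Qed.

Lemma sseq_comp_assoc j (x y z : sseq) : sseq_bd false j x = sseq_bd true j y ->
  sseq_bd false j y = sseq_bd true j z -> sseq_comp j (sseq_comp j x y) z =
  sseq_comp j x (sseq_comp j y z).
Proof.
move=> /sseq_composable xy /sseq_composable yz.
apply: (@sseq_ext j) => m /ltn_Lt p; rewrite !(sseq_compE _ _ p).
rewrite (tcompE (xy _ p)) (tcompE (yz _ p)).
have e1 : isrc p (scomp p _ _ (xy _ p)) = itgt p (z m).
  rewrite -tcompE [LHS](ibd_tcomp_eq false) //; exact: yz.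
have e2 : isrc p (x m) = itgt p (scomp p _ _ (yz _ p)).
  rewrite -tcompE [RHS](ibd_tcomp_eq true) //; exact: xy.
by rewrite (tcompE e1) (tcompE e2); apply: scompA.
Qed.

Lemma sseq_exchange i j (a b c d : sseq) : i < j ->
  sseq_bd false j a = sseq_bd true j b -> sseq_bd false j c = sseq_bd true j d ->
  sseq_bd false i a = sseq_bd true i c -> sseq_bd false i b = sseq_bd true i d ->
  sseq_comp i (sseq_comp j a b) (sseq_comp j c d) =
  sseq_comp j (sseq_comp i a c) (sseq_comp i b d).
Proof.
move=> /ltn_Lt r /sseq_composable ab /sseq_composable cd /sseq_composable ac.
move=> /sseq_composable bdd.
apply: (@sseq_ext j) => m /ltn_Lt p; have q := Lt_trans r p.
rewrite !(sseq_compE _ _ p, sseq_compE _ _ q).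
have e1 : isrc q (tcomp p (a m) (b m)) = itgt q (tcomp p (c m) (d m)).
  rewrite -[LHS](ibd_ibd false true r p) -[RHS](ibd_ibd true true r p).
  rewrite !ibd_tcomp_eq // [LHS](ibd_ibd false true r p q).
  by rewrite [RHS](ibd_ibd true true r p q); apply: ac.
have e2 : isrc p (tcomp q (a m) (c m)) = itgt p (tcomp q (b m) (d m)).
  rewrite [LHS](ibd_tcomp_gt false r) // [RHS](ibd_tcomp_gt true r) //.
  by rewrite /ibd ab cd.
rewrite (tcompE e1) (tcompE e2).
have f1 := tcompE (ab m p); have f2 := tcompE (cd m p).
have f3 := tcompE (ac m q); have f4 := tcompE (bdd m q).
move: e1 e2; rewrite f1 f2 f3 f4 => e1 e2; exact: sexchange.
Qed.

Definition sseq_cat : omega_cat :=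
  OmegaCat sseq_bd_lt sseq_bd_ge sseq_bd_comp_eq sseq_bd_comp_gt
    sseq_comp_src sseq_comp_tgt sseq_comp_assoc sseq_exchange.

Definition emb_fun m (u : X m) : sseq :=
  @extend m (fun k p => iid p u) (fun k p => sid_src _).

Definition emb m (u : X m) : sseq_cat := emb_fun u.

Lemma embE m (u : X m) k (p : Lt m k) : (emb u : sseq) k = iid p u.
Proof. exact: extend_gt. Qed.

Lemma emb_at m (u : X m) : (emb u : sseq) m = u.
Proof. by rewrite -sseq_at_src (embE _ Lt1) [LHS]sid_src. Qed.

Lemma emb_bd b m (u : X m.+1) : emb (gbd b u) = bd b m (emb u).
Proof.
apply: (@sseq_ext m.+1) => k /ltn_Lt p; have q := Lt_trans (@Lt1 m) p.
by rewrite (embE _ q) [RHS](sseq_bdE _ _ q) (embE _ p) (ibd_iid_lt _ Lt1 q p).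
Qed.

Lemma emb_cell m (u : X m) : bd false m (emb u) = emb u.
Proof.
apply: (@sseq_ext m) => k /ltn_Lt p.
by rewrite [LHS](sseq_bdE _ _ p) (embE _ p) ibd_iid.
Qed.

Lemma emb_id m (u : X m) : emb (sid u) = emb u.
Proof.
apply: (@sseq_ext m.+1) => k /ltn_Lt p; have q := Lt_trans (@Lt1 m) p.
by rewrite (embE _ q) (embE _ p) -(iid_iid Lt1 p q).
Qed.

Lemma emb_comp j i (p : Lt j i) (u v : X i) (e : isrc p u = itgt p v) :
  emb (scomp p u v e) = comp j (emb u) (emb v).
Proof.
apply: (@sseq_ext i) => k /ltn_Lt q; have r := Lt_trans p q.
rewrite [RHS](sseq_compE _ _ r) !(embE _ q) -(tcompE e); exact: iid_tcomp.
Qed.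

Lemma emb_sseq m (x : sseq_cat) : bd false m x = x -> emb ((x : sseq) m) = x.
Proof.
move=> e; apply: (@sseq_ext m) => k /ltn_Lt p.
rewrite (embE _ p) -{2}e [RHS](sseq_bdE _ _ p); congr iid.
exact: esym (isrc_sseq x p).
Qed.

End OfGroupoid.

(** * Elementary expansions preserve contractibility *)

Definition parallel (X : gset) n : X n -> X n -> Prop :=
  match n with
  | 0 => fun _ _ => True
  | n.+1 => fun u v => gsrc u = gsrc v /\ gtgt u = gtgt v
  end.

Definition weakly_contractible (X : gset) : Prop :=
  forall n (u v : X n), parallel u v ->
    exists h : X n.+1, gsrc h = u /\ gtgt h = v.

Lemma gmap_parallel (X Y : gset) (f : gmap X Y) n (u v : X n) :
  parallel u v -> parallel (f n u) (f n v).
Proof. by case: n u v => //= n u v [s t]; rewrite -!gfun_src -!gfun_tgt s t. Qed.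

Section Endpoints.
Variable X : strict_gpd.

Lemma sseq_has_inverses : has_inverses (sseq_cat X).
Proof.
move=> j x /emb_sseq <-; set u := sseq_at x j.+1.
have [v [uv [vu [uvE vuE]]]] := sg_inv u.
exists (emb v); first exact: emb_cell.
split.
- by rewrite -(emb_bd false) -(emb_bd true); congr emb.
- by rewrite -(emb_bd false) -(emb_bd true); congr emb.
- by rewrite -(emb_comp uv) uvE emb_id -(emb_bd true).
- by rewrite -(emb_comp vu) vuE emb_id -(emb_bd false).
Qed.

Variable n : nat.

Definition cyl_gpd : strict_gpd := cell_gpd (@cyl_has_inverses _ n sseq_has_inverses).

Definition endpoint_fun (e : bool) m (p : cyl_gpd m) : X m :=
  sseq_at (cyl_end (proj1_sig p) e) m.

Lemma bd_at b m (x : sseq_cat X) : sseq_at (bd b m x) m = gbd b (sseq_at x m.+1).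
Proof.
by rewrite -(sseq_at_src (bd b m x))
  [bd b m x](erefl (sseq_bd b m x)) (sseq_bdE _ _ Lt1) [LHS]sid_src.
Qed.

Lemma endpoint_src e m (p : cyl_gpd m.+1) :
  endpoint_fun e (gsrc p) = gsrc (endpoint_fun e p).
Proof. exact: (bd_at false). Qed.

Lemma endpoint_tgt e m (p : cyl_gpd m.+1) :
  endpoint_fun e (gtgt p) = gtgt (endpoint_fun e p).
Proof. exact: (bd_at true). Qed.

Definition endpoint_gmap e : gmap cyl_gpd X :=
  GMap (@endpoint_src e) (@endpoint_tgt e).

Lemma endpoint_comp e j i (p : Lt j i) (u v : cyl_gpd i) (c : isrc p u = itgt p v)
    (c' : isrc p (endpoint_gmap e i u) = itgt p (endpoint_gmap e i v)) :
  endpoint_gmap e i (scomp p u v c) =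
  scomp p (endpoint_gmap e i u) (endpoint_gmap e i v) c'.
Proof.
have uv := ocell_composable c.
rewrite /= /endpoint_fun /= end_comp //.
by rewrite [LHS](sseq_compE _ _ p) -tcompE.
Qed.

Lemma endpoint_id e i (u : cyl_gpd i) :
  endpoint_gmap e i.+1 (sid u) = sid (endpoint_gmap e i u).
Proof.
rewrite /= /endpoint_fun /=; set x := cyl_end _ e.
have xi : bd false i x = x by exact: (f_equal (fun r => cyl_end r e) (proj2_sig u)).
by rewrite -{1}(emb_sseq xi) (embE _ Lt1).
Qed.

Definition endpoint e : gpd_map cyl_gpd X :=
  @GpdMap cyl_gpd X (endpoint_gmap e) (@endpoint_comp e) (@endpoint_id e).

End Endpoints.

Lemma parallel_bd (A : omega_cat) m (u v : cell_gset A m) b j :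
  parallel u v -> j < m -> bd b j (proj1_sig u) = bd b j (proj1_sig v).
Proof.
case: m u v => // m u v [s t]; rewrite ltnS leq_eqVlt => /orP[/eqP ->|Jmor].
  have v1 := f_equal (fun w : cell_gset A m => proj1_sig w).
  by case: b; [exact: (v1 _ _ t) | exact: (v1 _ _ s)].
rewrite -(bd_lt b false (proj1_sig u) Jmor) -(bd_lt b false (proj1_sig v) Jmor).
by congr (bd b j _); exact: (f_equal (fun w : cell_gset A m => proj1_sig w) s).
Qed.

(** G' is the pushout of [gdisk_sig n] along [yo x], stated by its universal property;
    [a] is the attached (n+1)-cell. *)
Definition is_expansion (G G' : gset) (i : gmap G G') n (x : G n) (a : G' n.+1) :
    Prop :=
  gsrc a = i n x /\
  forall (H : gset) (f : gmap G H) (b : H n.+1), gsrc b = f n x ->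
    exists! f' : gmap G' H, gmap_comp f' i = f /\ f' n.+1 a = b.

Section Expansion.
Variables (G G' : gset) (i : gmap G G') (n : nat) (x : G n) (a : G' n.+1).
Hypothesis exp : is_expansion i x a.

Lemma expansion_ext (H : gset) (f g : gmap G' H) :
  gmap_comp f i = gmap_comp g i -> f n.+1 a = g n.+1 a -> f = g.
Proof.
move=> fg fga; have [ai u] := exp.
have [|k [_ ku]] := u H (gmap_comp g i) (g n.+1 a).
  by rewrite -gfun_src ai.
by rewrite -(ku f) // -(ku g).
Qed.

Let X := free_gpd G'.
Let A := sseq_cat X.

Lemma expansion_retraction : exists r : gpd_map X (free_gpd G),
  gmap_comp (gmap_comp r (free_unit G')) i = free_unit G /\
  r n.+1 (free_unit G' n.+1 a) = sid (free_unit G n x).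
Proof.
have [ai u] := exp.
have [|k [[ki ka] _]] := u _ (free_unit G) (sid (free_unit G n x)).
  by rewrite sid_src.
exists (free_ext k); rewrite free_extK; split=> //.
by rewrite -ka -{2}(free_extK k).
Qed.

Definition cst_cell_fun m (y : G m) : cyl_gpd X n m :=
  exist (fun p : cyl_cat A n => bd false m p = p)
    (cst n (emb (free_unit G' m (i m y)) : A))
    (etrans (cst_bd_comm _ _ _ _) (f_equal (@cst A n) (emb_cell _))).

Lemma cst_cell_bd b m (y : G m.+1) :
  cst_cell_fun (gbd b y) = gbd b (cst_cell_fun y).
Proof.
apply: ocell_inj; case: b.
  by rewrite [RHS](cst_bd_comm n true) -(emb_bd true) /gbd -!gfun_tgt.
by rewrite [RHS](cst_bd_comm n false) -(emb_bd false) /gbd -!gfun_src.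
Qed.

Definition cst_gmap : gmap G (cyl_gpd X n) :=
  @GMap G (cyl_gpd X n) cst_cell_fun (@cst_cell_bd false) (@cst_cell_bd true).

(** The cylinder-valued map is constant on [G] and takes [a] to [conn a]. Its ends are
    morphisms out of a free oo-groupoid that agree on generators with the identity and
    with the retraction followed by the inclusion. *)
Lemma expansion_homotopy : exists P : gpd_map X (cyl_gpd X n),
  (forall m (z : X m), endpoint X n true m (P m z) = z) /\
  (forall r : gpd_map X (free_gpd G),
    gmap_comp (gmap_comp r (free_unit G')) i = free_unit G ->
    r n.+1 (free_unit G' n.+1 a) = sid (free_unit G n x) ->
    forall m (z : X m), endpoint X n false m (P m z) = free_map i m (r m z)).
Proof.
have [ai u] := exp.
set ua := free_unit G' n.+1 a.
pose b : cyl_gpd X n n.+1 :=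
  exist (fun p : cyl_cat A n => bd false n.+1 p = p) (conn (emb_cell ua))
    (conn_is_cell (emb_cell ua)).
have bs : gsrc b = cst_gmap n x.
  apply: ocell_inj; rewrite [LHS]conn_src -(emb_bd false) /gbd.
  have e : gsrc ua = free_unit G' n (i n x) by rewrite -ai gfun_src.
  rewrite [X in cst n (emb X)]e. exact: erefl.
have [k [[ki ka] _]] := u _ cst_gmap b bs.
exists (free_ext k); split=> [m z|r ri ra m z].
- suff e : gpd_map_comp (endpoint X n true) (free_ext k) = gpd_map_id X.
    exact: (f_equal (fun f : gpd_map X X => f m z) e).
  apply: free_gpd_ext; apply: expansion_ext.
    apply: eq_gmap => d y.
    have e : free_ext k d (free_unit G' d (i d y)) = cst_gmap d y.
      by rewrite -ki -{2}(free_extK k).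
    rewrite /= [fval _ _]e; exact: (emb_at (free_unit G' d (i d y))).
  have e : free_ext k n.+1 ua = b by rewrite -ka -{2}(free_extK k).
  rewrite /= [fval _ _]e; exact: (emb_at ua).
- suff e : gpd_map_comp (endpoint X n false) (free_ext k) = gpd_map_comp (free_map i) r.
    exact: (f_equal (fun f : gpd_map X X => f m z) e).
  apply: free_gpd_ext; apply: expansion_ext.
    apply: eq_gmap => d y.
    have e : free_ext k d (free_unit G' d (i d y)) = cst_gmap d y.
      by rewrite -ki -{2}(free_extK k).
    have e' : r d (free_unit G' d (i d y)) = free_unit G d y by rewrite -ri.
    rewrite /= [fval k _]e [r _ _]e' [LHS](emb_at (free_unit G' d (i d y))).
    exact: (f_equal (fun f : gmap G X => f d y) (esym (free_map_unit i))).
  have e : free_ext k n.+1 ua = b by rewrite -ka -{2}(free_extK k).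
  rewrite /= [fval k _]e [r _ _]ra [RHS](gpd_id (free_map i)).
  have e' : free_map i n (free_unit G n x) = gsrc ua.
    rewrite -[LHS]/(gmap_comp (free_map i) (free_unit G) n x) free_map_unit.
    by rewrite /= -ai [LHS](gfun_src (free_unit G')).
  rewrite e' -[LHS]/(sseq_at (bd false n (emb ua)) n.+1) -(emb_bd false).
  exact: (@embE X n (gsrc ua) n.+1 Lt1).
Qed.


(** Below dimension [n] the homotopy is the identity, so a filler in [L(G)] is included
    in [X] as it stands. In dimension [n] and above, a filler [k] in [L(G)] of the images
    of [f] and [g] gives [w1 k w0^-1], where [w1] is a wall at [g] and [w0] a wall at [f];
    above dimension [n] the walls at [f] and [g] are the same, and naturality shows that
    the boundary of this composite is [f] and [g]. *)
Theorem expansion_contractible :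
  weakly_contractible (free_gpd G) -> weakly_contractible X.
Proof.
move=> Gc m f g fg.
have [r [ri ra]] := expansion_retraction.
have [P [P1 P0]] := expansion_homotopy; have {}P0 := P0 r ri ra.
have [k0 [ks kt]] := Gc m (r m f) (r m g) (gmap_parallel r fg).
pose k : A := emb (free_map i m.+1 k0).
pose p (h : X m) : cyl_cat A n := proj1_sig (P m h).
have pc1 h : bd false m (p h) = p h by exact: (proj2_sig (P m h)).
have g_cell e h : bd false m (cyl_end (p h) e) = cyl_end (p h) e.
  exact: (f_equal (fun q => cyl_end q e) (pc1 h)).
have gT h : cyl_end (p h) true = emb h by rewrite -(emb_sseq (g_cell true h)) [sseq_at _ m]P1.
have gF h : cyl_end (p h) false = emb (free_map i m (r m h)).
  by rewrite -(emb_sseq (g_cell false h)) [sseq_at _ m]P0.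
have kc : bd false m.+1 k = k by apply: emb_cell.
have ks' : bd false m k = cyl_end (p f) false.
  by rewrite gF -ks -(emb_bd false); congr emb; apply/esym/(gfun_src (free_map i)).
have kt' : bd true m k = cyl_end (p g) false.
  by rewrite gF -kt -(emb_bd true); congr emb; apply/esym/(gfun_tgt (free_map i)).
suff [z [zc zs zt]] : exists z : A, [/\ bd false m.+1 z = z, bd false m z = emb f
    & bd true m z = emb g].
  exists (sseq_at z m.+1); split.
    by rewrite -(emb_at f) -zs bd_at.
  by rewrite -(emb_at g) -zt bd_at.
have [mn|nm] := ltnP m n.
  have gw h e c : cyl_end (p h) e = cyl_wall (p h) c.
    have wc : bd false m (cyl_wall (p h) c) = cyl_wall (p h) c.
      by have := f_equal (fun q => cyl_wall q c) (pc1 h); rewrite /= /bd_wall mn.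
    rewrite -(bd_cell c (g_cell e h) (ltnW mn)) -wall_bd.
    by rewrite (bd_cell _ wc) // ltnW.
  exists k; split; rewrite ?kc ?ks' ?kt' //.
    by rewrite (gw f false false) -(gw f true) gT.
  by rewrite (gw g false false) -(gw g true) gT.
have [v v1 [wv vw wvE vwE]] := sseq_has_inverses (wall_cell (p f) false).
(* The walls depend on the boundary in dimension [n] only. *)
have wE : n < m -> (forall c, cyl_wall (p g) c = cyl_wall (p f) c).
  move=> nm' c; have := parallel_bd c (gmap_parallel P fg) nm'.
  move=> /(f_equal (fun q => cyl_wall q c)) /=; rewrite /bd_wall ltnn eqxx; exact: esym.
have conj_h h : cyl_wall (p h) false = cyl_wall (p f) false ->
    comp n (cyl_wall (p h) true) (comp n (cyl_end (p h) false) v) = emb h.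
  move=> wh; have gv : composable n (cyl_end (p h) false) v.
    by rewrite -wv -wh wall_bd.
  rewrite -comp_assoc // ?wall_bd // wall_nat wh comp_assoc // -?wh ?wall_bd // wh wvE.
  by rewrite -wh wall_bd comp_src gT.
have kn b : bd b n k = bd b n (cyl_end (p (if b then g else f)) false).
  move: nm; rewrite leq_eqVlt => /orP[/eqP e|nm].
    by subst m; case: b; rewrite -(ks', kt') bd_ge.
  rewrite -(bd_lt b b _ nm).
  by case: b; rewrite -(ks', kt').
have kv : composable n k v by rewrite kn -wall_bd wv.
have wk : composable n (cyl_wall (p g) true) k by rewrite kn -wall_bd.
have wkv : composable n (cyl_wall (p g) true) (comp n k v) by rewrite bd_comp_eq.
have vE : bd false n v = bd false n (emb f) by rewrite vw wall_bd gT.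
exists (comp n (cyl_wall (p g) true) (comp n k v)); split.
- have nm1 : n < m.+1 by [].
  rewrite (bd_comp_gt _ nm1 wkv) (bd_comp_gt _ nm1 kv) kc (bd_cell _ v1) //.
  by rewrite (bd_cell _ (wall_cell _ _)).
- have [mn|nm'] := leqP m n.
    have e : m = n by apply/eqP; rewrite eqn_leq mn nm.
    have bdm b (z : A) : bd b m z = bd b n z by rewrite e.
    by rewrite bdm (bd_comp_eq _ wkv) (bd_comp_eq _ kv) vE -bdm emb_cell.
  rewrite (bd_comp_gt _ nm' wkv) (bd_comp_gt _ nm' kv) ks' (bd_cell _ v1) //.
  by rewrite (bd_cell _ (wall_cell _ _)) // (wE nm'); apply: conj_h.
- have [mn|nm'] := leqP m n.
    have e : m = n by apply/eqP; rewrite eqn_leq mn nm.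
    have bdm b (z : A) : bd b m z = bd b n z by rewrite e.
    by rewrite bdm (bd_comp_eq _ wkv) wall_bd gT -bdm (bd_cell _ (emb_cell g)).
  rewrite (bd_comp_gt _ nm' wkv) (bd_comp_gt _ nm' kv) kt' (bd_cell _ v1) //.
  by rewrite (bd_cell _ (wall_cell _ _)) //; apply/conj_h/wE.
Qed.

End Expansion.

(** * Free strict oo-groupoids on globular sums *)

Section Identities.
Variables (X : strict_cat) (i : nat) (y : X i).

Lemma sid_composable : isrc Lt1 (sid y) = itgt Lt1 (sid y).
Proof. by rewrite [LHS]sid_src [RHS]sid_tgt. Qed.

Lemma sid_idem (e : isrc Lt1 (sid y) = itgt Lt1 (sid y)) :
  scomp Lt1 (sid y) (sid y) e = sid y.
Proof.
have e' : isrc Lt1 (sid y) = itgt Lt1 (iter_up (@sid X) Lt1 (isrc Lt1 (sid y))).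
  by rewrite [RHS]sid_tgt.
rewrite -[RHS](scompu1 e'); apply: scomp_eq => //.
exact: (f_equal (@sid X i) (esym (sid_src y))).
Qed.

Lemma sid_inverse : is_inverse (sid y) (sid y).
Proof.
exists sid_composable, sid_composable.
by split; rewrite sid_idem ?sid_src ?sid_tgt.
Qed.

End Identities.

Section Dimension.
Variables (G : gset) (d : nat).
Hypothesis Gd : forall m, d < m -> G m -> False.

(** By induction on terms: no generator has dimension above [d], and identities are closed
    under composition and inverses. *)
Lemma value_above (H : strict_gpd) (f : gmap G H) m (t : term G m.+1) (x : H m.+1) :
  d <= m -> value f t x -> x = sid (gsrc x).
Proof.
pose Q k := match k return term G k -> Prop with
  | 0 => fun _ => True
  | k.+1 => fun t => forall x, d <= k -> value f t x -> exists y, x = sid y end.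
suff QT k (s : term G k) : Q k s.
  by move=> dm tx; have [y ->] := QT _ t x dm tx; rewrite sid_src.
elim: s => {k} [[|k] a|k s IH|j i p s IH s' IH'|k s IH] //=.
- by move=> w dk; case: (@Gd k.+1 dk a).
- by move=> w _ [y _ ->]; exists y.
- move: p s s' IH IH' => p; destruct p as [|i p] => s s' IH IH' w dk.
    move=> [u [v [e [/(IH _ dk) [y ?] /(IH' _ dk) [z ?] ->]]]]; subst u v.
    have yz : y = z by move: (e); rewrite [LHS]sid_src [RHS]sid_tgt.
    by subst z; exists y; apply: sid_idem.
  move=> [u [v [e [/(IH _ dk) [y ?] /(IH' _ dk) [z ?] ->]]]]; subst u v.
  have e' : isrc p y = itgt p z.
    by rewrite -{1}(sid_src y) -[in RHS](sid_tgt z).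
  by exists (scomp p y z e'); rewrite (sid_comp e' e).
- move=> w dk [u /(IH _ dk) [y ->] ux]; exists y.
  exact: inverse_uniq ux (sid_inverse y).
Qed.

Lemma free_above m (z : free_gpd G m.+1) : d <= m -> z = sid (gsrc z).
Proof.
move=> dm; apply: fval_inj => H f.
have -> := value_above dm (fvalP f z).
rewrite -fval_src; exact: esym (fval_id f _).
Qed.

End Dimension.

Lemma point_contractible : weakly_contractible (free_gpd (gdisk 0)).
Proof.
have G0 m : 0 < m -> gdisk 0 m -> False.
  move=> m0 y; suff : m <= 0 by rewrite leqNgt m0.
  by case: y => [//|k /Lt_ltn/ltnW|k /Lt_ltn/ltnW].
have dim0 (H : strict_gpd) (f : gmap (gdisk 0) H) (t : term (gdisk 0) 0) (u : H 0) :
    value f t u -> u = f 0 Gid.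
  pose Q k := match k return term (gdisk 0) k -> Prop with
    | 0 => fun t => forall w, value f t w -> w = f 0 Gid
    | _.+1 => fun _ => True end.
  suff QT k (s : term (gdisk 0) k) : Q k s by exact: (QT 0).
  elim: s => {k} [[|k] a|//|j [|i] p s _ s' _|//] //= w; last by have := Lt_ltn p.
  move=> ->; congr (f 0 _).
  refine (match a as a' in globe _ i return
    (match i return globe 0 i -> Prop with 0 => fun a => a = Gid | _ => fun=> True end) a'
    with Gid => erefl | Gsig i p => _ | Gtau i p => _ end).
    by case: i p => // p; have := Lt_ltn p.
  by case: i p => // p; have := Lt_ltn p.
have X1 m (u v : free_gpd (gdisk 0) m) : u = v.
  elim: m u v => [|m IH] u v.
    by apply: fval_inj => H f; rewrite (dim0 _ _ _ _ (fvalP f u)) (dim0 _ _ _ _ (fvalP f v)).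
  by rewrite (free_above G0 u) // (free_above G0 v) // (IH (gsrc u) (gsrc v)).
by move=> m u v _; exists (sid u); rewrite sid_src sid_tgt.
Qed.

Lemma globe_bound j i (y : globe j i) : j <= i.
Proof. by case: y => [//|k /Lt_ltn/ltnW|k /Lt_ltn/ltnW]. Qed.

Lemma disk_expansion i :
  is_expansion (gdisk_sig i) (Gid : gdisk i i) (Gid : gdisk i.+1 i.+1).
Proof.
split=> // H f b bf; exists (yo b); split.
  by split=> //; apply: gdisk_ext.
by move=> k [_ <-]; rewrite -yo_uniq.
Qed.

Lemma disk_contractible i : weakly_contractible (free_gpd (gdisk i)).
Proof.
elim: i => [|i IH]; first exact: point_contractible.
exact: expansion_contractible (disk_expansion i) IH.
Qed.

Section Glue.
Variables (G : gset) (j : nat) (g : gmap (gdisk j) G).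

Definition glue i (p : Lt j i) : gset := pushout (yo (G := gdisk i) (Gsig p)) g.
Definition glue_inl i (p : Lt j i) : gmap (gdisk i) (glue p) := pushout_inl _ _.
Definition glue_inr i (p : Lt j i) : gmap G (glue p) := pushout_inr _ _.

Lemma glue_map i (p : Lt j i) (H : gset) (b : H i) (f : gmap G H) :
  isrc p b = f j (g j Gid) -> exists h : gmap (glue p) H,
    h i (glue_inl p i Gid) = b /\ gmap_comp h (glue_inr p) = f.
Proof.
move=> e; have [|h [[hb hf] _]] := @pushout_univ _ _ _ (yo (G := gdisk i) (Gsig p))
  g H (yo b) f.
  exact: gdisk_ext.
exists h; split=> //.
by rewrite -[LHS]/(gmap_comp h (pushout_inl _ _) i Gid) hb.
Qed.

Lemma glue_ext i (p : Lt j i) (H : gset) (h k : gmap (glue p) H) :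
  h i (glue_inl p i Gid) = k i (glue_inl p i Gid) ->
  gmap_comp h (glue_inr p) = gmap_comp k (glue_inr p) -> h = k.
Proof.
move=> e /(f_equal (fun f : gmap G H => fun n => f n)) e'.
have {}e : gmap_comp h (glue_inl p) = gmap_comp k (glue_inl p) by apply: gdisk_ext.
apply: eq_gmap => n; apply: po_ind => c.
  exact: (f_equal (fun f : gmap (gdisk i) H => f n c) e).
exact: (f_equal (fun f => f n c) e').
Qed.

Lemma glue_src i (p : Lt j i) : isrc p (glue_inl p i Gid) = glue_inr p j (g j Gid).
Proof.
by rewrite -gfun_isrc isrc_Gid; exact: (@po_glue _ _ _ (yo (G := gdisk i) (Gsig p)) g j Gid).
Qed.

Lemma glue1_expansion : is_expansion (glue_inr Lt1) (g j Gid) (glue_inl Lt1 j.+1 Gid).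
Proof.
split=> [|H f b bf]; first exact: (glue_src Lt1).
have [h [hb hf]] := @glue_map _ Lt1 H b f bf.
exists h; split=> // k [kf kb]; apply: glue_ext; rewrite ?hb ?hf ?kb ?kf //.
Qed.

(** Since the source of [D_i.+1] factors through [D_i], attaching [D_i.+1] along an
    iterated source amounts to attaching [D_i], and then [D_i.+1] along its source. *)
Lemma glueS_expansion i (p : Lt j i) : exists h : gmap (glue p) (glue (LtS p)),
  is_expansion h (glue_inl p i Gid) (glue_inl (LtS p) i.+1 Gid).
Proof.
have [|h [hb hf]] := @glue_map _ p (glue (LtS p)) (gsrc (glue_inl (LtS p) i.+1 Gid))
  (glue_inr (LtS p)); first exact: (glue_src (LtS p)).
exists h; split=> // H f b bf.
have [|k [kb kf]] := @glue_map _ (LtS p) H b (gmap_comp f (glue_inr p)).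
  by rewrite -[LHS]/(isrc p (gsrc b)) bf -gfun_isrc glue_src.
exists k; split.
  split=> //; apply: glue_ext; first by rewrite /= hb gfun_src kb.
  by rewrite -gmap_compA hf.
move=> l [lf lb]; apply: glue_ext; first by rewrite lb.
by rewrite kf -lf -gmap_compA hf.
Qed.

Lemma glue_contractible i (p : Lt j i) :
  weakly_contractible (free_gpd G) -> weakly_contractible (free_gpd (glue p)).
Proof.
move=> Gc; elim: p => [|k p IH]; first exact: expansion_contractible glue1_expansion Gc.
have [h hx] := glueS_expansion p; exact: expansion_contractible hx IH.
Qed.

End Glue.

Theorem gsum_contractible (T : table) : weakly_contractible (free_gpd (gsum T)).
Proof.
rewrite /gsum; elim: (ttab T) => [i|i i' i2 p q T' IH]; first exact: disk_contractible.
exact: glue_contractible.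
Qed.

Lemma gsum_dim (T : table) m : tab_dim T < m -> gsum T m -> False.
Proof.
rewrite /gsum; elim: (ttab T) m => [i|i i' i2 p q T' IH] m /=.
  by move=> im /globe_bound; rewrite leqNgt im.
rewrite !gtn_max => /andP[im /andP[_ Tm]].
apply: po_ind => [/globe_bound|/(IH _ Tm)//].
by rewrite leqNgt im.
Qed.

(** The arrow joining [h] and [k] has dimension greater than that of [T], and so is an
    identity. *)
Lemma gsum_filler_unique (T : table) m (h k : free_gpd (gsum T) m.+1) :
  tab_dim T <= m.+1 -> gsrc h = gsrc k -> gtgt h = gtgt k -> h = k.
Proof.
move=> Tm s t; have [//|z [zs zt]] := @gsum_contractible T m.+1 h k.
have zE := free_above (@gsum_dim T) z Tm.
by rewrite -zt [in RHS]zE sid_tgt zs.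
Qed.

(** * Unique liftings and functors out of a free globular extension *)

Section DiskMaps.
Variable X : strict_gpd.

Definition cell_of n (f : gpd_map (free_gpd (gdisk n)) X) : X n :=
  f n (free_unit (gdisk n) n Gid).

Definition of_cell n (x : X n) : gpd_map (free_gpd (gdisk n)) X := free_ext (yo x).

Lemma of_cellK n (x : X n) : cell_of (of_cell x) = x.
Proof. exact: (f_equal (fun f : gmap (gdisk n) X => f n Gid) (free_extK (yo x))). Qed.

Lemma cell_of_inj n : injective (@cell_of n).
Proof. by move=> f g fg; apply/free_gpd_ext/gdisk_ext. Qed.

Lemma cell_ofK n (f : gpd_map (free_gpd (gdisk n)) X) : of_cell (cell_of f) = f.
Proof. by apply: cell_of_inj; rewrite of_cellK. Qed.

Lemma cell_of_map (G : gset) n (f : gpd_map (free_gpd G) X) (y : G n) :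
  cell_of (gpd_map_comp f (free_map (yo y))) = f n (free_unit G n y).
Proof.
congr (f n _).
exact: (f_equal (fun k : gmap (gdisk n) (free_gpd G) => k n Gid) (free_map_unit (yo y))).
Qed.

Lemma cell_of_src n (f : gpd_map (free_gpd (gdisk n.+1)) X) :
  cell_of (gpd_map_comp f (free_map (gdisk_sig n))) = gsrc (cell_of f).
Proof. by rewrite [LHS]cell_of_map /cell_of -!gfun_src. Qed.

Lemma cell_of_tgt n (f : gpd_map (free_gpd (gdisk n.+1)) X) :
  cell_of (gpd_map_comp f (free_map (gdisk_tau n))) = gtgt (cell_of f).
Proof. by rewrite [LHS]cell_of_map /cell_of -!gfun_tgt. Qed.

End DiskMaps.

Lemma cell_of_comp (X Y : strict_gpd) n (f : gpd_map X Y)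
    (g : gpd_map (free_gpd (gdisk n)) X) :
  cell_of (gpd_map_comp f g) = f n (cell_of g).
Proof. by []. Qed.

Lemma theta_tilde_table_lifting (T : table) n
    (f g : hom (theta_tilde_globe n) (T : theta_tilde_cat)) :
  globularly_parallel f g -> tab_dim T <= n.+1 -> exists! h, is_lifting f g h.
Proof.
move=> fg Tn.
have [|z [zs zt]] := @gsum_contractible T n (cell_of f) (cell_of g).
  case: n f g fg {Tn} => // n f g [s t].
  by split; [rewrite -!cell_of_src | rewrite -!cell_of_tgt]; congr cell_of.
exists (of_cell z); split.
  by split; apply: cell_of_inj; rewrite [LHS](cell_of_src, cell_of_tgt) of_cellK.
move=> h [hs ht]; apply: cell_of_inj; rewrite of_cellK.
apply: gsum_filler_unique => //.
  by rewrite zs -cell_of_src; congr cell_of.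
by rewrite zt -cell_of_tgt; congr cell_of.
Qed.

Definition lifts_uniquely (D : globular_extension) : Prop :=
  forall (a : disk_pair D), admissible a ->
    exists! h : hom (ge_globe D (dp_dim a).+1) (dp_ob a),
      is_lifting (dp_fst a) (dp_snd a) h.

Lemma parallel_comp (C : category) (K : globe_functor C) n (X Y : C)
    (f g : hom (K n) X) (h : hom X Y) :
  globularly_parallel f g -> globularly_parallel (h \c f) (h \c g).
Proof. by case: n f g => //= n f g [s t]; rewrite -!cmpA s t. Qed.

Lemma lifting_comp (C : category) (K : globe_functor C) n (X Y : C)
    (f g : hom (K n) X) (k : hom (K n.+1) X) (h : hom X Y) :
  is_lifting f g k -> is_lifting (h \c f) (h \c g) (h \c k).
Proof. by move=> [s t]; split; rewrite -cmpA ?s ?t. Qed.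

Lemma theta_tilde_lifts_uniquely : lifts_uniquely theta_tilde.
Proof.
move=> [n X f g] [/= fg [T [c [cs Tn]]]].
have [h [k [_ kh hk]]] := globular_sum_iso cs (free_gsum_theta_tilde T).
have [l [ll lu]] := theta_tilde_table_lifting (parallel_comp h fg) Tn.
exists (k \c l); split.
  by have := lifting_comp k ll; rewrite !cmpA !kh !cmp1m.
by move=> l' /(lifting_comp h) /lu ->; rewrite cmpA kh cmp1m.
Qed.

Lemma parallel_image (C D : category) (F : functor C D) (K : globe_functor C) n (X : C)
    (f g : hom (K n) X) :
  globularly_parallel f g ->
  globularly_parallel (K := push F K) (n := n) (fmor F f) (fmor F g).
Proof. by case: n f g => //= n f g [s t]; rewrite -!fmorM s t. Qed.

Lemma lifting_image (C D : category) (F : functor C D) (K : globe_functor C) n (X : C)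
    (f g : hom (K n) X) (h : hom (K n.+1) X) :
  is_lifting f g h ->
  is_lifting (K := push F K) (n := n) (fmor F f) (fmor F g) (fmor F h).
Proof. by move=> [s t]; split; rewrite -fmorM ?s ?t. Qed.

Section Tower.
Variable D : globular_extension.
Hypothesis D_lifts : lifts_uniquely D.

(** The disks of [D] are the images of those of [C] by an equality of functors on globes
    only; hence the generalization over that functor. *)
Lemma image_lifts_uniquely (C : globular_extension) (F : globular_functor C D)
    (a : disk_pair C) : admissible a ->
  exists! h : hom (F (ge_globe C (dp_dim a).+1)) (F (dp_ob a)),
    is_lifting (K := push F (ge_globe C)) (n := dp_dim a)
      (fmor F (dp_fst a)) (fmor F (dp_snd a)) h.
Proof.
move=> [/(parallel_image F) + [T [c [/(gf_sums F) + Tn]]]].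
set f := fmor F _; set g := fmor F (dp_snd a); set d := cocone_image F c.
move: d f g; rewrite -[F (ge_globe C _)]/(push F (ge_globe C) (dp_dim a)).
rewrite -[F (ge_globe C _)]/(push F (ge_globe C) (dp_dim a).+1).
rewrite gf_under => d f g fg ds.
by apply: (D_lifts (a := DiskPair f g)); split=> //; exists T, d.
Qed.

Section Adds.
Variables (C C' : globular_extension) (I : globular_functor C C').
Variables (A : disk_pair C -> Prop) (l : choice_on A I).
Hypotheses (A_adm : forall a, A a -> admissible a) (adds : formally_adds l).

Lemma adds_extend (F : globular_functor C D) :
  exists G : globular_functor C' D, fcomp G I = F :> functor _ _.
Proof.
have [_ u] := adds.
pose s a (Aa : A a) := constructive_indefinite_description _
  (image_lifts_uniquely F (A_adm Aa)).
have [|G [[GI _] _]] := u D F (fun a Aa => proj1_sig (s a Aa)); last by exists G.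
by move=> a Aa; case: (proj2_sig (s a Aa)).
Qed.

(** Both functors send the added liftings to liftings of the same admissible pairs of [D],
    which are unique. *)
Lemma adds_unique (G G' : globular_functor C' D) :
  fcomp G I = fcomp G' I -> G = G'.
Proof.
move=> e; have [lI u] := adds.
pose F := globular_comp G I.
have lG (H : globular_functor C' D) a (Aa : A a) :
    is_lifting (K := push (fcomp H I) (ge_globe C)) (n := dp_dim a) (X := fcomp H I (dp_ob a))
    (fmor (fcomp H I) (dp_fst a)) (fmor (fcomp H I) (dp_snd a)) (fmor H (l Aa)).
  by have := lifting_image H (lI a Aa).
have [|H [_ Hu]] := u D F (fun a Aa => fmor G (l Aa)); first exact: lG.
rewrite -(Hu G) // -(Hu G') //; split=> // a Aa.
have gen (Q : functor C D) : Q = fcomp G I ->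
    forall h : hom (Q (ge_globe C (dp_dim a).+1)) (Q (dp_ob a)),
    is_lifting (K := push Q (ge_globe C)) (n := dp_dim a)
      (fmor Q (dp_fst a)) (fmor Q (dp_snd a)) h ->
    Arrow h = Arrow (fmor G (l Aa)).
  move=> -> h hl; have [k [_ ku]] := image_lifts_uniquely F (A_adm Aa).
  by rewrite -(ku _ hl) -(ku _ (lG G a Aa)).
exact: gen (esym e) _ (lG G' a Aa).
Qed.

End Adds.

Variables (C : globular_extension) (P : free_presentation C).
Let E := fp_tower P.

Lemma stage_extend n (F : globular_functor (ct_stage E n) D) :
  exists G : globular_functor (ct_stage E n.+1) D,
    fcomp G (ct_map E n) = F :> functor _ _.
Proof. exact: (adds_extend (@ct_admissible E n) (@ct_adds E n)). Qed.

Lemma stage_unique n (G G' : globular_functor (ct_stage E n.+1) D) :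
  fcomp G (ct_map E n) = fcomp G' (ct_map E n) -> G = G'.
Proof. exact: (adds_unique (@ct_admissible E n) (@ct_adds E n)). Qed.

Variable F0 : globular_functor theta0 D.

Fixpoint stage_functor n : globular_functor (ct_stage E n) D :=
  match n return globular_functor (ct_stage E n) D with
  | 0 => F0
  | n.+1 => proj1_sig (constructive_indefinite_description _
              (stage_extend (stage_functor n)))
  end.

Lemma stage_functor_cocone : is_tower_cocone stage_functor.
Proof.
move=> n; exact: (proj2_sig (constructive_indefinite_description _
  (stage_extend (stage_functor n)))).
Qed.

(** The values on the added liftings exist and are forced at each stage of the tower. *)
Theorem free_unique_functor : exists! G : globular_functor C D,
  fcomp G (fp_leg P 0) = F0 :> functor _ _.
Proof.
have [G [Gl Gu]] := fp_colimit stage_functor_cocone.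
exists G; split; first exact: (Gl 0).
move=> G' G'0; apply: Gu => n.
suff e : globular_comp G' (fp_leg P n) = stage_functor n.
  exact: (f_equal (fun H : globular_functor _ _ => gf_functor H) e).
elim: n => [|n IH]; first exact: eq_globular_functor.
apply: stage_unique; rewrite stage_functor_cocone -IH /=.
by rewrite -fcompA (fp_cocone P).
Qed.

End Tower.

Lemma theory_map_eq (C D : globular_theory) (F F' : theory_map C D) :
  F = F' :> functor C D -> F = F'.
Proof.
case: F F' => [F u] [F' u'] /= e; subst F'; congr TheoryMap; exact: proof_irrelevance.
Qed.

Lemma free_theory_map (C : globular_extension) (P : free_presentation C) :
  exists F : theory_map (free_theory P) theta_tilde, forall F', F' = F.
Proof.
have [G [G0 Gu]] := free_unique_functor theta_tilde_lifts_uniquely P theta_tilde_globular.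
exists (@TheoryMap (free_theory P) theta_tilde G G0) => F'.
apply: theory_map_eq; rewrite /=.
by rewrite (Gu (theory_map_globular F')) //; apply: (tm_under F').
Qed.

(** * Lifting compositions and identities *)

Lemma parallel_src_tgt (X : gset) n (x : X n.+1) : parallel (gsrc x) (gtgt x).
Proof. by case: n x => //= n x; rewrite gsrc_src gtgt_src. Qed.

(** The table (i, i; j), whose globular sum consists of two i-arrows that are composable
   in dimension j. *)
Definition pair_table j i (p : Lt j i) : table := Table (TabS p p (Tab1 i)).

Section PairTable.
Variables (j i : nat) (p : Lt j i).

Definition pair_fst : gsum (pair_table p) i := (gsum_legs_rec (TabS p p (Tab1 i))).1.
Definition pair_snd : gsum (pair_table p) i := (gsum_legs_rec (TabS p p (Tab1 i))).2.

Lemma pair_composable : isrc p pair_fst = itgt p pair_snd.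
Proof. by have [] := gsum_legs_matching (TabS p p (Tab1 i)). Qed.

Lemma pair_map (X : gset) (u v : X i) : isrc p u = itgt p v ->
  exists f : gmap (gsum (pair_table p)) X, f i pair_fst = u /\ f i pair_snd = v.
Proof.
move=> uv; have [|f [fuv _]] := @gsum_univ _ (TabS p p (Tab1 i)) X (u, v); first by [].
by exists f; case: fuv.
Qed.

Lemma pair_ext (X : gset) (f g : gmap (gsum (pair_table p)) X) :
  f i pair_fst = g i pair_fst -> f i pair_snd = g i pair_snd -> f = g.
Proof.
move=> e1 e2.
have [|h [_ hu]] := @gsum_univ _ (TabS p p (Tab1 i)) X (g i pair_fst, g i pair_snd).
  split=> //; have e := f_equal (g j) pair_composable.
  by rewrite gfun_isrc gfun_itgt in e.
by rewrite -(hu f) ?(hu g) //= -e1 -e2.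
Qed.

Lemma pair_dim : tab_dim (pair_table p) = i.
Proof. by rewrite /= (maxn_idPr (ltnW (Lt_ltn p))) maxnn. Qed.

Lemma unit_composable : isrc p (free_unit _ i pair_fst) = itgt p (free_unit _ i pair_snd).
Proof. by rewrite -gfun_isrc pair_composable gfun_itgt. Qed.

(** As a map from a disk, the arrow of [theta_tilde] that corepresents composition. *)
Definition pair_comp : free_gpd (gsum (pair_table p)) i := scomp p _ _ unit_composable.

End PairTable.

Lemma free_map_gen (G G' : gset) (f : gmap G G') n (y : G n) :
  free_map f n (free_unit G n y) = free_unit G' n (f n y).
Proof. exact: (f_equal (fun k : gmap G (free_gpd G') => k n y) (free_map_unit f)). Qed.

Lemma pair_comp_value (X : strict_gpd) j i (p : Lt j i)
    (a : gpd_map (free_gpd (gsum (pair_table p))) X) (u v : X i)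
    (e : isrc p u = itgt p v) :
  a i (free_unit _ i (pair_fst p)) = u -> a i (free_unit _ i (pair_snd p)) = v ->
  a i (pair_comp p) = scomp p u v e.
Proof. by move=> ? ?; subst u v; apply: gpd_comp. Qed.

(** Contractibility is expressed with the disks of [C], which are only propositionally
    equal to the images of those of [theta0]. *)
Lemma contractible_lifting (C : globular_extension) (J : globular_functor theta0 C)
    (T : table) n (f g : hom (push J theta0_globe n) (J T)) :
  contractible C -> globularly_parallel f g -> tab_dim T <= n.+1 ->
  exists h, is_lifting f g h.
Proof.
move=> Cc.
suff gen (K : globe_functor C) (eK : K = ge_globe C) (X : C) (f0 g0 : hom (K n) X) :
    globularly_parallel f0 g0 ->
    (exists c : fam (fun n => hom (K n) X) T, is_globular_sum c) ->
    tab_dim T <= n.+1 -> exists h, is_lifting f0 g0 h.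
  move=> fg; apply: gen => //; first exact: globular_under0.
  by eexists; apply: (gf_sums J); apply: gsum_theta0.
subst K => fg [c cs] Tn; apply: (Cc (DiskPair f0 g0)); split=> //.
by exists T, c.
Qed.

(** [Fm] is the action on arrows of a functor from [C] to [theta_tilde] under [theta0],
    the objects being indexed by tables. *)
Section Operations.
Variables (C : globular_extension) (J : globular_functor theta0 C).
Hypothesis C_contractible : contractible C.
Variable Fm : forall S T : table, hom (J S) (J T) ->
  gpd_map (free_gpd (gsum S)) (free_gpd (gsum T)).
Hypothesis FmM : forall (S T U : table) (g : hom (J T) (J U)) (f : hom (J S) (J T)),
  Fm (g \c f) = gpd_map_comp (Fm g) (Fm f).
Hypothesis FmJ : forall (S T : table) (f : gmap (gsum S) (gsum T)),
  Fm (fmor J (f : hom (S : theta0) (T : theta0))) = free_map f.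
Let K := push J theta0_globe.

Definition Jmor (S T : table) (f : gmap (gsum S) (gsum T)) : hom (J S) (J T) :=
  fmor J (f : hom (S : theta0) (T : theta0)).

Lemma JmorM (S T U : table) (g : gmap (gsum T) (gsum U)) (f : gmap (gsum S) (gsum T)) :
  Jmor g \c Jmor f = Jmor (gmap_comp g f).
Proof. by rewrite /Jmor -fmorM. Qed.

Lemma Fm_src (T : table) n (c : hom (J (dtable n.+1)) (J T)) :
  gsrc (cell_of (Fm c)) = cell_of (Fm (c \c sig K n)).
Proof. by rewrite FmM [Fm (sig K n)]FmJ cell_of_src. Qed.

Lemma Fm_tgt (T : table) n (c : hom (J (dtable n.+1)) (J T)) :
  gtgt (cell_of (Fm c)) = cell_of (Fm (c \c tau K n)).
Proof. by rewrite FmM [Fm (tau K n)]FmJ cell_of_tgt. Qed.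

Lemma lifted_gen (T : table) n (y : gsum T n) :
  exists c : hom (J (dtable n)) (J T), cell_of (Fm c) = free_unit _ n y.
Proof.
exists (Jmor (S := dtable n) (yo y)); rewrite FmJ.
exact: (cell_of_map (gpd_map_id _)).
Qed.

Lemma lifted_id n : exists c : hom (J (dtable n.+1)) (J (dtable n)),
  cell_of (Fm c) = sid (free_unit (gdisk n) n Gid).
Proof.
have [||c [cs ct]] := @contractible_lifting C J (dtable n) n (idm _) (idm _) C_contractible.
- by case: (n).
- exact: leqnSn.
have F1 : cell_of (Fm (idm (J (dtable n)))) = free_unit (gdisk n) n Gid.
  by rewrite -(fmor1 J) FmJ -[idm _]/(gmap_id _) free_map1.
exists c; apply: (@gsum_filler_unique (dtable n)); first exact: leqnSn.
- by rewrite sid_src Fm_src [X in Fm X]cs.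
- by rewrite sid_tgt Fm_tgt [X in Fm X]ct.
Qed.

(** The induction is on [p]. For [i = j.+1], the source of the arrow to be constructed
    is that of the second generator, and its target that of the first; otherwise they are
    the previous arrow followed by the maps [s] and [t] that take sources and targets of
    both generators. The second part of the statement makes these two arrows parallel in
    [C], which cannot be deduced from their images. *)
Lemma lifted_comp j i (p : Lt j i) :
  exists c : hom (J (dtable i)) (J (pair_table p)),
    cell_of (Fm c) = pair_comp p /\
    forall (T : table) (f g : gmap (gsum (pair_table p)) (gsum T)),
      parallel (f i (pair_fst p)) (g i (pair_fst p)) ->
      parallel (f i (pair_snd p)) (g i (pair_snd p)) ->
      globularly_parallel (K := K) (n := i) (Jmor f \c c) (Jmor g \c c).
Proof.
have jsig n (T : table) (x : gsum T n.+1) :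
    Jmor (S := dtable n.+1) (yo x) \c sig K n = Jmor (S := dtable n) (yo (gsrc x)).
  by rewrite [LHS](@JmorM (dtable n) (dtable n.+1)); congr Jmor; apply: gdisk_ext.
have jtau n (T : table) (x : gsum T n.+1) :
    Jmor (S := dtable n.+1) (yo x) \c tau K n = Jmor (S := dtable n) (yo (gtgt x)).
  by rewrite [LHS](@JmorM (dtable n) (dtable n.+1)); congr Jmor; apply: gdisk_ext.
have jyo n (S T : table) (h : gmap (gsum S) (gsum T)) (y : gsum S n) :
    Jmor h \c Jmor (S := dtable n) (yo y) = Jmor (S := dtable n) (yo (h n y)).
  by rewrite JmorM; congr Jmor; apply: gdisk_ext.
elim: p => [|k p [c [cE cP]]].
- set u := pair_fst _; set v := pair_snd _.
  have uv : gsrc u = gtgt v := pair_composable Lt1.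
  have [||c [cs ct]] := @contractible_lifting C J (pair_table (@Lt1 j)) j
    (Jmor (S := dtable j) (yo (gsrc v))) (Jmor (S := dtable j) (yo (gtgt u))) C_contractible.
  + case: j u v uv => // j u v uv; split.
      by rewrite !jsig gsrc_src -uv gsrc_src.
    by rewrite !jtau gtgt_src -uv gtgt_src.
  + by rewrite pair_dim.
  exists c; split; last first.
    move=> T f g [us ut] [vs vt]; split.
      by rewrite -!cmpA [c \c _]cs !jyo !gfun_src vs.
    by rewrite -!cmpA [c \c _]ct !jyo !gfun_tgt ut.
  apply: (@gsum_filler_unique (pair_table Lt1)); first by rewrite pair_dim.
    rewrite Fm_src [X in Fm X]cs FmJ [LHS](cell_of_map (gpd_map_id _)).
    by rewrite [RHS](scomp_src1 (unit_composable _)) [LHS](gfun_src (free_unit _)).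
  rewrite Fm_tgt [X in Fm X]ct FmJ [LHS](cell_of_map (gpd_map_id _)).
  by rewrite [RHS](scomp_tgt1 (unit_composable _)) [LHS](gfun_tgt (free_unit _)).
- set u := pair_fst _; set v := pair_snd _.
  have uv : isrc (LtS p) u = itgt (LtS p) v := pair_composable (LtS p).
  have [|s [su sv]] := @pair_map _ _ p _ (gsrc u) (gsrc v).
    by rewrite -[LHS]/(isrc (LtS p) u) uv [LHS]itgt_tgt.
  have [|t [tu tv]] := @pair_map _ _ p _ (gtgt u) (gtgt v).
    by rewrite -isrc_src.
  have [||h [hs ht]] := @contractible_lifting C J (pair_table (LtS p)) k
    (Jmor s \c c) (Jmor t \c c) C_contractible.
  + by apply: cP; rewrite ?su ?tu ?sv ?tv; apply: parallel_src_tgt.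
  + by rewrite pair_dim.
  exists h; split; last first.
    move=> T f g [us ut] [vs vt]; split.
      rewrite -!cmpA [h \c _]hs !cmpA !JmorM; congr (Jmor _ \c _).
      by apply: pair_ext; rewrite /= ?su ?sv -?gfun_src in us vs *.
    rewrite -!cmpA [h \c _]ht !cmpA !JmorM; congr (Jmor _ \c _).
    by apply: pair_ext; rewrite /= ?tu ?tv -?gfun_tgt in ut vt *.
  apply: (@gsum_filler_unique (pair_table (LtS p))); first by rewrite pair_dim.
    have e : isrc p (gsrc (free_unit _ _ u)) = itgt p (gsrc (free_unit _ _ v)).
      by rewrite -!gfun_src -su -sv -gfun_isrc -!gfun_isrc pair_composable !gfun_itgt.
    rewrite Fm_src [X in Fm X]hs FmM FmJ cell_of_comp cE.
    rewrite [RHS](scomp_srcS _ e); apply: pair_comp_value.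
      by rewrite free_map_gen su gfun_src.
    by rewrite free_map_gen sv gfun_src.
  have e : isrc p (gtgt (free_unit _ _ u)) = itgt p (gtgt (free_unit _ _ v)).
    by rewrite -!gfun_tgt -tu -tv -gfun_isrc -!gfun_isrc pair_composable !gfun_itgt.
  rewrite Fm_tgt [X in Fm X]ht FmM FmJ cell_of_comp cE.
  rewrite [RHS](scomp_tgtS _ e); apply: pair_comp_value.
    by rewrite free_map_gen tu gfun_tgt.
  by rewrite free_map_gen tv gfun_tgt.
Qed.

(** * Full faithfulness *)

Section Natural.
Variables (G H : strict_gpd).
Variable psi : forall T : table,
  gpd_map (free_gpd (gsum T)) G -> gpd_map (free_gpd (gsum T)) H.
Hypothesis psiN : forall (S T : table) (c : hom (J S) (J T)) 
    (a : gpd_map (free_gpd (gsum T)) G),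
  psi (gpd_map_comp a (Fm c)) = gpd_map_comp (psi a) (Fm c).

Definition psi_fun n (x : G n) : H n := cell_of (psi (T := dtable n) (of_cell x)).

(** Naturality with respect to [c], since a map from a free oo-groupoid on a disk is a
    cell. *)
Lemma psi_lifted (T : table) n (c : hom (J (dtable n)) (J T)) (z : free_gpd (gsum T) n)
    (a : gpd_map (free_gpd (gsum T)) G) :
  cell_of (Fm c) = z -> psi a n z = psi_fun (a n z).
Proof.
move=> <-; rewrite -[LHS](cell_of_comp (psi a) (Fm c)) -(psiN c a) /psi_fun.
by rewrite -[a n _](cell_of_comp a (Fm c)) cell_ofK.
Qed.

Lemma psi_gen (T : table) n (y : gsum T n) (a : gpd_map (free_gpd (gsum T)) G) :
  psi a n (free_unit _ n y) = psi_fun (a n (free_unit _ n y)).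
Proof. by have [c cy] := lifted_gen y; apply: psi_lifted cy. Qed.

Lemma of_cell_src n (x : G n.+1) :
  of_cell x n (free_unit (gdisk n.+1) n (gsrc (Gid : gdisk n.+1 n.+1))) = gsrc x.
Proof. by rewrite !gfun_src; congr gsrc; apply: of_cellK. Qed.

Lemma of_cell_tgt n (x : G n.+1) :
  of_cell x n (free_unit (gdisk n.+1) n (gtgt (Gid : gdisk n.+1 n.+1))) = gtgt x.
Proof. by rewrite !gfun_tgt; congr gtgt; apply: of_cellK. Qed.

Lemma psi_src n (x : G n.+1) : psi_fun (gsrc x) = gsrc (psi_fun x).
Proof.
by rewrite -{1}(of_cell_src x) -(@psi_gen (dtable n.+1)) /psi_fun /cell_of !gfun_src.
Qed.

Lemma psi_tgt n (x : G n.+1) : psi_fun (gtgt x) = gtgt (psi_fun x).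
Proof.
by rewrite -{1}(of_cell_tgt x) -(@psi_gen (dtable n.+1)) /psi_fun /cell_of !gfun_tgt.
Qed.

Definition psi_gmap : gmap G H := GMap psi_src psi_tgt.

Lemma psi_comp j i (p : Lt j i) (u v : G i) (e : isrc p u = itgt p v)
    (e' : isrc p (psi_gmap i u) = itgt p (psi_gmap i v)) :
  psi_gmap i (scomp p u v e) = scomp p (psi_gmap i u) (psi_gmap i v) e'.
Proof.
have [f [fu fv]] := pair_map e.
have [c [cE _]] := lifted_comp p.
have gen y : free_ext f i (free_unit _ i y) = f i y.
  exact: (f_equal (fun k : gmap _ G => k i y) (free_extK f)).
have fE : free_ext f i (pair_comp p) = scomp p u v e.
  by apply: pair_comp_value; rewrite gen.
rewrite -fE -[LHS](psi_lifted (T := pair_table p) (free_ext f) cE).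
by apply: pair_comp_value; rewrite psi_gen gen ?fu ?fv.
Qed.

Lemma psi_id i (u : G i) : psi_gmap i.+1 (sid u) = sid (psi_gmap i u).
Proof.
have [c cE] := lifted_id i.
rewrite -{1}(of_cellK u) -(gpd_id (of_cell u)).
by rewrite -[LHS](psi_lifted (T := dtable i) (of_cell u) cE) gpd_id.
Qed.

Definition psi_map : gpd_map G H := GpdMap psi_comp psi_id.

Lemma psi_mapE (T : table) (a : gpd_map (free_gpd (gsum T)) G) :
  psi a = gpd_map_comp psi_map a.
Proof. by apply: free_gpd_ext; apply: eq_gmap => n y; apply: psi_gen. Qed.

Lemma natural_unique : exists! m : gpd_map G H,
  forall (T : table) (a : gpd_map (free_gpd (gsum T)) G), psi a = gpd_map_comp m a.
Proof.
exists psi_map; split; first exact: psi_mapE.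
move=> m mE; apply: eq_gpd_map => n x.
rewrite -[LHS]/(psi_fun x) /psi_fun mE cell_of_comp; congr (m n _); exact: of_cellK.
Qed.

End Natural.
End Operations.

(** The functor is a variable here, so that its action on objects, which is only
    propositionally equal to the identity, can be replaced by the identity. *)
Lemma natural_over_unique (C : globular_extension) (J : globular_functor theta0 C)
    (F : functor (full_on (fun T : theta0 => J T)) theta_tilde_cat)
    (G H : strict_gpd) :
  contractible C ->
  fcomp F (@Functor theta0_cat (full_on (fun T : theta0 => J T)) (fun T => T)
    (fun S T f => fmor J f) (fun T => fmor1 J T) (fun S T U g f => fmorM J g f)) =
    theta_tilde_functor ->
  forall psi : natural (restrict F (gpd_presheaf G)) (restrict F (gpd_presheaf H)),
  exists! m : gpd_map G H, forall T a, psi T a = gpd_map_comp m a.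
Proof.
move=> Cc e; have eo : fob F = id := f_equal (@fob _ _) e.
case: F eo e => o fm f1 fM /= eo; subst o => e.
have fmJ := fmor_of_eq e erefl; rewrite /= in fmJ.
move=> psi.
apply: (@natural_unique C J Cc fm) => //.
- by move=> S T f; have := f_equal (fun k => k S T f) fmJ.
- by move=> S T c a; apply: (nat_mor psi).
Qed.

Lemma theory_map_fully_faithful (C : globular_theory) (F : theory_map C theta_tilde) :
  contractible C -> fully_faithful (fcomp (model_restrict F) gpd_nerve).
Proof.
move=> Cc G H g; pose J := gt_theta0 C.
pose B := full_on (fun T : theta0 => J T).
pose FB : functor B theta_tilde_cat := fcomp F (full_on_incl _).
pose psi : natural (restrict FB (gpd_presheaf G)) (restrict FB (gpd_presheaf H)) :=
  @Natural B (restrict FB (gpd_presheaf G)) (restrict FB (gpd_presheaf H))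
    (fun T => (g : natural _ _) (J T)) (fun S T c a => nat_mor (g : natural _ _) c a).
have [|m [mE mu]] := @natural_over_unique C J FB G H Cc _ psi.
  rewrite -[RHS](tm_under F); exact: eq_functor.
exists m; split.
  apply: eq_natural => x; have [T [<- _]] := gt_bij x.
  by move=> a; exact: esym (mE T a).
move=> m' e; apply: mu => T a.
pose P := restrict F (gpd_presheaf G); pose Q := restrict F (gpd_presheaf H).
exact: (f_equal (fun h : natural P Q => h (J T) a) (esym e)).
Qed.

Theorem theorem8p1 (C : coherator) :
  exists F : theory_map (coh_theory C) theta_tilde,
    (forall F' : theory_map (coh_theory C) theta_tilde, F' = F) /\
    fully_faithful (fcomp (model_restrict F) gpd_nerve).
Proof.
have [F Fu] := free_theory_map (coh_free C).
exists F; split=> //; apply: theory_map_fully_faithful.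
exact: coh_contractible C.
Qed.
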